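(* Let $n\ge 2$, $p$, $k$, $l$ be integers with $1\le p\le n-1$ and $0\le l<k\le N=\binom{n}{p}$. Let $\Omega\subset\mathbb{R}^{n}$ be a (bounded) $C^3$ strictly convex domain with outer unit normal $\nu$, let $f$ be a positive function with $f^{\frac{1}{k-l}}\in C^{1}(\overline{\Omega})$ and let $\varphi\in C^{2}(\partial\Omega)$. Suppose that $\varepsilon\in(0,1)$ and that $u\in C^{3}(\Omega)\cap C^{2}(\overline{\Omega})$ is a $(\Lambda,k)$-admissible solution of $$\begin{cases}\dfrac{\sigma_k(\Lambda(D^2 u))}{\sigma_l(\Lambda(D^2 u))}=f(x)&\text{in }\Omega,\\[2mm] u_\nu=-\varepsilon u+\varphi(x)&\text{on }\partial\Omega.\end{cases}$$ Then $$\sup_{\overline{\Omega}}|Du|\le M_{1},$$ where $M_{1}$ depends only on $n,k,l,p,M_{0},|\varphi|_{C^2},|f^{\frac{1}{k-l}}|_{C^1}$ and $\Omega$ (in particular $M_1$ is independent of $\varepsilon$). Here $M_0$ denotes a bound $\max_{\overline\Omega}|\varepsilon u|\le M_0$.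
   Context: Let $\mathfrak{J}(p,n)$ be the set of multi-indices $I=(i_1,\dots,i_p)$ with $1\le i_1<\cdots<i_p\le n$, enumerated in a fixed order as $I_1,\dots,I_N$, $N=\binom{n}{p}$. If $\lambda_1,\dots,\lambda_n$ are the eigenvalues of the Hessian $D^2u$, put $\Lambda_I(D^2u)=\lambda_{i_1}+\cdots+\lambda_{i_p}$ and $\Lambda(D^2u)=(\Lambda_{I_1}(D^2u),\dots,\Lambda_{I_N}(D^2u))\in\mathbb{R}^N$. $\sigma_m$ is the $m$-th elementary symmetric function on $\mathbb{R}^N$, with $\sigma_0=1$. Let $\tilde\Gamma_k=\{\mu\in\mathbb{R}^N:\sigma_j(\mu)>0,\ 1\le j\le k\}$. A $C^2$ function $u$ is called $(\Lambda,k)$-admissible if $\Lambda(D^2u(x))\in\tilde\Gamma_k$ for every $x\in\Omega$. Strict convexity of the domain $\Omega$ means that the principal curvatures of $\partial\Omega$ are bounded below by a positive constant. $u_\nu$ denotes the derivative of $u$ in the direction $\nu$. *)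

(* Defs.v *)
From HB Require Import structures.
From mathcomp Require Import all_boot all_order all_algebra.
From mathcomp Require Import all_classical all_reals all_analysis.
Import Order.TTheory GRing.Theory Num.Theory.
Import numFieldNormedType.Exports.

Set Implicit Arguments.
Unset Strict Implicit.
Unset Printing Implicit Defensive.

Local Open Scope classical_set_scope.
Local Open Scope ring_scope.

(* The norm that the library puts on 'rV[R]_n is the max norm, hence the
   explicit Euclidean structure. *)
Definition dot (R : realType) (n : nat) (v w : 'rV[R]_n) : R :=
  \sum_(i < n) v 0 i * w 0 i.

Definition enorm (R : realType) (n : nat) (v : 'rV[R]_n) : R :=
  Num.sqrt (dot v v).

Definition boundary (T : topologicalType) (A : set T) : set T :=
  closure A `\` A°.

Definition partial (R : realType) (n : nat) (i : 'I_n) (f : 'rV[R]_n -> R)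
  : 'rV[R]_n -> R :=
  fun x => 'D_(delta_mx 0 i) f x.

Definition partials (R : realType) (n : nat) (s : seq 'I_n)
  (f : 'rV[R]_n -> R) : 'rV[R]_n -> R :=
  foldr (@partial R n) f s.

Definition grad (R : realType) (n : nat) (f : 'rV[R]_n -> R) (x : 'rV[R]_n)
  : 'rV[R]_n :=
  \row_(i < n) partial i f x.

Definition hessian (R : realType) (n : nat) (f : 'rV[R]_n -> R)
  (x : 'rV[R]_n) : 'M[R]_n :=
  \matrix_(i < n, j < n) partials [:: i; j] f x.

(* f is of class C^m on the open set U. *)
Definition C_open (R : realType) (n : nat) (m : nat) (U : set 'rV[R]_n)
  (f : 'rV[R]_n -> R) : Prop :=
  (forall (s : seq 'I_n) (i : 'I_n) (x : 'rV[R]_n), (size s < m)%N -> U x ->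
     derivable (partials s f) x (delta_mx 0 i)) /\
  (forall (s : seq 'I_n) (x : 'rV[R]_n), (size s <= m)%N -> U x ->
     {for x, continuous (partials s f)}).

(* f is in C^m of the closure of Omega: f is C^m in Omega, and the derivatives
   of f of order at most m extend continuously to the closure, the extension
   for order 0 being f itself. *)
Definition C_closure (R : realType) (n : nat) (m : nat)
  (Omega : set 'rV[R]_n) (f : 'rV[R]_n -> R) : Prop :=
  [/\ C_open m Omega f,
      {within closure Omega, continuous f} &
      forall s : seq 'I_n, (size s <= m)%N ->
        exists h : 'rV[R]_n -> R,
          {within closure Omega, continuous h} /\
          (forall x, Omega x -> h x = partials s f x)].

(* phi is of class C^m on the boundary of Omega; the values of phi outside of
   the boundary are irrelevant. *)
Definition C_boundary (R : realType) (n : nat) (m : nat)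
  (Omega : set 'rV[R]_n) (phi : 'rV[R]_n -> R) : Prop :=
  forall x, boundary Omega x ->
    exists (U : set 'rV[R]_n) (Phi : 'rV[R]_n -> R),
      [/\ open U, U x, C_open m U Phi &
          forall y, boundary Omega y -> U y -> Phi y = phi y].

(* sum_(j <= m) sup_Omega max_(|beta| = j) |D^beta f|; every sup is finite when
   f is in C_closure m Omega with Omega bounded. *)
Definition normC (R : realType) (n : nat) (m : nat) (Omega : set 'rV[R]_n)
  (f : 'rV[R]_n -> R) : R :=
  \sum_(j < m.+1)
    sup [set `|partials s f x| | s in [set s : seq 'I_n | size s = j]
                               & x in Omega].

(* The norm of C^m(boundary Omega): infimum of the C^m norms of the extensions
   to the closure of Omega (Gilbarg-Trudinger, section 6.2). *)
Definition normC_boundary (R : realType) (n : nat) (m : nat)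
  (Omega : set 'rV[R]_n) (phi : 'rV[R]_n -> R) : R :=
  inf [set normC m Omega Phi | Phi in
        [set Phi : 'rV[R]_n -> R | C_closure m Omega Phi /\
           forall x, boundary Omega x -> Phi x = phi x]].

(* Value at a point x of the closure of Omega of the continuous extension
   of g. *)
Definition extension (R : realType) (n : nat) (Omega : set 'rV[R]_n)
  (g : 'rV[R]_n -> R) (x : 'rV[R]_n) : R :=
  lim (g y @[y --> within Omega (nbhs x)]).

Definition grad_closure (R : realType) (n : nat) (Omega : set 'rV[R]_n)
  (f : 'rV[R]_n -> R) (x : 'rV[R]_n) : 'rV[R]_n :=
  \row_(i < n) extension Omega (partial i f) x.

Definition dirder_closure (R : realType) (n : nat) (Omega : set 'rV[R]_n)
  (f : 'rV[R]_n -> R) (v : 'rV[R]_n) (x : 'rV[R]_n) : R :=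
  dot (grad_closure Omega f x) v.

(* rho is a C^m defining function of Omega in the neighborhood U of x. *)
Definition local_defining (R : realType) (n : nat) (m : nat)
  (Omega : set 'rV[R]_n) (x : 'rV[R]_n) (U : set 'rV[R]_n)
  (rho : 'rV[R]_n -> R) : Prop :=
  [/\ open U /\ U x, C_open m U rho,
      forall y, U y -> grad rho y != 0,
      forall y, U y -> (Omega y <-> rho y < 0) &
      forall y, U y -> (boundary Omega y <-> rho y = 0)].

Definition bounded_domain (R : realType) (n : nat) (Omega : set 'rV[R]_n)
  : Prop :=
  [/\ Omega !=set0, open Omega, connected Omega & bounded_set Omega].

Definition C_domain (R : realType) (n : nat) (m : nat)
  (Omega : set 'rV[R]_n) : Prop :=
  bounded_domain Omega /\
  forall x, boundary Omega x ->
    exists (U : set 'rV[R]_n) (rho : 'rV[R]_n -> R),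
      local_defining m Omega x U rho.

Definition unit_grad (R : realType) (n : nat) (rho : 'rV[R]_n -> R)
  (x : 'rV[R]_n) : 'rV[R]_n :=
  (enorm (grad rho x))^-1 *: grad rho x.

Definition outer_unit_normal (R : realType) (n : nat) (Omega : set 'rV[R]_n)
  (x v : 'rV[R]_n) : Prop :=
  exists (U : set 'rV[R]_n) (rho : 'rV[R]_n -> R),
    local_defining 1 Omega x U rho /\ v = unit_grad rho x.

(* kappa is an eigenvalue of the shape operator tau |-> D_tau nu on the tangent
   space of the boundary at x, where the outer unit normal nu is extended to a
   neighborhood by unit_grad rho.  With this sign the principal curvatures of a
   ball of radius r are 1 / r. *)
Definition principal_curvature (R : realType) (n : nat)
  (Omega : set 'rV[R]_n) (x : 'rV[R]_n) (kappa : R) : Prop :=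
  exists (U : set 'rV[R]_n) (rho : 'rV[R]_n -> R) (tau : 'rV[R]_n),
    [/\ local_defining 2 Omega x U rho, tau != 0,
        dot tau (grad rho x) = 0 &
        'D_tau (unit_grad rho) x = kappa *: tau].

Definition strictly_convex (R : realType) (n : nat) (Omega : set 'rV[R]_n)
  : Prop :=
  exists2 kappa0 : R, 0 < kappa0 &
    forall (x : 'rV[R]_n) (kappa : R), boundary Omega x ->
      principal_curvature Omega x kappa -> kappa0 <= kappa.

(* The n eigenvalues of A, with multiplicity and in some order, when the
   characteristic polynomial of A splits over R, as it does for symmetric A;
   0 otherwise. *)
Definition eigenvalues (R : realType) (n : nat) (A : 'M[R]_n) : 'rV[R]_n :=
  xget 0 [set lambda : 'rV[R]_n |
            char_poly A = \prod_(i < n) ('X - (lambda 0 i)%:P)].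

(* A multi-index i_1 < ... < i_p is represented by the set of its entries;
   the j-th one in a fixed enumeration, for j < 'C(n, p). *)
Definition multi_index (n p : nat) (j : 'I_('C(n, p))) : {set 'I_n} :=
  nth finset.set0 (enum [set I : {set 'I_n} | #|I| == p]%SET) j.

Definition Lambda (R : realType) (n p : nat) (A : 'M[R]_n)
  : 'rV[R]_('C(n, p)) :=
  \row_(j < 'C(n, p)) \sum_(i in multi_index j) eigenvalues A 0 i.

Definition sigma (R : realType) (N m : nat) (mu : 'rV[R]_N) : R :=
  \sum_(J : {set 'I_N} | #|J| == m) \prod_(i in J) mu 0 i.

Definition Gamma_cone (R : realType) (N k : nat) : set 'rV[R]_N :=
  [set mu | forall j : nat, (1 <= j <= k)%N -> 0 < sigma j mu].

Definition admissible (R : realType) (n p k : nat) (Omega : set 'rV[R]_n)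
  (u : 'rV[R]_n -> R) : Prop :=
  C_open 2 Omega u /\
  forall x, Omega x -> Gamma_cone k (Lambda p (hessian u x)).

Definition neumann_solution (R : realType) (n p k l : nat)
  (Omega : set 'rV[R]_n) (nu : 'rV[R]_n -> 'rV[R]_n)
  (f phi : 'rV[R]_n -> R) (eps : R) (u : 'rV[R]_n -> R) : Prop :=
  (forall x, Omega x ->
     sigma k (Lambda p (hessian u x)) / sigma l (Lambda p (hessian u x))
       = f x) /\
  (forall x, boundary Omega x ->
     dirder_closure Omega u (nu x) x = - eps * u x + phi x).

(* Main.v *)
(* The function W(x, xi) = u_xi - <N, xi> (Phi - eps u) + eps^2 u^2 + K |x|^2 is
   maximised over x in the closure of Omega and unit vectors xi, where N and Phi
   are C^2 extensions of the outer normal and of phi.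
   If the maximum were interior, the vanishing of the first derivatives and the
   sign of the second ones would give
   D_xi D^2 u <= - c D^2 u - (2 K - C) I with c bounded.  The operator
   A |-> (sigma_k / sigma_l)^(1 / (k - l)) (Lambda(A)) is nondecreasing,
   homogeneous of degree one and grows at least linearly along the identity, so
   for K large this contradicts the bound on the derivatives of f^(1 / (k - l)).
   Hence the maximum is on the boundary, and there the optimal xi is the direction
   of the tangential gradient.  Differentiating the Neumann condition along xi
   and using that the outer normal derivative of W is nonnegative bounds
   kappa0 |Du_tangential|, where kappa0 bounds the principal curvatures from
   below.  The Neumann condition bounds the normal derivative; the term
   eps^2 u^2 absorbs what the factor - eps u contributes to the Hessian of W. *)
Require Import Defs.
From HB Require Import structures.
From mathcomp Require Import all_boot all_order all_algebra.
From mathcomp Require Import all_classical all_reals all_analysis.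
From mathcomp Require Import perm complex polyorder ring lra zify.
Import Order.TTheory GRing.Theory Num.Theory.
Import numFieldNormedType.Exports.
Set Implicit Arguments.
Unset Strict Implicit.
Unset Printing Implicit Defensive.
Local Open Scope classical_set_scope.
Local Open Scope ring_scope.
Local Open Scope sesquilinear_scope.

(** * Elementary symmetric functions of eigenvalues *)

(** The operator is never linearised. At an interior maximum [x], the Hessians of [u] at [x] and at
    [x + t *: xi] are compared as matrices for one small [t > 0]. This uses only order properties of
    the operator, and its monotonicity and its growth both rest on Newton's inequalities for
    real-rooted polynomials. On the boundary [u] has two derivatives that extend continuously to the
    closure and no values beyond it, so differentiation there means first-order expansions along the
    closure and along curves in the boundary. Maximising over [xi] too lets one function serve
    everywhere: the maximum of W over unit vectors is [|h| + eps^2 u^2 + K |x|^2] with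
    [h = Du - (Phi - eps u) N]. On the boundary the Neumann condition makes [h] orthogonal to the
    normal, so the optimal [xi] is tangent without any case distinction on directions. Uniformity in
    [eps] holds because [u] enters the bounds only through [eps * u], because [eps < 1], and because
    the one remaining term, [eps] times the length of the tangential gradient, has the favourable
    sign. *)

Lemma horner_deriv_prod_XsubC (F : fieldType) (s : seq F) (z : F) :
  z \notin s ->
  (\prod_(a <- s) ('X - a%:P))^`().[z] =
  (\prod_(a <- s) (z - a)) * \sum_(a <- s) (z - a)^-1.
Proof.
elim: s => [|a s IHs]; first by rewrite !big_nil derivC horner0 mulr0.
rewrite in_cons negb_or => /andP[za zs].
rewrite !big_cons derivM derivXsubC mul1r hornerD hornerM (IHs zs).
rewrite hornerXsubC horner_prod.
have -> : \prod_(i <- s) ('X - i%:P).[z] = \prod_(i <- s) (z - i).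
  by apply: eq_bigr => i _; rewrite hornerXsubC.
by field; rewrite subr_eq0.
Qed.

(** For real [a] the imaginary part of [1 / (z - a)] is [- Im z / |z - a|^2], so all summands have
    the same sign and cannot cancel; [c] is the sum of the [1 / |z - a|^2]. *)
Lemma Im_sum_inv (R : rcfType) (s : seq R) (z : R[i]) : complex.Im z != 0 ->
  exists2 c : R, 0 <= c & (s != [::] -> 0 < c) /\
  complex.Im (\sum_(a <- s) (z - (a%:C)%C)^-1) = - complex.Im z * c.
Proof.
move=> z0; elim: s => [|a s [c c0 [_ IHs]]].
  by exists 0 => //; split=> //; rewrite big_nil mulr0.
case: z z0 IHs => x y /= y0 IHs.
have d0 : 0 < (x - a) ^+ 2 + y ^+ 2.
  by rewrite ltr_wpDl ?sqr_ge0// exprn_even_gt0.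
exists (((x - a) ^+ 2 + y ^+ 2)^-1 + c).
  by rewrite addr_ge0// invr_ge0 ltW.
split; first by move=> _; rewrite ltr_wpDr// invr_gt0.
rewrite big_cons raddfD /= IHs /=.
by rewrite ?(oppr0, addr0, subr0); ring.
Qed.

(* Gauss-Lucas: above the real axis, the logarithmic derivative of a split real
   polynomial has negative imaginary part. *)
Lemma deriv_prod_XsubC (R : rcfType) (s : seq R) : s != [::] ->
  exists t : seq R, (size t).+1 = size s /\
    (\prod_(a <- s) ('X - a%:P))^`() =
    (size s)%:R *: \prod_(b <- t) ('X - b%:P).
Proof.
move=> s0; set p := \prod_(a <- s) _.
have n0 : (size s)%:R != 0 :> R by rewrite pnatr_eq0 size_eq0.
have pmon : p \is monic by exact: monic_prod_XsubC.
have szp : size p = (size s).+1 by rewrite size_prod_XsubC.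
have szp' : size p^`() = size s.
  by rewrite size_deriv szp.
have lcp' : lead_coef p^`() = (size s)%:R.
  rewrite lead_coefE szp' coef_deriv prednK ?lt0n ?size_eq0//.
  by have := monicP pmon; rewrite lead_coefE szp/= => ->.
pose toC := real_complex R.
have pCE : map_poly toC p = \prod_(a <- [seq toC a | a <- s]) ('X - a%:P).
  rewrite rmorph_prod big_map; apply: eq_bigr => a _.
  by rewrite rmorphB/= map_polyX map_polyC.
(* The derivative is factored over the complex field; once its roots are known to be real, their
   real parts are the wanted [t]. *)
have [r qr] := closed_field_poly_normal (map_poly toC p^`()).
have q0 : map_poly toC p^`() != 0 by rewrite map_poly_eq0 -size_poly_eq0 szp' size_eq0.
have rreal z : z \in r -> toC (complex.Re z) = z.
  move=> zr; have [z0|z0] := eqVneq (complex.Im z) 0.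
    by case: z z0 {zr} => x y /= ->.
  have : root (map_poly toC p^`()) z.
    by rewrite qr rootZ ?lead_coef_eq0// root_prod_XsubC.
  have zs : z \notin [seq toC a | a <- s].
    by apply: contra z0 => /mapP[a _ ->].
  rewrite -deriv_map pCE /root horner_deriv_prod_XsubC// mulf_eq0.
  move=> /orP[/eqP H|]; last first.
    rewrite big_map => /eqP H; have [c _ [/(_ s0) c0]] := Im_sum_inv s z0.
    by rewrite H /= => /esym/eqP; rewrite mulf_eq0 oppr_eq0 (negPf z0) (gt_eqF c0).
  have : \prod_(a <- [seq toC a | a <- s]) (z - a) != 0.
    rewrite prodf_seq_neq0; apply/allP => a sa /=.
    by rewrite subr_eq0; apply: contraNneq zs => ->.
  by rewrite H eqxx.
exists [seq complex.Re z | z <- r].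
have E : p^`() = (size s)%:R *: \prod_(b <- [seq complex.Re z | z <- r]) ('X - b%:P).
  apply: (map_poly_inj toC); rewrite qr linearZ/= lead_coef_map lcp'.
  congr (_ *: _); rewrite rmorph_prod big_map big_seq [RHS]big_seq.
  apply: eq_bigr => z zr; rewrite rmorphB/= map_polyX map_polyC/=.
  by congr (_ - _%:P); exact/esym/rreal.
split=> //.
by rewrite -szp' E size_scale// size_prod_XsubC.
Qed.

(** Induction on the roots: with [y = x - a], adding the factor [X - a] to a polynomial of degree
    [d] gives a new difference of the two sides which, multiplied by [d], is [(d P - y P')^2] plus
    [(d + 1) y^2] times the old difference. *)
Lemma laguerre_ineq (R : realFieldType) (s : seq R) (x : R) :
  let p := \prod_(a <- s) ('X - a%:P) in
  (size s)%:R * (p.[x] * p^`()^`().[x]) <= ((size s)%:R - 1) * p^`().[x] ^+ 2.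
Proof.
elim: s => [|a s /= IHs] /=.
  by rewrite !big_nil -polyC1 !derivC horner0 expr0n !mulr0.
rewrite big_cons; set p := \prod_(j <- s) _ in IHs *.
rewrite !derivM derivXsubC mul1r derivD derivM derivXsubC mul1r.
rewrite !hornerD !hornerM hornerXsubC.
set y := x - a; set P := p.[x] in IHs *; set P' := p^`().[x] in IHs *.
set P'' := p^`()^`().[x] in IHs *.
have [s0|s0] := posnP (size s).
  have -> : P' = 0 by rewrite /P' /p (size0nil s0) big_nil -polyC1 derivC horner0.
  have -> : P'' = 0 by rewrite /P'' /p (size0nil s0) big_nil -polyC1 !derivC horner0.
  by rewrite /= s0; lra.
rewrite /= -natr1 addrK.
set d := (size s)%:R in IHs *.
have d0 : 0 < d by rewrite ltr0n.
rewrite -(ler_pM2l d0) -subr_ge0.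
have : 0 <= y ^+ 2 * (d + 1) * ((d - 1) * P' ^+ 2 - d * (P * P'')).
  apply: mulr_ge0; last by rewrite subr_ge0.
  by apply: mulr_ge0; [exact: sqr_ge0|lra].
have := sqr_ge0 (d * P - y * P').
nra.
Qed.

Lemma derivn_prod_XsubC (R : rcfType) (s : seq R) (r : nat) :
  (r <= size s)%N ->
  exists (c : R) (t : seq R), [/\ c != 0, (size t + r = size s)%N &
    (\prod_(a <- s) ('X - a%:P))^`(r) = c *: \prod_(b <- t) ('X - b%:P)].
Proof.
elim: r => [_|r IHr rs].
  by exists 1, s; rewrite oner_neq0 addn0 scale1r derivn0.
have [c [t [c0 szt E]]] := IHr (ltnW rs).
have t0 : t != [::].
  by apply: contraTneq rs => t0; rewrite -szt t0 add0n ltnn.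
have [t' [szt' E']] := deriv_prod_XsubC t0.
exists (c * (size t)%:R), t'; split.
- by rewrite mulf_neq0// pnatr_eq0 size_eq0.
- by rewrite -szt -szt'; lia.
- by rewrite derivnS E derivZ E' scalerA.
Qed.

(** The [r]-th derivative of [p] still splits, and its value and first two derivatives at [0] are
    factorial multiples of three consecutive coefficients of [p]; Laguerre's inequality at [0] thus
    becomes Newton's. *)
Lemma coef_newton_ineq (R : rcfType) (s : seq R) (r : nat) :
  let p := \prod_(a <- s) ('X - a%:P) in
  (r.+2 <= size s)%N ->
  ((size s - r) * r.+2)%:R * (p`_r * p`_r.+2) <=
  ((size s - r).-1 * r.+1)%:R * p`_r.+1 ^+ 2.
Proof.
move=> p rs; have rs' : (r <= size s)%N by lia.
have [c [t [c0 szt E]]] := derivn_prod_XsubC rs'.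
have d0 k : p^`(r + k).[0] = (r + k)`!%:R * p`_(r + k).
  by rewrite horner_coef0 coef_derivn addn0 ffactnn mulr_natl.
have := laguerre_ineq t 0; rewrite /= -(ler_pM2l (_ : 0 < c ^+ 2)); last first.
  by rewrite exprn_even_gt0.
set T := \prod_(b <- t) _ in E *.
have E0 : c * T.[0] = r`!%:R * p`_r.
  by have := d0 0%N; rewrite !addn0 E hornerZ.
have E1 : c * T^`().[0] = (r.+1)`!%:R * p`_r.+1.
  by have := d0 1%N; rewrite !addn1 derivnS E derivZ hornerZ.
have E2 : c * T^`()^`().[0] = (r.+2)`!%:R * p`_r.+2.
  by have := d0 2%N; rewrite !addn2 !derivnS E !derivZ hornerZ.
have -> : c ^+ 2 * ((size t)%:R * (T.[0] * T^`()^`().[0])) =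
  (size t)%:R * ((c * T.[0]) * (c * T^`()^`().[0])) by ring.
have -> : c ^+ 2 * (((size t)%:R - 1) * T^`().[0] ^+ 2) =
  ((size t)%:R - 1) * (c * T^`().[0]) ^+ 2 by ring.
rewrite E0 E1 E2.
have -> : (size s - r = size t)%N by lia.
have -> : (size t)%:R - 1 = (size t).-1%:R :> R.
  by rewrite -subn1 natrB//; lia.
have f0 : 0 < (r`! * r.+1`!)%:R :> R by rewrite ltr0n muln_gt0 !fact_gt0.
rewrite -(ler_pM2l f0 _ (_ * p`_r.+1 ^+ 2)) => H.
apply: le_trans (le_trans H _);
  by rewrite !factS !natrM le_eqVlt; apply/orP; left; apply/eqP; ring.
Qed.

Section ElSym.
Context {R : comNzRingType}.

(** The generating product makes permutation invariance and the recursion on one added entry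
    ([elsymS]) immediate; [elsym_sigma] links it to the sum over subsets in [sigma]. *)
Definition elsym (m : nat) (s : seq R) : R := (\prod_(a <- s) (1 + a *: 'X))`_m.

Lemma elsym_nil m : elsym m [::] = (m == 0%N)%:R.
Proof. by rewrite /elsym big_nil coef1. Qed.

Lemma elsym0 s : elsym 0 s = 1.
Proof.
rewrite /elsym; elim: s => [|a s IHs]; first by rewrite big_nil coef1.
by rewrite big_cons mulrDl mul1r coefD -scalerAl coefZ coefXM mulr0 addr0.
Qed.

Lemma elsymS m a s : elsym m.+1 (a :: s) = elsym m.+1 s + a * elsym m s.
Proof.
by rewrite /elsym big_cons mulrDl mul1r coefD -scalerAl coefZ coefXM.
Qed.

Lemma elsym_perm m s t : perm_eq s t -> elsym m s = elsym m t.
Proof. by move=> st; rewrite /elsym (perm_big _ st). Qed.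

Lemma elsym_oversize m s : (size s < m)%N -> elsym m s = 0.
Proof.
elim: s m => [|a s IHs] [//|m] /=; first by rewrite elsym_nil.
by rewrite ltnS => sm; rewrite elsymS !IHs ?mulr0 ?addr0// ltnW.
Qed.

Lemma elsym_scale m (c : R) s : elsym m [seq c * a | a <- s] = c ^+ m * elsym m s.
Proof.
elim: s m => [|a s IHs] [|m] /=; rewrite ?elsym0 ?expr0 ?mulr1//.
  by rewrite !elsym_nil mulr0.
by rewrite !elsymS !IHs exprS; ring.
Qed.

Lemma elsym_coef m s : (m <= size s)%N ->
  (\prod_(a <- s) ('X + a%:P))`_(size s - m) = elsym m s.
Proof.
have szp (t : seq R) : size (\prod_(a <- t) ('X + a%:P)) = (size t).+1.
  rewrite -(size_prod_XsubC t (fun a => - a)); congr (size (polyseq _)).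
  by apply: eq_bigr => a _; rewrite polyCN opprK.
elim: s m => [|a s IHs] m /=.
  by rewrite leqn0 => /eqP ->; rewrite big_nil elsym0 subn0 coef1.
rewrite big_cons mulrDl coefD coefXM coefCM; case: m => [_|m].
  rewrite subn0/= elsym0 -[X in _`_X](subn0 (size s)) IHs// elsym0.
  by rewrite nth_default ?szp// mulr0 addr0.
rewrite ltnS subSS leq_eqVlt => /orP[/eqP ->|ms].
  rewrite subnn/= add0r elsymS elsym_oversize// add0r.
  by rewrite -IHs// subnn.
rewrite subn_eq0 leqNgt ms/= -subnS IHs// elsymS IHs ?(ltnW ms)//.
Qed.

Lemma elsym_sigma (N m : nat) (mu : 'I_N -> R) :
  \sum_(J : {set 'I_N} | #|J| == m) \prod_(i in J) mu i =
  elsym m [seq mu i | i <- enum 'I_N].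
Proof.
rewrite /elsym big_map big_enum/=.
under [in RHS]eq_bigr do rewrite addrC.
rewrite bigA_distr/= coef_sum [LHS]big_mkcond/=; apply: eq_bigr => J _.
rewrite -big_mkcondr/=.
have -> : \prod_(i | (i \in J)) (mu i *: 'X) = (\prod_(i in J) mu i) *: 'X^#|J|.
  by rewrite scaler_prod prodr_const.
by rewrite coefZ coefXn eq_sym; case: eqP => _; rewrite ?mulr1 ?mulr0.
Qed.
End ElSym.

(** Elementary symmetric functions are polynomial coefficients counted from the top, so this is
    [coef_newton_ineq] at degree [size s - j.+2]. The exact factors are kept because the gap between
    them is what makes [elsym_ratio_shift] work. *)
Lemma elsym_newton (R : rcfType) (s : seq R) (j : nat) : (j.+2 <= size s)%N ->
  (j.+2 * (size s - j))%:R * (elsym j s * elsym j.+2 s) <=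
  (j.+1 * (size s - j.+1))%:R * elsym j.+1 s ^+ 2.
Proof.
move=> js.
have pE : \prod_(a <- s) ('X + a%:P) = \prod_(a <- map -%R s) ('X - a%:P).
  by rewrite big_map; apply: eq_bigr => a _; rewrite polyCN opprK.
have c k : (k <= size s)%N ->
    (\prod_(a <- map -%R s) ('X - a%:P))`_(size s - k) = elsym k s.
  by move=> ks; rewrite -pE elsym_coef.
have := @coef_newton_ineq R (map -%R s) (size s - j.+2).
rewrite size_map /= -(c j) ?(ltnW (ltnW js))// -(c j.+1) ?(ltnW js)// -(c j.+2)//.
have -> : (size s - (size s - j.+2) = j.+2)%N by lia.
have -> : ((size s - j.+2).+2 = size s - j)%N by lia.
have -> : ((size s - j.+2).+1 = size s - j.+1)%N by lia.
rewrite [_`_(size s - j) * _]mulrC; apply; lia.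
Qed.

Lemma elsym_newton_weak (R : rcfType) (s : seq R) (j : nat) :
  elsym j s * elsym j.+2 s <= elsym j.+1 s ^+ 2.
Proof.
have [js|sj] := leqP j.+2 (size s); last first.
  by rewrite [elsym j.+2 s]elsym_oversize// mulr0 sqr_ge0.
have [H|H] := leP (elsym j s * elsym j.+2 s) 0; first exact: le_trans (sqr_ge0 _).
have f0 : 0 < (j.+2 * (size s - j))%:R :> R by rewrite ltr0n muln_gt0/=; lia.
rewrite -(ler_pM2l f0); apply: le_trans (elsym_newton js) _.
by rewrite ler_wpM2r ?sqr_ge0// ler_nat; apply: leq_mul; lia.
Qed.

Definition elsym_cone (R : realFieldType) (k : nat) (s : seq R) : Prop :=
  forall j, (j <= k)%N -> 0 < elsym j s.

Lemma elsym_cone_le (R : realFieldType) (k l : nat) (s : seq R) :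
  (l <= k)%N -> elsym_cone k s -> elsym_cone l s.
Proof. by move=> lk H j jl; apply: H; apply: leq_trans lk. Qed.

(** [elsym j s] is the derivative of [elsym j.+1 (a :: s)] in [a], so this is ellipticity on the
    cone. If [x = elsym k.+1 s] were nonpositive, with [y] and [z] the values of order [k] and
    [k.+2], then eliminating [a] from [0 < x + a * y] and [0 < z + a * x] would give
    [x ^+ 2 < y * z], against Newton. *)
Lemma elsym_cone_behead (R : rcfType) (k : nat) (a : R) (s : seq R) :
  elsym_cone k.+1 (a :: s) -> elsym_cone k s.
Proof.
elim: k => [_ j|k IHk H]; first by rewrite leqn0 => /eqP ->; rewrite elsym0.
have Hk : elsym_cone k s by apply: IHk; apply: elsym_cone_le H.
move=> j; rewrite leq_eqVlt => /orP[/eqP ->|]; last by rewrite ltnS; exact: Hk.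
rewrite ltNge; apply/negP => e0.
have := H k.+1 (leqnSn _); have := H k.+2 (leqnn _); rewrite !elsymS.
have ek := Hk k (leqnn _); have := elsym_newton_weak s k.
move: e0 ek; set x := elsym k.+1 s; set y := elsym k s; set z := elsym k.+2 s.
move=> x0 y0 nw h1 h2.
have : 0 < (z + a * x) * y by rewrite mulr_gt0.
have : 0 <= - x * (x + a * y) by rewrite mulr_ge0 ?oppr_ge0// ltW.
nra.
Qed.

(** By Newton the ratios [elsym j.+1 s / elsym j s] decrease in [j]. The cone condition stops at
    order [k], leaving the sign of [elsym k.+1 s] free: this is what remains after
    [elsym_cone_behead] has removed an entry. *)
Lemma elsym_ratio (R : rcfType) (k l : nat) (s : seq R) : elsym_cone k s ->
  (l <= k)%N -> elsym l s * elsym k.+1 s <= elsym l.+1 s * elsym k s.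
Proof.
elim: k => [|k IHk] H lk.
  by move: lk; rewrite leqn0 => /eqP ->; rewrite mulrC.
move: lk; rewrite leq_eqVlt => /orP[/eqP ->|]; first by rewrite mulrC.
rewrite ltnS => lk; have Hk : elsym_cone k s by apply: elsym_cone_le H.
have ek := Hk k (leqnn _); have ek1 := H k.+1 (leqnn _).
have el := H l (leqW lk).
rewrite -(ler_pM2r ek); have := IHk Hk lk; have := elsym_newton_weak s k.
move: ek ek1 el; set x := elsym k s; set y := elsym k.+1 s; set z := elsym l s.
set w := elsym k.+2 s; set v := elsym l.+1 s => x0 y0 z0 h1 h2.
have : 0 <= z * (y ^+ 2 - x * w) by rewrite mulr_ge0 ?subr_ge0// ltW.
have : 0 <= y * (v * x - z * y) by rewrite mulr_ge0 ?subr_ge0// ltW.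
nra.
Qed.

(** As a function of one entry, the quotient is a fraction of two affine functions. In terms of the
    elementary symmetric functions e of the other entries, its slope has the sign of
    [e_(k-1) e_l - e_k e_(l-1)], which [elsym_ratio] controls. *)
Lemma elsym_quotient_cons (R : rcfType) (k l : nat) (a b : R) (s : seq R) :
  (l < k)%N -> a <= b -> elsym_cone k (a :: s) ->
  elsym_cone k (b :: s) /\
  elsym k (a :: s) / elsym l (a :: s) <= elsym k (b :: s) / elsym l (b :: s).
Proof.
case: k => // k; rewrite ltnS => lk ab H; have Hs := elsym_cone_behead H.
have Hb : elsym_cone k.+1 (b :: s).
  move=> [|j] jk; rewrite ?elsym0// elsymS.
  apply: lt_le_trans (H _ jk) _; rewrite elsymS lerD2l ler_wpM2r// ltW//.
  by apply: Hs.
split=> //.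
have la := H l (leqW lk); have lb := Hb l (leqW lk).
rewrite ler_pdivrMr// mulrAC ler_pdivlMr//.
case: l lk la lb => [|l] lk la lb.
  rewrite !elsym0 !mulr1 !elsymS lerD2l ler_wpM2r//.
  by apply: ltW; apply: Hs.
have := elsym_ratio Hs (ltnW lk); rewrite !elsymS.
have : 0 <= b - a by rewrite subr_ge0.
nra.
Qed.

Lemma elsym_quotient_le (R : rcfType) (k l : nat) (s t : seq R) :
  (l < k)%N -> size s = size t ->
  (forall i, (i < size s)%N -> s`_i <= t`_i) -> elsym_cone k s ->
  elsym_cone k t /\ elsym k s / elsym l s <= elsym k t / elsym l t.
Proof.
move=> lk; pose P (s' t' : seq R) := elsym_cone k s' ->
  elsym_cone k t' /\ elsym k s' / elsym l s' <= elsym k t' / elsym l t'.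
have permP (s' t' u v : seq R) : perm_eq s' t' -> perm_eq u v -> P t' v -> P s' u.
  rewrite /P => st uv H; rewrite !(elsym_perm _ st) !(elsym_perm _ uv) => Hs.
  have [|Hv le] := H; first by move=> j; rewrite -(elsym_perm _ st); exact: Hs.
  by split=> // j; rewrite (elsym_perm _ uv); exact: Hv.
(* Entries are raised one at a time at the head of the list; [u] collects those already raised, and
   [permP] moves each of them out of the way. *)
suff : forall u, size s = size t ->
    (forall i, (i < size s)%N -> s`_i <= t`_i) -> P (s ++ u) (t ++ u).
  by move=> H st le; have := H [::] st le; rewrite !cats0.
elim: s t => [|a s IHs] [|b t]//= u.
move=> [st] le; have [ab leS] : a <= b /\ forall i, (i < size s)%N -> s`_i <= t`_i.
  by split=> [|i si]; [exact: (le 0%N)|exact: (le i.+1)].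
have Q : P (s ++ b :: u) (b :: t ++ u).
  apply: (permP _ _ _ _ (perm_refl _) _ (IHs t (b :: u) st leS)).
  by rewrite -[b :: t ++ u]/((b :: t) ++ u) perm_sym -cat_rcons perm_cat2r
     perm_rcons.
move=> H; have [Hb le1] := elsym_quotient_cons lk ab H.
have pe : perm_eq (b :: s ++ u) (s ++ b :: u).
  by rewrite -[b :: s ++ u]/((b :: s) ++ u) perm_sym -cat_rcons perm_cat2r
     perm_rcons.
have [|Ht le2] := Q; first by move=> j; rewrite -(elsym_perm _ pe); exact: Hb.
by split=> //; apply: le_trans le1 _; rewrite !(elsym_perm _ pe).
Qed.

(** Each [m]-subset lies in [size s - m] subsets with one more element, whence the factor. For
    [m >= size s] the truncated subtraction is [0], as is the function being differentiated. *)
Lemma is_derive_elsym (R : realType) (m : nat) (s : seq R) (h : R) :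
  is_derive h 1 (fun h => elsym m.+1 [seq a + h | a <- s])
    ((size s - m)%:R * elsym m [seq a + h | a <- s]).
Proof.
have step (a : R) (f g : R -> R) (df dg : R) : is_derive h 1 f df -> is_derive h 1 g dg ->
    is_derive h 1 (f + (cst a + id) * g) (df + ((a + h) * dg + g h)).
  move=> Hf Hg.
  have Hi : is_derive h 1 (cst a + id) (0 + 1) by exact: is_deriveD.
  apply: (is_derive_eq (is_deriveD Hf (is_deriveM Hi Hg))).
  by rewrite /GRing.scale/= add0r mulr1 fctE /cst.
have const0 t : is_derive h 1 (fun h => elsym 0 [seq a + h | a <- t]) 0.
  rewrite [X in is_derive _ _ X _](_ : _ = cst 1); first exact: is_derive_cst.
  by apply/funext => x; rewrite elsym0.
elim: s m => [|a s IHs] m /=.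
  rewrite mul0r [X in is_derive _ _ X _](_ : _ = cst 0); first exact: is_derive_cst.
  by apply/funext => x; rewrite elsym_nil.
rewrite [X in is_derive _ _ X _](_ : _ =
  (fun h => elsym m.+1 [seq a + h | a <- s]) +
  (cst a + id) * (fun h => elsym m [seq a + h | a <- s])); last first.
  by apply/funext => x; rewrite elsymS.
case: m => [|m].
  have := step a _ _ _ _ (IHs 0%N) (const0 s).
  by rewrite !elsym0 !subn0 mulr0 !mulr1 add0r -natr1.
have := step a _ _ _ _ (IHs m.+1) (IHs m); congr (is_derive _ _ _ _).
rewrite subSS elsymS.
have [ms|sm] := ltnP m (size s).
  by rewrite -(subnSK ms) -natr1; ring.
rewrite [elsym m.+1 _]elsym_oversize ?size_map//.
have -> : (size s - m.+1 = 0)%N by lia.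
have -> : (size s - m = 0)%N by lia.
by ring.
Qed.

Lemma elsym_size (R : realType) (k : nat) (s : seq R) : elsym_cone k s ->
  (k <= size s)%N.
Proof.
move=> /(_ k (leqnn k)) ek; rewrite leqNgt; apply/negP => sk.
by move: ek; rewrite elsym_oversize// ltxx.
Qed.

Lemma elsym_cone_shift (R : realType) (k : nat) (s : seq R) (h : R) :
  0 <= h -> elsym_cone k s -> elsym_cone k [seq a + h | a <- s].
Proof.
case: k => [_ _ j|k h0 Hs]; first by rewrite leqn0 => /eqP ->; rewrite elsym0.
apply: (proj1 (@elsym_quotient_le R k.+1 k s _ (leqnn _) _ _ Hs)).
  by rewrite size_map.
by move=> i si; rewrite (nth_map 0)// lerDl.
Qed.

(** The derivative of the ratio in [h] is at least [1 / N] with [N = size s]: the sharp Newton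
    inequality leaves [(N - j) / (j + 1)], and [j < N] by [elsym_size]. For [j > 0] the weak form of
    Newton would only give the lower bound [-1]. *)
Lemma elsym_ratio_shift (R : realType) (j : nat) (s : seq R) (h : R) :
  elsym_cone j.+1 s -> 0 <= h ->
  elsym j.+1 s / elsym j s + h / (size s)%:R <=
  elsym j.+1 [seq a + h | a <- s] / elsym j [seq a + h | a <- s].
Proof.
move=> Hs h0; have js := elsym_size Hs.
pose e m (x : R) := elsym m [seq a + x | a <- s].
have e_gt0 m (x : R) : (m <= j.+1)%N -> 0 <= x -> 0 < e m x.
  by move=> mj x0; apply: elsym_cone_shift mj.
have e0 m : e m 0 = elsym m s.
  by rewrite /e (eq_map (g := id)) ?map_id// => a; rewrite addr0.
pose de m (x : R) : R := if m is i.+1 then (size s - i)%:R * e i x else 0.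
pose dq (x : R) := ((size s - j)%:R * e j x * e j x -
  e j.+1 x * de j x) / e j x ^+ 2.
have dqE (x : R) : 0 <= x -> is_derive x 1 (fun x => e j.+1 x / e j x) (dq x).
  move=> x0; have ej : e j x != 0 by rewrite gt_eqF// e_gt0.
  have d1 : is_derive x 1 (e j.+1) ((size s - j)%:R * e j x).
    exact: is_derive_elsym.
  have d2 : is_derive x 1 (e j) (de j x).
    case: (j) => [|i]; last exact: is_derive_elsym.
    rewrite [X in is_derive _ _ X _](_ : _ = cst 1); first exact: is_derive_cst.
    by apply/funext => y; rewrite /e elsym0.
  have d3 : is_derive x 1 (fun y => (e j y)^-1)
     (- (e j x) ^- 2 *: de j x).
    by apply: DeriveDef; [apply: derivableV|rewrite deriveV// derive_val].
  apply: is_derive_eq; rewrite /GRing.scale/= /dq.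
  by move: (e j.+1 x) (de j x) (e j x) ej => x1 x2 x3 x30; field.
have [c] : exists2 c, c \in `[0, h] &
    e j.+1 h / e j h - e j.+1 0 / e j 0 = dq c * (h - 0).
  apply: (@MVT_segment _ (fun x => e j.+1 x / e j x)) => //.
    by move=> x; rewrite in_itv/= => /andP[/ltW x0 _]; exact: dqE.
  apply: derivable_within_continuous => x; rewrite in_itv/= => /andP[x0 _].
  by have [] := dqE x x0.
rewrite in_itv/= => /andP[c0 _]; rewrite !e0 subr0 => qE.
rewrite addrC -lerBrDr [leRHS]qE mulrC ler_wpM2r//.
have s0 : 0 < (size s)%:R :> R by rewrite ltr0n; lia.
have ejc : 0 < e j c by rewrite e_gt0.
rewrite /dq /de ler_pdivlMr ?exprn_gt0//.
have -> : (size s - j)%:R * e j c * e j c = (size s - j)%:R * e j c ^+ 2 by ring.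
case: j Hs js e_gt0 dq dqE qE ejc => [|j] Hs js e_gt0 dq dqE qE ejc.
  rewrite mulr0 !subr0 subn0 ler_wpM2r ?sqr_ge0//.
  by rewrite (@le_trans _ _ 1)// ?invf_le1 ?ler1n//; lia.
have js' : (j.+2 <= size (map (fun a : R => (a + c)%R) s))%N by rewrite size_map.
have := elsym_newton js'; rewrite size_map -/(e j c) -/(e j.+1 c) -/(e j.+2 c).
set X := e j.+1 c ^+ 2; set Y := e j c * e j.+2 c => nw.
have j0 : 0 < (j.+2)%:R :> R by rewrite ltr0n.
have -> : e j.+2 c * ((size s - j)%:R * e j c) = (size s - j)%:R * Y.
  by rewrite /Y; ring.
have X0 : 0 <= X by rewrite sqr_ge0.
have H : j.+2%:R * ((size s)%:R^-1 * X) <= (size s - j.+1)%:R * X.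
  rewrite mulrA ler_wpM2r// (@le_trans _ _ 1)//; last by rewrite ler1n; lia.
  by rewrite ler_pdivrMr// mul1r ler_nat.
rewrite -(ler_pM2l j0); move: nw H; rewrite !natrM -[j.+2%:R]natr1; lra.
Qed.

(** This is Minkowski's inequality for the geometric means [r] and [T]. The inequality of means for
    the numbers [q i / (q i + h)] and for the numbers [h / (q i + h)] bounds [r / T] and [h / T] by
    averages that add up to [1]. *)
Lemma minkowski_prod (R : realType) (m : nat) (q : 'I_m.+1 -> R) (h r T : R) :
  (forall i, 0 < q i) -> 0 <= h -> 0 <= r -> 0 <= T ->
  r ^+ m.+1 = \prod_i q i -> T ^+ m.+1 = \prod_i (q i + h) -> r + h <= T.
Proof.
move=> q0 h0 r0 T0 rE TE.
have qh i : 0 < q i + h by rewrite ltr_wpDr.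
have Tp : 0 < T.
  rewrite lt_neqAle T0 andbT eq_sym; apply/eqP => T00.
  have : 0 < T ^+ m.+1 by rewrite TE prodr_gt0.
  by rewrite T00 expr0n ltxx.
have cm : #|'I_m.+1| = m.+1 by rewrite card_ord.
have m0 : 0 < m.+1%:R :> R by rewrite ltr0n.
have avg (E : 'I_m.+1 -> R) x : (forall i, 0 <= E i) -> 0 <= x ->
    x ^+ m.+1 = \prod_i E i -> x * m.+1%:R <= \sum_i E i.
  move=> E0 x0 xE; have [+ _] := @leif_AGM _ _ predT E (fun i _ => E0 i).
  by rewrite cm -xE -ler_pdivlMr// ler_pXn2r // nnegrE divr_ge0 ?sumr_ge0.
have H1 : r / T * m.+1%:R <= \sum_i q i / (q i + h).
  apply: avg => [i||]; [by rewrite divr_ge0// ltW|by rewrite divr_ge0|].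
  by rewrite prodf_div expr_div_n rE TE.
have H2 : h / T * m.+1%:R <= \sum_i h / (q i + h).
  apply: avg => [i||]; [by rewrite divr_ge0// ltW|by rewrite divr_ge0|].
  by rewrite prodf_div expr_div_n TE prodr_const cm.
have : (r / T + h / T) * m.+1%:R <= m.+1%:R.
  rewrite mulrDl; apply: le_trans (lerD H1 H2) _.
  rewrite -big_split/= (eq_bigr (fun=> 1)) ?sumr_const ?cm// => i _.
  by rewrite -mulrDl divff// gt_eqF.
by rewrite -mulrDl -[leRHS]mul1r ler_pM2r// ler_pdivrMr// mul1r.
Qed.

Definition hquot (R : realType) (k l : nat) (s : seq R) : R :=
  (elsym k s / elsym l s) `^ (k - l)%:R^-1.

(** The quotient telescopes into [k - l] ratios of consecutive orders; each gains [h / size s] by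
    [elsym_ratio_shift], and [minkowski_prod] transfers the gain to their geometric mean, which is
    [hquot]. *)
Lemma hquot_shift (R : realType) (k l : nat) (s : seq R) (h : R) :
  (l < k)%N -> elsym_cone k s -> 0 <= h ->
  hquot k l s + h / (size s)%:R <= hquot k l [seq a + h | a <- s].
Proof.
move=> lk Hs h0; set s' := [seq a + h | a <- s].
have Hs' : elsym_cone k s' by exact: elsym_cone_shift.
have tel (t : seq R) : elsym_cone k t -> elsym k t / elsym l t =
    \prod_(i < k - l) (elsym (l + i).+1 t / elsym (l + i) t).
  move=> Ht; rewrite -[in LHS](subnKC (ltnW lk)).
  have : (l + (k - l) <= k)%N by lia.
  elim: (k - l)%N => [|n IHn] ln.
    by rewrite addn0 big_ord0 divff// gt_eqF// Ht//; lia.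
  rewrite big_ord_recr/= -IHn; last by lia.
  have e1 : elsym (l + n) t != 0 by rewrite gt_eqF// Ht//; lia.
  have e2 : elsym l t != 0 by rewrite gt_eqF// Ht//; lia.
  by rewrite addnS; field; rewrite e1 e2.
have root (t : seq R) : elsym_cone k t -> hquot k l t ^+ (k - l) = elsym k t / elsym l t.
  move=> Ht; rewrite -powR_mulrn ?powR_ge0// -powRrM mulVf ?pnatr_eq0; last by lia.
  by rewrite powRr1// divr_ge0// ltW// Ht// ltnW.
have [m km] : exists m, (k - l = m.+1)%N by exists (k - l).-1; lia.
have := root _ Hs; have := root _ Hs'; have := tel _ Hs; have := tel _ Hs'.
rewrite km => telt' telt roott' roott.
have hs : 0 <= h / (size s)%:R by rewrite divr_ge0.
have q0 (t : seq R) i : elsym_cone k t -> (i < m.+1)%N -> 0 < elsym (l + i).+1 t / elsym (l + i) t.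
  by move=> Ht im; rewrite divr_gt0// Ht//; lia.
set T0 := (\prod_(i < m.+1) (elsym (l + i).+1 s / elsym (l + i) s + h / (size s)%:R)).
have T00 : 0 <= T0.
  by rewrite prodr_ge0// => i _; rewrite addr_ge0// ltW// q0.
apply: (@le_trans _ _ (T0 `^ m.+1%:R^-1)).
  apply: (minkowski_prod _ hs (powR_ge0 _ _) (powR_ge0 _ _) (etrans roott telt)).
    by move=> i; apply: q0.
  by rewrite -powR_mulrn ?powR_ge0// -powRrM mulVf ?pnatr_eq0// powRr1.
rewrite /hquot km; apply: ge0_ler_powR; rewrite ?nnegrE ?invr_ge0//.
  by rewrite divr_ge0// ltW// Hs'// ltnW.
rewrite telt'; apply: ler_prod => i _; rewrite addr_ge0 ?(ltW (q0 _ _ _ _))//=.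
by apply: elsym_ratio_shift => //; apply: elsym_cone_le Hs; move: (ltn_ord i); lia.
Qed.

Lemma hquot_scale (R : realType) (k l : nat) (s : seq R) (c : R) :
  (l < k)%N -> elsym_cone k s -> 0 < c ->
  elsym_cone k [seq c * a | a <- s] /\
  hquot k l [seq c * a | a <- s] = c * hquot k l s.
Proof.
move=> lk Hs c0; split.
  by move=> j jk; rewrite elsym_scale mulr_gt0 ?exprn_gt0// Hs.
have e0 : elsym l s != 0 by rewrite gt_eqF// Hs// ltnW.
rewrite /hquot !elsym_scale.
have -> : c ^+ k * elsym k s / (c ^+ l * elsym l s) =
   c ^+ (k - l) * (elsym k s / elsym l s).
  rewrite -{1}(subnK (ltnW lk)) exprD; field.
  by rewrite e0 expf_neq0 ?gt_eqF.
rewrite powRM ?exprn_ge0 ?(ltW c0)//; last by rewrite divr_ge0// ltW// Hs// ltnW.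
by rewrite -powR_mulrn ?ltW// -powRrM mulfV ?pnatr_eq0 ?powRr1 ?ltW//; lia.
Qed.

Lemma hquot_le (R : realType) (k l : nat) (s t : seq R) :
  (l < k)%N -> size s = size t ->
  (forall i, (i < size s)%N -> s`_i <= t`_i) -> elsym_cone k s ->
  elsym_cone k t /\ hquot k l s <= hquot k l t.
Proof.
move=> lk st le Hs; have [Ht q] := elsym_quotient_le lk st le Hs; split=> //.
by apply: ge0_ler_powR; rewrite ?nnegrE ?invr_ge0// divr_ge0// ltW// ?Hs ?Ht// ltnW.
Qed.

(** * Spectral comparison of symmetric matrices *)

Lemma symmetric_spectral (R : rcfType) (n : nat) (A : 'M[R]_n) : A^T = A ->
  exists (P : 'M[R[i]]_n) (d : 'I_n -> R),
  [/\ P \is unitarymx,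
      map_mx (real_complex R) A =
        P^t* *m diag_mx (\row_i real_complex R (d i)) *m P &
      char_poly A = \prod_i ('X - (d i)%:P)].
Proof.
move=> Asym; pose toC := real_complex R; pose AC := map_mx toC A.
have AC_herm : AC \is hermsymmx.
  apply: realsym_hermsym.
    by apply/is_hermitianmxP; rewrite expr0 scale1r map_mx_id// map_trmx Asym.
  by apply/mxOverP => i j; rewrite mxE; apply/complex_realP; exists (A i j).
have /orthomx_spectralP ACE := hermitian_normalmx AC_herm.
have Preal := hermitian_spectral_diag_real AC_herm.
set P := spectralmx AC in ACE; set sp := spectral_diag AC in ACE Preal.
have Puni : P \is unitarymx by exact: spectral_unitarymx.
have Punit : P \in unitmx by exact: unitarymx_unit.
pose d i := complex.Re (sp 0 i).
have spE : sp = \row_i toC (d i).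
  apply/rowP => i; rewrite mxE /d.
  by have /mxOverP/(_ 0 i)/complex_realP[x ->] := Preal.
exists P, d; split=> //; first by rewrite -invmx_unitary// -spE -ACE.
apply: (map_poly_inj toC); rewrite map_char_poly -/AC ACE.
have -> : char_poly (invmx P *m diag_mx sp *m P) = char_poly (diag_mx sp).
  rewrite /char_poly /char_poly_mx.
  have -> : 'X%:M - map_mx polyC (invmx P *m diag_mx sp *m P) =
     map_mx polyC (invmx P) *m ('X%:M - map_mx polyC (diag_mx sp)) *m map_mx polyC P.
    rewrite mulmxBr mulmxBl !map_mxM; congr (_ - _).
    by rewrite scalar_mxC -mulmxA -map_mxM mulVmx// map_mx1 mulmx1.
  rewrite !det_mulmx mulrAC -det_mulmx -map_mxM mulVmx// map_mx1 det1 mul1r//.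
rewrite char_poly_trig ?diag_mx_is_trig// rmorph_prod; apply: eq_bigr => i _.
by rewrite rmorphB/= map_polyX map_polyC/= mxE eqxx mulr1n spE mxE.
Qed.

(** The spectral theorem is used in Hermitian form, with complex eigenvectors, so nonnegativity of a
    real form has to reach complex vectors. For [v = x + i y] the cross terms cancel by symmetry of
    [M], leaving the values of the form at [x] and at [y]. *)
Lemma real_form_complex (R : rcfType) (n : nat) (M : 'M[R]_n) (v : 'rV[R[i]]_n) :
  M^T = M -> (forall x : 'rV[R]_n, 0 <= (x *m M *m x^T) 0 0) ->
  0 <= (v *m map_mx (real_complex R) M *m v^t*) 0 0.
Proof.
move=> Msym M0; pose x := map_mx (@complex.Re R) v; pose y := map_mx (@complex.Im R) v.
pose toC := real_complex R.
have vE : v = map_mx toC x + 'i *: map_mx toC y.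
  by apply/rowP => i; rewrite !mxE -complexiE [LHS]complexE.
have vtE : v^t* = map_mx toC x^T - 'i *: map_mx toC y^T.
  apply/colP => i; rewrite !mxE -complexiE /=; case: (v 0 i) => a b /=.
  by apply/eqP; rewrite eq_complex/= !(mul0r, mul1r, mulr0, subr0, oppr0, addr0, add0r) !eqxx.
have -> : (v *m map_mx toC M *m v^t*) 0 0 =
    toC ((x *m M *m x^T) 0 0 + (y *m M *m y^T) 0 0).
  have xy : (x *m M *m y^T) = (y *m M *m x^T).
    rewrite -[LHS]trmxK; have -> : (x *m M *m y^T)^T = y *m M *m x^T.
      by rewrite !trmx_mul trmxK Msym mulmxA.
    by apply/matrixP => i j; rewrite !ord1 mxE.
  rewrite {1}vE vtE !mulmxDl !mulmxBr -!scalemxAl -!scalemxAr -!map_mxM xy.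
  rewrite scalerA -expr2 sqrCi scaleN1r opprK.
  by rewrite addrA subrK -map_mxD mxE mxE.
by rewrite /toC ler0c addr_ge0.
Qed.

Section SpectralForm.
Context {R : rcfType} {n : nat} (A : 'M[R]_n) (P : 'M[R[i]]_n) (d : 'I_n -> R).
Hypothesis Puni : P \is unitarymx.
Hypothesis AE : map_mx (real_complex R) A =
  P^t* *m diag_mx (\row_i real_complex R (d i)) *m P.

Lemma spectral_form (v : 'rV[R[i]]_n) (c : R) :
  (v *m map_mx (real_complex R) A *m v^t*) 0 0 - real_complex R c * (v *m v^t*) 0 0 =
  \sum_i real_complex R (d i - c) * `|(v *m P^t*) 0 i| ^+ 2.
Proof.
pose w := v *m P^t*.
have wt : w^t* = P *m v^t*.
  by rewrite /w trmx_mul map_mxM map_trmx trmxK -map_mx_comp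
    (map_mx_id (@conjCK _)).
have vv : v *m v^t* = w *m w^t*.
  by rewrite wt /w mulmxA -[v *m P^t* *m P]mulmxA -invmx_unitary// mulVmx
    ?mulmx1// unitarymx_unit.
rewrite vv AE !mulmxA -/w -mulmxA -wt !mxE mulr_sumr -sumrB; apply: eq_bigr => i _.
rewrite mul_mx_diag !mxE normCK rmorphB mulrBl; congr (_ - _).
by rewrite mulrAC mulrC.
Qed.
End SpectralForm.

(** This is Weyl's monotonicity, put as a count so that no ordering of eigenvalues is needed. If the
    count failed, a dimension argument would give a nonzero [v] both in the span of the eigenvectors
    of [B] with [m i <= c] and in that of the eigenvectors of [A] with [d i > c]; at [v] the form of
    [B] is at most [c |v|^2] and that of [A] exceeds it. *)
Lemma weyl_card (R : rcfType) (n : nat) (A B : 'M[R]_n) (P Q : 'M[R[i]]_n)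
  (d m : 'I_n -> R) (c : R) :
  A^T = A -> B^T = B -> P \is unitarymx -> Q \is unitarymx ->
  map_mx (real_complex R) A = P^t* *m diag_mx (\row_i real_complex R (d i)) *m P ->
  map_mx (real_complex R) B = Q^t* *m diag_mx (\row_i real_complex R (m i)) *m Q ->
  (forall x : 'rV[R]_n, (x *m A *m x^T) 0 0 <= (x *m B *m x^T) 0 0) ->
  (#|[pred i | (m i <= c)%R]| <= #|[pred i | (d i <= c)%R]|)%N.
Proof.
move=> As Bs Pu Qu AE BE AB; rewrite leqNgt; apply/negP => lt.
have sub (W : 'M[R[i]]_n) (I : pred 'I_n) : W \is unitarymx ->
    rowsub (@enum_val _ I) W \is unitarymx.
  move=> /unitarymxP WW; apply/unitarymxP.
  apply/matrixP => i j.
  have := congr1 (fun M : 'M[R[i]]_n => M (enum_val i) (enum_val j)) WW.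
  rewrite !mxE (inj_eq enum_val_inj) => <-.
  by apply: eq_bigr => k _; rewrite !mxE.
have supp (W : 'M[R[i]]_n) (I : pred 'I_n) (v : 'rV_n) i : W \is unitarymx ->
    (v <= rowsub (@enum_val _ I) W)%MS -> i \notin I -> (v *m W^t*) 0 i = 0.
  move=> /unitarymxP WW /submxP[a ->] iI.
  rewrite -mulmxA mxE big1// => k _.
  have := congr1 (fun M : 'M[R[i]]_n => M (enum_val k) i) WW.
  rewrite !mxE; under [in X in _ -> X]eq_bigr do rewrite mxE.
  move=> ->; case: eqP => [E|_]; last by rewrite mulr0.
  by move: iI; rewrite -E enum_valP.
pose I := [pred i | (m i <= c)%R]; pose J := [pred i | ~~ (d i <= c)].
pose U := rowsub (@enum_val _ I) Q; pose V := rowsub (@enum_val _ J) P.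
have rU : \rank U = #|I| by rewrite mxrank_unitary// sub.
have rV : \rank V = #|J| by rewrite mxrank_unitary// sub.
have cardJ : (#|[pred i | (d i <= c)%R]| + #|J| = n)%N.
  by rewrite cardC card_ord.
have /rowV0Pn[v] : (U :&: V)%MS != 0.
  rewrite -mxrank_eq0 -lt0n; have := mxrank_sum_cap U V.
  have := rank_leq_col (U + V)%MS; rewrite rU rV; move: lt cardJ.
  rewrite -/I; set nI := #|I|; set nJ := #|J|; set nd := #|_|.
  by move: nI nJ nd (\rank _) (\rank _) => *; lia.
rewrite sub_capmx => /andP[vU vV] v0.
have H : 0 <= (v *m map_mx (real_complex R) (B - A) *m v^t*) 0 0.
  apply: real_form_complex; first by rewrite linearB/= As Bs.
  by move=> x; rewrite mulmxBr mulmxBl mxE [X in _ + X]mxE subr_ge0 AB.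
have HB : (v *m map_mx (real_complex R) B *m v^t*) 0 0
    <= real_complex R c * (v *m v^t*) 0 0.
  rewrite -subr_le0 (spectral_form Qu BE); apply: sumr_le0 => i _.
  have [iI|iI] := boolP (i \in I); last by rewrite (supp Q I)// normr0 expr0n mulr0.
  by rewrite mulr_le0_ge0 ?exprn_ge0// lecR subr_le0.
have HA : real_complex R c * (v *m v^t*) 0 0 <
    (v *m map_mx (real_complex R) A *m v^t*) 0 0.
  rewrite -subr_gt0 (spectral_form Pu AE).
  have [w0|[i wi]] : v *m P^t* = 0 \/ exists i, (v *m P^t*) 0 i != 0.
  - have [|/rV0Pn] := eqVneq (v *m P^t*) 0; first by left.
    by right.
  - case/eqP: v0; have := congr1 (mulmx^~ P) w0.
    by rewrite -mulmxA -(invmx_unitary Pu) (mulVmx (unitarymx_unit Pu)) mulmx1 mul0mx.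
  have iJ : i \in J by apply: contraNT wi => iJ; rewrite (supp P J)//.
  rewrite (bigD1 i)//= ltr_wpDr//.
    apply: sumr_ge0 => j _; have [jJ|jJ] := boolP (j \in J).
      by rewrite mulr_ge0 ?exprn_ge0// ler0c subr_ge0 ltW// ltNge.
    by rewrite (supp P J)// normr0 expr0n mulr0.
  by rewrite mulr_gt0 ?exprn_gt0 ?normr_gt0// ltcR subr_gt0 ltNge.
have AB' : (v *m map_mx (real_complex R) A *m v^t*) 0 0 <=
    (v *m map_mx (real_complex R) B *m v^t*) 0 0.
  by move: H; rewrite map_mxB mulmxBr mulmxBl mxE [X in _ + X]mxE subr_ge0.
by have := lt_le_trans HA (le_trans AB' HB); rewrite ltxx.
Qed.

Lemma sorting_perm (R : realDomainType) (n : nat) (d : 'I_n -> R) :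
  exists s : {perm 'I_n}, forall i j : 'I_n, (i <= j)%N -> d (s i) <= d (s j).
Proof.
pose t := [tuple d i | i < n].
have sz : size (sort <=%O t) == n by rewrite size_sort size_tuple.
have /tuple_permP[s sE] : perm_eq (Tuple sz) t by rewrite perm_sort.
exists s => i j ij.
have nthE (k : 'I_n) : (sort <=%O t)`_k = d (s k).
  have := congr1 (fun u => u`_k) sE; rewrite [tval (Tuple sz)]/= => ->.
  by rewrite (nth_map k) ?size_enum_ord// nth_ord_enum tnth_mktuple.
rewrite -!nthE; apply: (sorted_leq_nth le_trans le_refl) => //.
- exact: sort_le_sorted.
- by rewrite inE (eqP sz).
- by rewrite inE (eqP sz).
Qed.

(** If [e (t i) < d (s i)], the threshold [c = e (t i)] has at least [i + 1] values of [e] at or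
    below it, but at most [i] values of [d]. *)
Lemma sorted_le_of_card (R : realDomainType) (n : nat) (d e : 'I_n -> R)
  (s t : {perm 'I_n}) :
  (forall i j : 'I_n, (i <= j)%N -> d (s i) <= d (s j)) ->
  (forall i j : 'I_n, (i <= j)%N -> e (t i) <= e (t j)) ->
  (forall c, (#|[pred i | (e i <= c)%R]| <= #|[pred i | (d i <= c)%R]|)%N) ->
  forall i, d (s i) <= e (t i).
Proof.
move=> sd te card i; rewrite leNgt; apply/negP => lt.
have cI (u : 'I_n) : (u < #|[pred j : 'I_n | (j <= u)%N]|)%N.
  have := subset_leq_card (_ : [set widen_ord (ltn_ord u) k | k : 'I_u.+1]%SET
    \subset [pred j : 'I_n | (j <= u)%N]).
  rewrite card_imset ?card_ord; last by move=> x y /(congr1 val)/= /val_inj.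
  by apply; apply/fintype.subsetP => _ /imsetP[k _ ->]; rewrite inE/= -ltnS.
have cJ (u : 'I_n) : (#|[pred j : 'I_n | (j < u)%N]| <= u)%N.
  have := subset_leq_card (_ : [pred j : 'I_n | (j < u)%N] \subset
    [set widen_ord (ltnW (ltn_ord u)) k | k : 'I_u]%SET).
  rewrite card_imset ?card_ord; last by move=> x y /(congr1 val)/= /val_inj.
  apply; apply/fintype.subsetP => j; rewrite inE/= => ju.
  by apply/imsetP; exists (Ordinal ju) => //; exact: val_inj.
have := card (e (t i)); apply/negP; rewrite -ltnNge.
apply: (@leq_ltn_trans i).
  apply: leq_trans (cJ i); rewrite -(fintype.card_image (@perm_inj _ s) [pred j : 'I_n | (j < i)%N]).
  apply: subset_leq_card; apply/fintype.subsetP => x dx. 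
  apply/fintype.imageP; exists ((s^-1)%g x); last by rewrite permKV.
  rewrite inE ltnNge; apply: contraTN dx => ij; rewrite inE.
  by have := sd _ _ ij; rewrite permKV -ltNge; exact: lt_le_trans.
apply: leq_trans (cI i) _; rewrite -(fintype.card_image (@perm_inj _ t) [pred j : 'I_n | (j <= i)%N]).
apply: subset_leq_card.
by apply/fintype.subsetP => _ /fintype.imageP[j ji ->]; rewrite inE te.
Qed.

Definition subset_sums (R : realType) (n p : nat) (lam : 'I_n -> R) : seq R :=
  [seq \sum_(i in J) lam i | J : {set 'I_n} <- enum [set I : {set 'I_n} | #|I| == p]%SET].

Lemma size_subset_sums (R : realType) (n p : nat) (lam : 'I_n -> R) :
  size (subset_sums p lam) = 'C(n, p).
Proof. by rewrite size_map -cardE card_draws card_ord. Qed.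

Lemma sigma_Lambda (R : realType) (n p m : nat) (A : 'M[R]_n) :
  sigma m (Lambda p A) = elsym m (subset_sums p (eigenvalues A 0)).
Proof.
rewrite /sigma elsym_sigma; congr elsym.
apply: (@eq_from_nth _ 0).
  by rewrite size_subset_sums size_map size_enum_ord.
move=> i; rewrite size_map size_enum_ord => iN.
rewrite (nth_map (Ordinal iN)) ?size_enum_ord// mxE.
rewrite (nth_map finset.set0) -?cardE ?card_draws ?card_ord//.
by rewrite /multi_index nth_enum_ord.
Qed.

(** [eigenvalues] picks an arbitrary order, while Weyl's comparison works with sorted eigenvalues. A
    permutation of the indices acts on the [p]-subsets by images, so symmetric functions of the sums
    do not see the difference. *)
Lemma subset_sums_perm (R : realType) (n p : nat) (lam : 'I_n -> R)
  (s : {perm 'I_n}) :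
  perm_eq (subset_sums p (fun i => lam (s i))) (subset_sums p lam).
Proof.
pose E := enum [set I : {set 'I_n} | #|I| == p]%SET.
have pE : perm_eq [seq (s @: J)%SET | J : {set 'I_n} <- E] E.
  have injs : injective (fun I : {set 'I_n} => (s @: I)%SET).
    exact: imset_inj (@perm_inj _ s).
  apply: uniq_perm; rewrite ?map_inj_uniq ?enum_uniq// => I.
  apply/mapP/idP => [[J JE ->]|IE].
    move: JE; rewrite !mem_enum !inE card_imset//; exact: perm_inj.
  exists (s @^-1: I)%SET; last first.
    by apply/setP => x; rewrite -[x in RHS](permKV s) (mem_imset _ _ (@perm_inj _ s)) inE permKV.
  by move: IE; rewrite !mem_enum !inE card_preimset//; exact: perm_inj.
rewrite /subset_sums -/E perm_sym.
have := perm_map (fun J : {set 'I_n} => \sum_(i in J) lam i) pE.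
rewrite perm_sym => H; apply: perm_trans H _.
rewrite -map_comp; apply/seq.permP => a; congr (count a _); apply: eq_map => I /=.
by rewrite big_imset//=; move=> x y _ _; exact: perm_inj.
Qed.

(** A shift of every eigenvalue by [b] shifts a sum of [p] of them by [b * p]; this is the origin of
    the factor [p] in the growth along the identity. *)
Lemma subset_sums_affine (R : realType) (n p : nat) (lam : 'I_n -> R) (a b : R) :
  subset_sums p (fun i => a * lam i + b) =
  [seq x + b * p%:R | x <- [seq a * x | x <- subset_sums p lam]].
Proof.
rewrite /subset_sums -!map_comp; apply/eq_in_map => I /=.
rewrite mem_enum inE => /eqP Ip.
by rewrite big_split/= -mulr_sumr sumr_const Ip mulr_natr.
Qed.

Lemma char_poly_eigen_perm (R : realType) (n : nat) (d e : 'I_n -> R) :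
  \prod_i ('X - (d i)%:P) = \prod_i ('X - (e i)%:P) ->
  exists s : {perm 'I_n}, forall i, d i = e (s i).
Proof.
move=> de.
have /prod_XsubC_eq/tuple_permP[s sE] :
    \prod_(x <- [tuple d i | i < n]) ('X - x%:P) =
    \prod_(x <- [tuple e i | i < n]) ('X - x%:P).
  by rewrite !big_tuple; under eq_bigr do rewrite tnth_mktuple;
     rewrite de; apply: eq_bigr => i _; rewrite tnth_mktuple.
exists s => i; have := congr1 (fun u => u`_i) sE.
rewrite !(nth_map i) -?enumT ?size_enum_ord// !nth_ord_enum => ->.
by rewrite tnth_mktuple.
Qed.

Lemma eigenvalues_perm (R : realType) (n : nat) (A : 'M[R]_n) (d : 'I_n -> R) :
  char_poly A = \prod_i ('X - (d i)%:P) ->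
  exists s : {perm 'I_n}, forall i, eigenvalues A 0 i = d (s i).
Proof.
move=> Ad; apply: char_poly_eigen_perm; rewrite -Ad.
rewrite /eigenvalues; case: xgetP => [_ _ /= ->//|].
move/(_ (\row_i d i)) => /=; case.
by rewrite Ad; apply: eq_bigr => i _; rewrite mxE.
Qed.

(* Combines monotonicity, homogeneity and linear growth along the identity of the
   operator, when C <= a A - s I. *)
Lemma hquot_Lambda_le (R : realType) (n p k l : nat) (A C : 'M[R]_n) (a s : R) :
  (l < k)%N -> A^T = A -> C^T = C -> Gamma_cone k (Lambda p A) ->
  Gamma_cone k (Lambda p C) -> 0 < a -> 0 <= s ->
  (forall x : 'rV[R]_n, (x *m C *m x^T) 0 0 <=
     a * (x *m A *m x^T) 0 0 - s * (x *m x^T) 0 0) ->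
  (sigma k (Lambda p C) / sigma l (Lambda p C)) `^ (k - l)%:R^-1 +
     s * p%:R / ('C(n, p))%:R <=
  a * (sigma k (Lambda p A) / sigma l (Lambda p A)) `^ (k - l)%:R^-1.
Proof.
move=> lk As Cs gA gC a0 s0 le.
have cone (B : 'M[R]_n) : Gamma_cone k (Lambda p B) ->
    elsym_cone k (subset_sums p (eigenvalues B 0)).
  move=> gB [|j] jk; first by rewrite elsym0.
  by rewrite -sigma_Lambda; apply: gB; rewrite jk.
have [P [d [Pu AE Ad]]] := symmetric_spectral As.
have [Q [e [Qu CE Ce]]] := symmetric_spectral Cs.
pose D := a *: A - s%:M.
have Ds : D^T = D by rewrite /D linearB linearZ/= As tr_scalar_mx.
have DE : map_mx (real_complex R) D =
    P^t* *m diag_mx (\row_i real_complex R (a * d i - s)) *m P.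
  have -> : diag_mx (\row_i real_complex R (a * d i - s)) =
     real_complex R a *: diag_mx (\row_i real_complex R (d i)) - (real_complex R s)%:M.
    apply/matrixP => i j; rewrite !mxE; case: eqP => _.
      by rewrite !mulr1n rmorphB rmorphM.
    by rewrite !mulr0n mulr0 subr0.
  rewrite mulmxBr mulmxBl -scalemxAr -scalemxAl -AE map_mxB map_mxZ; congr (_ - _).
  rewrite map_scalar_mx scalar_mxC -mulmxA.
  by rewrite -(invmx_unitary Pu) (mulVmx (unitarymx_unit Pu)) mulmx1.
have CD (x : 'rV[R]_n) : (x *m C *m x^T) 0 0 <= (x *m D *m x^T) 0 0.
  apply: le_trans (le x) _; rewrite /D mulmxBr mulmxBl -scalemxAr -scalemxAl.
  by rewrite mul_mx_scalar -scalemxAl !mxE.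
have card c : (#|[pred i | (a * d i - s <= c)%R]| <= #|[pred i | (e i <= c)%R]|)%N.
  exact: (weyl_card _ Cs Ds Qu Pu CE DE CD).
have [t te] := sorting_perm e.
have [r rd] := sorting_perm (fun i => a * d i - s).
have ed := sorted_le_of_card te rd card.
have [tA tAE] := eigenvalues_perm Ad; have [tC tCE] := eigenvalues_perm Ce.
have pA : perm_eq (subset_sums p (eigenvalues A 0)) (subset_sums p d).
  rewrite (_ : eigenvalues A 0 = fun i => d (tA i)); last exact/funext.
  exact: subset_sums_perm.
have pC : perm_eq (subset_sums p (eigenvalues C 0)) (subset_sums p (fun i => e (t i))).
  rewrite (_ : eigenvalues C 0 = fun i => e (tC i)); last exact/funext.
  apply: perm_trans (subset_sums_perm _ _ _) _.
  by rewrite perm_sym subset_sums_perm.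
have HC : elsym_cone k (subset_sums p (fun i => e (t i))).
  by move=> j jk; rewrite -(elsym_perm _ pC); exact: cone.
have HA : elsym_cone k (subset_sums p d).
  by move=> j jk; rewrite -(elsym_perm _ pA); exact: cone.
pose LD := subset_sums p (fun i => a * d (r i) - s).
(* The cone condition for [D] is inherited from [C] by monotonicity; subtracting [s] from [a *: A]
   gives no such information. *)
have [HD CDle] : elsym_cone k LD /\
    hquot k l (subset_sums p (fun i => e (t i))) <= hquot k l LD.
  apply: hquot_le => //; first by rewrite !size_subset_sums.
  move=> i; rewrite size_map => iN.
  rewrite !(nth_map finset.set0)//; apply: ler_sum => j _; exact: ed.
have sp : 0 <= s * p%:R by rewrite mulr_ge0.
have := hquot_shift lk HD sp; rewrite size_subset_sums.
have pLD : perm_eq LD (subset_sums p (fun i => a * d i - s)).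
  exact: (subset_sums_perm p (fun i => a * d i - s)).
have shE : [seq x + s * p%:R | x <- subset_sums p (fun i => a * d i - s)] =
    [seq a * x | x <- subset_sums p d].
  rewrite subset_sums_affine -map_comp -[RHS]map_id; apply: eq_map => x /=.
  by rewrite mulNr subrK.
have hp (u v : seq R) : perm_eq u v -> hquot k l u = hquot k l v.
  by move=> uv; rewrite /hquot !(elsym_perm _ uv).
rewrite (hp _ _ (perm_map _ pLD)) shE (proj2 (hquot_scale lk HA a0)) => H.
have sE (B : 'M[R]_n) :
    (sigma k (Lambda p B) / sigma l (Lambda p B)) `^ (k - l)%:R^-1 =
    hquot k l (subset_sums p (eigenvalues B 0)) by rewrite !sigma_Lambda.
have subst2 (x y z x' z' : R) : x = x' -> z = z' -> x' + y <= a * z' -> x + y <= a * z.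
  by move=> -> ->.
apply: (subst2 _ _ _ _ _ (etrans (sE C) (hp _ _ pC)) (etrans (sE A) (hp _ _ pA))).
by apply: le_trans H; rewrite lerD2r.
Qed.

(** * Calculus on open sets and on closures *)

Lemma is_derive_line (R : realType) (n : nat) (f : 'rV[R]_n -> R)
  (x v : 'rV[R]_n) (t df : R) :
  is_derive (t *: v + x) v f df -> is_derive t 1 (fun t => f (t *: v + x)) df.
Proof.
move=> [dv <-].
have E : (fun h : R => h^-1 *: (((fun t => f (t *: v + x)) \o shift t) (h *: 1) -
    f (t *: v + x))) =
  (fun h : R => h^-1 *: ((f \o shift (t *: v + x)) (h *: v) - f (t *: v + x))).
  by apply/funext => h /=; rewrite [h *: 1]mulr1 scalerDl addrA.
by apply: DeriveDef; [move: dv; rewrite /derivable E|rewrite /derive E].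
Qed.

Lemma MVT_signed (R : realType) (f df : R -> R) (c : R) :
  (forall t : R, `|t| <= `|c| -> is_derive t 1 f (df t)) ->
  exists2 t : R, `|t| <= `|c| & f c - f 0 = df t * c.
Proof.
move=> fdf; have [c0|c0] := leP 0 c.
  have [||t] := @MVT_segment _ f df 0 c c0.
  - move=> t; rewrite in_itv/= => /andP[t0 tc]; apply: fdf.
    by rewrite !ger0_norm// ltW.
  - apply: derivable_within_continuous => t; rewrite in_itv/= => /andP[t0 tc].
    by have [] := fdf t; rewrite ?ger0_norm.
  - rewrite in_itv/= subr0 => /andP[t0 tc] E.
    by exists t; rewrite // !ger0_norm.
have [||t] := @MVT_segment _ f df c 0 (ltW c0).
- move=> t; rewrite in_itv/= => /andP[t0 tc]; apply: fdf.
  by rewrite !ler0_norm ?lerN2// ltW.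
- apply: derivable_within_continuous => t; rewrite in_itv/= => /andP[t0 tc].
  by have [] := fdf t; rewrite // !ler0_norm ?lerN2// ltW.
- rewrite in_itv/= sub0r => /andP[t0 tc] E.
  exists t; first by rewrite !ler0_norm ?lerN2// ltW.
  by rewrite -opprB E mulrN opprK.
Qed.

Lemma norm_coord_le (R : realType) (n : nat) (v : 'rV[R]_n) i : `|v 0 i| <= `|v|.
Proof.
rewrite [leRHS]/Num.Def.normr/= mx_normrE.
exact: (@le_bigmax _ _ _ _ (fun ij => `|v ij.1 ij.2|) (0, i)).
Qed.

Lemma norm_row_le (R : realType) (n : nat) (v : 'rV[R]_n) (c : R) : 0 <= c ->
  (forall i, `|v 0 i| <= c) -> `|v| <= c.
Proof.
move=> c0 vc; rewrite /Num.Def.normr/= mx_normrE bigmax_le// => -[i j] _ /=.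
by rewrite ord1.
Qed.

Lemma cvg_sumr (R : realType) (T : Type) (F : set_system T) {FF : Filter F}
  (I : Type) (r : seq I) (f : I -> T -> R) (a : I -> R) :
  (forall i, f i x @[x --> F] --> a i) ->
  \sum_(i <- r) f i x @[x --> F] --> \sum_(i <- r) a i.
Proof. by move=> fa; apply: cvg_big => // x; exact: add_continuous. Qed.

Section Dot.
Context {R : realType} {n : nat}.
Implicit Types u v w : 'rV[R]_n.

Lemma dotC u v : dot u v = dot v u.
Proof. by apply: eq_bigr => i _; rewrite mulrC. Qed.

Lemma dotDl u v w : dot (u + v) w = dot u w + dot v w.
Proof. by rewrite -big_split/=; apply: eq_bigr => i _; rewrite mxE mulrDl. Qed.

Lemma dotZl (a : R) u v : dot (a *: u) v = a * dot u v.
Proof. by rewrite mulr_sumr; apply: eq_bigr => i _; rewrite mxE mulrA. Qed.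

Lemma dotNl u v : dot (- u) v = - dot u v.
Proof. by rewrite -scaleN1r dotZl mulN1r. Qed.

Lemma dotBl u v w : dot (u - v) w = dot u w - dot v w.
Proof. by rewrite dotDl dotNl. Qed.

Lemma dotDr u v w : dot u (v + w) = dot u v + dot u w.
Proof. by rewrite !(dotC u) dotDl. Qed.

Lemma dotZr (a : R) u v : dot u (a *: v) = a * dot u v.
Proof. by rewrite !(dotC u) dotZl. Qed.

Lemma dotNr u v : dot u (- v) = - dot u v.
Proof. by rewrite !(dotC u) dotNl. Qed.

Lemma dotBr u v w : dot u (v - w) = dot u v - dot u w.
Proof. by rewrite !(dotC u) dotBl. Qed.

Lemma dot0l u : dot 0 u = 0.
Proof. by rewrite -(scale0r 0) dotZl mul0r. Qed.

Lemma dot0r u : dot u 0 = 0.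
Proof. by rewrite dotC dot0l. Qed.

Lemma dot_delta u i : dot u (delta_mx 0 i) = u 0 i.
Proof.
rewrite /dot (bigD1 i)//= mxE !eqxx mulr1 big1 ?addr0// => j ji.
by rewrite mxE (negPf ji) andbF mulr0.
Qed.

Lemma dot_ge0 u : 0 <= dot u u.
Proof. by apply: sumr_ge0 => i _; rewrite -expr2 sqr_ge0. Qed.

Lemma dot_eq0 u : (dot u u == 0) = (u == 0).
Proof.
apply/idP/eqP => [|->]; last by rewrite dot0l.
rewrite psumr_eq0 => [/allP H|i _]; last by rewrite -expr2 sqr_ge0.
apply/rowP => i; have := H i (mem_index_enum i).
by rewrite mulf_eq0 orbb mxE => /eqP.
Qed.

Lemma dot_gt0 u : u != 0 -> 0 < dot u u.
Proof. by move=> u0; rewrite lt_neqAle eq_sym dot_eq0 u0 dot_ge0. Qed.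

Lemma dot_norm_le u v (c : R) : (forall i, `|u 0 i| <= c) ->
  `|dot u v| <= n%:R * c * `|v|.
Proof.
move=> uc; apply: le_trans (ler_norm_sum _ _ _) _.
have -> : n%:R * c * `|v| = \sum_(i < n) c * `|v|.
  by rewrite sumr_const card_ord -mulrA mulr_natl.
by apply: ler_sum => i _; rewrite normrM ler_pM// norm_coord_le.
Qed.

Lemma dot_norm_le2 u v : `|dot u v| <= n%:R * `|u| * `|v|.
Proof. by apply: dot_norm_le => i; exact: norm_coord_le. Qed.

Lemma dot_continuous u : continuous (dot u).
Proof.
rewrite /dot => x; apply: (@cvg_sumr _ _ (nbhs x) (nbhs_filter x)) => i; apply: cvgM; first exact: cvg_cst.
exact: coord_continuous.
Qed.

Lemma enormE u : enorm u ^+ 2 = dot u u.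
Proof. by rewrite /enorm sqr_sqrtr// dot_ge0. Qed.

Lemma enorm_ge0 u : 0 <= enorm u.
Proof. exact: sqrtr_ge0. Qed.

Lemma enorm_gt0 u : u != 0 -> 0 < enorm u.
Proof. by move=> u0; rewrite sqrtr_gt0 dot_gt0. Qed.

Lemma norm_le_enorm u : `|u| <= enorm u.
Proof.
apply: norm_row_le => [|i]; first exact: enorm_ge0.
rewrite -ler_sqr ?nnegrE ?enorm_ge0// enormE real_normK ?num_real//.
rewrite /dot (bigD1 i)//= -expr2 lerDl; apply: sumr_ge0 => j _.
by rewrite -expr2 sqr_ge0.
Qed.

Lemma enorm_unit u : u != 0 -> dot ((enorm u)^-1 *: u) ((enorm u)^-1 *: u) = 1.
Proof.
move=> u0; rewrite dotZl dotZr -enormE.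
by have := enorm_gt0 u0 => /gt_eqF e0; field; rewrite e0.
Qed.
End Dot.

(* First-order expansion of f at x along D, with gradient g; at boundary points
   of a domain this is the only notion of derivative that is available. *)
Definition expansion (R : realType) (n : nat) (D : set 'rV[R]_n)
  (f : 'rV[R]_n -> R) (x g : 'rV[R]_n) : Prop :=
  forall e : R, 0 < e -> exists2 d : R, 0 < d & forall y, D y -> `|y - x| < d ->
    `|f y - f x - dot g (y - x)| <= e * `|y - x|.

(** The filter is left general: [0^'] yields directional derivatives at interior points, and [0^'+]
    one-sided derivatives along curves that lie in the boundary or end at a boundary point. *)
Lemma expansion_curve (R : realType) (n : nat) (D : set 'rV[R]_n)
  (f : 'rV[R]_n -> R) (x g v : 'rV[R]_n) (F : set_system R) {FF : Filter F}
  (gam : R -> 'rV[R]_n) :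
  (\forall t \near F, t != 0) -> t @[t --> F] --> (0 : R) ->
  expansion D f x g -> (\forall t \near F, D (gam t)) ->
  t^-1 *: (gam t - x) @[t --> F] --> v ->
  t^-1 * (f (gam t) - f x) @[t --> F] --> dot g v.
Proof.
move=> F0 Fc fE Dg gv.
have cdot : dot g (t^-1 *: (gam t - x)) @[t --> F] --> dot g v.
  by apply: continuous_cvg => //; exact: dot_continuous.
rewrite -[X in _ --> X]addr0.
have -> : (fun t => t^-1 * (f (gam t) - f x)) = (fun t =>
    dot g (t^-1 *: (gam t - x)) +
    t^-1 * (f (gam t) - f x - dot g (gam t - x))).
  by apply/funext => t; rewrite dotZr -mulrDr addrCA subrr addr0.
apply: cvgD => //; apply/cvgrPdist_le => e e0.
have v1 : 0 < `|v| + 1 by rewrite ltr_wpDl.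
have [d d0 fd] := fE (e / (`|v| + 1)) (divr_gt0 e0 v1).
have bnd : \forall t \near F, `|t^-1 *: (gam t - x)| <= `|v| + 1.
  move/cvgrPdist_le : gv => /(_ 1 ltr01); apply: filterS => t H.
  rewrite -[_ *: _](subrK v) addrC (le_trans (ler_normD _ _))// lerD2l.
  by rewrite distrC.
have tsmall : \forall t \near F, `|t| < d / (`|v| + 1).
  move/cvgrPdist_lt : Fc => /(_ (d / (`|v| + 1)) (divr_gt0 d0 v1)).
  by apply: filterS => t; rewrite sub0r normrN.
near=> t.
have t0 : t != 0 by near: t.
have tp : 0 < `|t| by rewrite normr_gt0.
have gb : `|gam t - x| <= (`|v| + 1) * `|t|.
  have : `|t^-1 *: (gam t - x)| <= `|v| + 1 by near: t.
  by rewrite normrZ normfV mulrC ler_pdivrMr.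
rewrite sub0r normrN normrM normfV mulrC ler_pdivrMr//.
apply: le_trans (fd _ _ _) _; first by near: t.
  apply: le_lt_trans gb _; rewrite mulrC -ltr_pdivlMr//; near: t; exact: tsmall.
by rewrite mulrAC ler_pdivrMr// -mulrA ler_wpM2l ?(ltW e0)// mulrC.
Unshelve. all: by end_near. Qed.

Lemma expansion_is_derive (R : realType) (n : nat) (D : set 'rV[R]_n)
  (f : 'rV[R]_n -> R) (x g v : 'rV[R]_n) :
  nbhs x D -> expansion D f x g -> is_derive x v f (dot g v).
Proof.
move=> Dx fE.
have H : (fun h : R => h^-1 *: ((f \o shift x) (h *: v) - f x)) @ 0^' --> dot g v.
  apply: (expansion_curve (D := D) (gam := fun t => t *: v + x)) => //.
  - by near=> t; near: t; exact: nbhs_dnbhs_neq.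
  - exact: cvg_within.
  - have : (fun t : R => t *: v + x) @ 0^' --> x.
      rewrite -[X in _ --> X]add0r -[X in X + _](scale0r v).
      apply: cvgD; last exact: cvg_cst.
      by apply: cvgZr_tmp; exact: cvg_within.
    by apply.
  - apply: (@cvg_trans _ (cst v @ 0^')); last exact: cvg_cst.
    apply: near_eq_cvg; near=> t; rewrite addrK scalerA mulVf ?scale1r//.
    by near: t; exact: nbhs_dnbhs_neq.
by apply: DeriveDef; [apply/cvg_ex; exists (dot g v)|exact: cvg_lim].
Unshelve. all: by end_near. Qed.

Section COpen.
Context {R : realType} {n : nat}.
Implicit Types (U V : set 'rV[R]_n) (f g : 'rV[R]_n -> R) (m : nat).

Lemma partials_rcons s i f : partials (rcons s i) f = partials s (partial i f).
Proof. by rewrite /partials foldr_rcons. Qed.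

(** This is the form suited to induction on [m]. In [partials] the last entry of the list is the
    derivative taken first, so peeling off the innermost derivative means working with [rcons]. *)
Lemma C_open_rec m U f : C_open m.+1 U f <->
  [/\ forall x, U x -> {for x, continuous f},
      forall i x, U x -> derivable f x (delta_mx 0 i) &
      forall i, C_open m U (partial i f)].
Proof.
split=> [[df cf]|[cf df pf]].
  split=> [x Ux|i x Ux|i]; [exact: (cf [::])|exact: (df [::])|split].
  - by move=> s j x sm Ux; rewrite -partials_rcons; apply: df; rewrite ?size_rcons.
  - by move=> s x sm Ux; rewrite -partials_rcons; apply: cf; rewrite ?size_rcons.
split.
- case/lastP => [i x _|s j i x]; first exact: df.
  rewrite size_rcons partials_rcons ltnS; have [H _] := pf j; exact: H.
- case/lastP => [x _|s j x]; first exact: cf.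
  rewrite size_rcons partials_rcons ltnS; have [_ H] := pf j; exact: H.
Qed.

Lemma C_open0 U f : C_open 0 U f <-> forall x, U x -> {for x, continuous f}.
Proof.
split=> [[_ cf] x Ux|cf]; first exact: (cf [::]).
by split=> [s i x|[|//] x _]; [rewrite ltn0|exact: cf].
Qed.

Lemma C_open_continuous m U f x : C_open m U f -> U x -> {for x, continuous f}.
Proof. by move=> [_ cf] Ux; exact: (cf [::]). Qed.

Lemma C_open_le m m' U f : (m <= m')%N -> C_open m' U f -> C_open m U f.
Proof.
move=> mm' [df cf]; split=> [s i x sm|s x sm]; first exact/df/(leq_trans sm).
exact/cf/(leq_trans sm).
Qed.

Lemma C_open_sub m U V f : U `<=` V -> C_open m V f -> C_open m U f.
Proof.
by move=> UV [df cf]; split=> [s i x sm|s x sm] /UV Ux; [exact: df|exact: cf].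
Qed.

Lemma C_open_local m U f : (forall x, U x -> exists2 V, V x & C_open m V f) ->
  C_open m U f.
Proof.
by move=> H; split=> [s i x sm|s x sm] /H[V Vx [df cf]]; [exact: df|exact: cf].
Qed.

Lemma partial_ext U f g i x : open U -> (forall y, U y -> f y = g y) -> U x ->
  partial i f x = partial i g x.
Proof.
move=> oU fg Ux; apply: near_eq_derive.
by apply: filterS (open_nbhs_nbhs (conj oU Ux)).
Qed.

Lemma near_eq_continuous (f g : 'rV[R]_n -> R) x : {near x, f =1 g} ->
  {for x, continuous f} -> {for x, continuous g}.
Proof.
move=> fg cf; rewrite /prop_for /continuous_at -(nbhs_singleton fg).
by apply: cvg_trans cf; exact: (near_eq_cvg fg).
Qed.

Lemma C_open_ext m U f g : open U -> (forall y, U y -> f y = g y) ->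
  C_open m U f -> C_open m U g.
Proof.
move=> oU; elim: m f g => [|m IHm] f g fg.
  move=> /C_open0 cf; apply/C_open0 => x Ux.
  have nfg : {near x, f =1 g} by apply: filterS (open_nbhs_nbhs (conj oU Ux)).
  exact: near_eq_continuous (cf x Ux).
move=> /C_open_rec[cf df pf]; apply/C_open_rec; split.
- move=> x Ux; have nfg : {near x, f =1 g}.
    by apply: filterS (open_nbhs_nbhs (conj oU Ux)).
  exact: near_eq_continuous (cf x Ux).
- move=> i x Ux; apply: near_eq_derivable (df i x Ux).
  by apply: filterS (open_nbhs_nbhs (conj oU Ux)).
- by move=> i; apply: IHm (pf i) => x Ux; exact: partial_ext Ux.
Qed.

Lemma C_open_cst m U (a : R) : C_open m U (fun=> a).
Proof.
elim: m a => [|m IHm] a; first by apply/C_open0 => x _; exact: cst_continuous.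
apply/C_open_rec; split=> [x _|i x _|i]; [exact: cst_continuous|exact: derivable_cst|].
have -> : partial i (fun=> a) = fun=> 0.
  by apply/funext => x; rewrite /partial derive_cst.
exact: IHm.
Qed.

Lemma is_derive_coord (x v : 'rV[R]_n) i :
  is_derive x v (fun y : 'rV[R]_n => y 0 i) (v 0 i).
Proof.
have H : (fun h : R => h^-1 *: (((fun y : 'rV[R]_n => y 0 i) \o shift x) (h *: v) - x 0 i))
    @ 0^' --> v 0 i.
  apply: (@cvg_trans _ (cst (v 0 i) @ 0^')); last exact: cvg_cst.
  apply: near_eq_cvg; near=> t; rewrite /= !mxE addrK [RHS]mulrA mulVf ?mul1r//.
  by near: t; exact: nbhs_dnbhs_neq.
by apply: DeriveDef; [apply/cvg_ex; exists (v 0 i)|exact: cvg_lim].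
Unshelve. all: by end_near. Qed.

Lemma C_open_coord m U i : C_open m U (fun x : 'rV[R]_n => x 0 i).
Proof.
case: m => [|m]; first by apply/C_open0 => x _; exact: coord_continuous.
apply/C_open_rec; split=> [x _|j x _|j]; first exact: coord_continuous.
  by have [] := is_derive_coord x (delta_mx 0 j) i.
have -> : partial j (fun x : 'rV[R]_n => x 0 i) = fun=> (delta_mx 0 j : 'rV[R]_n) 0 i.
  by apply/funext => x; have [_] := is_derive_coord x (delta_mx 0 j) i.
exact: C_open_cst.
Qed.

Lemma partialD f g i x : derivable f x (delta_mx 0 i) ->
  derivable g x (delta_mx 0 i) ->
  partial i (fun y => f y + g y) x = partial i f x + partial i g x.
Proof. exact: deriveD. Qed.

Lemma partialM f g i x : derivable f x (delta_mx 0 i) ->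
  derivable g x (delta_mx 0 i) ->
  partial i (fun y => f y * g y) x = f x * partial i g x + g x * partial i f x.
Proof. exact: deriveM. Qed.

Lemma C_openD m U f g : open U -> C_open m U f -> C_open m U g ->
  C_open m U (fun x => f x + g x).
Proof.
move=> oU; elim: m f g => [|m IHm] f g.
  by move=> /C_open0 cf /C_open0 cg; apply/C_open0 => x Ux; exact: continuousD (cf x Ux) (cg x Ux).
move=> /C_open_rec[cf df pf] /C_open_rec[cg dg pg]; apply/C_open_rec; split.
- by move=> x Ux; exact: continuousD (cf x Ux) (cg x Ux).
- by move=> i x Ux; apply: derivableD; [exact: df|exact: dg].
- move=> i; apply: C_open_ext (IHm _ _ (pf i) (pg i)) => // y Uy.
  by rewrite partialD//; [exact: df|exact: dg].
Qed.

Lemma C_openM m U f g : open U -> C_open m U f -> C_open m U g ->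
  C_open m U (fun x => f x * g x).
Proof.
move=> oU; elim: m f g => [|m IHm] f g.
  by move=> /C_open0 cf /C_open0 cg; apply/C_open0 => x Ux; exact: continuousM (cf x Ux) (cg x Ux).
move=> Cf Cg; have /C_open_rec[cf df pf] := Cf; have /C_open_rec[cg dg pg] := Cg.
apply/C_open_rec; split.
- by move=> x Ux; exact: continuousM (cf x Ux) (cg x Ux).
- by move=> i x Ux; apply: derivableM; [exact: df|exact: dg].
- move=> i; have Cf' := C_open_le (leqnSn m) Cf; have Cg' := C_open_le (leqnSn m) Cg.
  apply: C_open_ext (C_openD oU (IHm _ _ Cf' (pg i)) (IHm _ _ Cg' (pf i))) => // y Uy.
  by rewrite partialM//; [exact: df|exact: dg].
Qed.

Lemma C_openZ m U f (a : R) : open U -> C_open m U f ->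
  C_open m U (fun x => a * f x).
Proof. by move=> oU; apply: C_openM => //; exact: C_open_cst. Qed.

Lemma C_openN m U f : open U -> C_open m U f -> C_open m U (fun x => - f x).
Proof.
move=> oU Cf; apply: C_open_ext (C_openZ (-1) oU Cf) => // y _.
by rewrite mulN1r.
Qed.

Lemma C_openB m U f g : open U -> C_open m U f -> C_open m U g ->
  C_open m U (fun x => f x - g x).
Proof. by move=> oU Cf Cg; apply: C_openD => //; exact: C_openN. Qed.

Lemma C_openX m U f k : open U -> C_open m U f -> C_open m U (fun x => f x ^+ k).
Proof.
move=> oU Cf; elim: k => [|k IHk].
  by apply: C_open_ext (C_open_cst m U 1) => // y _; rewrite expr0.
by apply: C_open_ext (C_openM oU Cf IHk) => // y _; rewrite exprS.
Qed.

Lemma C_open_sum m U (I : Type) (r : seq I) (F : I -> 'rV[R]_n -> R) : open U ->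
  (forall i, C_open m U (F i)) -> C_open m U (fun x => \sum_(i <- r) F i x).
Proof.
move=> oU CF; elim: r => [|i r IHr].
  by apply: C_open_ext (C_open_cst m U 0) => // y _; rewrite big_nil.
by apply: C_open_ext (C_openD oU (CF i) IHr) => // y _; rewrite big_cons.
Qed.

Lemma is_derive_chain (phi : R -> R) f x v (c : R) :
  derivable f x v -> is_derive (f x) 1 phi c ->
  is_derive x v (phi \o f) (c * 'D_v f x).
Proof.
move=> df dphi.
have line (g : 'rV[R]_n -> R) : 'D_v g x = 'D_1 (fun h : R => g (h *: v + x)) 0.
  rewrite /derive; set g1 := fun h => h^-1 *: _; set g2 := fun h => h^-1 *: _.
  suff -> : g1 = g2 by []; apply/funext => h; rewrite /g1 /g2 /=.
  by rewrite addr0 scale0r add0r [_%:A]mulr1.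
have dl : derivable (fun h : R => f (h *: v + x)) 0 1 by exact: (proj1 (derivable1P f x v) df).
have dphi' : is_derive ((fun h : R => f (h *: v + x)) 0) 1 phi c.
  by rewrite /= scale0r add0r.
have := @is_derive1_comp _ phi (fun h : R => f (h *: v + x)) 0 c _ dphi' (derivableP dl).
rewrite -line => -[dc vc].
by apply: DeriveDef; [exact/derivable1P|rewrite line].
Qed.

Lemma C_openV m U f : open U -> (forall x, U x -> f x != 0) -> C_open m U f ->
  C_open m U (fun x => (f x)^-1).
Proof.
move=> oU f0; elim: m => [|m IHm] Cf.
  by apply/C_open0 => x Ux; exact: continuousV (f0 x Ux) (C_open_continuous Cf Ux).
have Cf' := IHm (C_open_le (leqnSn m) Cf).
have /C_open_rec[cf df pf] := Cf; apply/C_open_rec; split.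
- by move=> x Ux; exact: continuousV (f0 x Ux) (cf x Ux).
- by move=> i x Ux; apply: derivableV; [exact: f0|exact: df].
- move=> i; apply: C_open_ext (C_openN oU (C_openM oU (C_openX 2 oU Cf') (pf i))) => // y Uy.
  rewrite /partial deriveV ?f0//; last exact: df.
  by rewrite /GRing.scale/= exprVn mulNr.
Qed.

(** The function [psi a = a^(-1/2)] satisfies [psi' = - psi^3 / 2], so its derivative is a
    polynomial in itself and the induction on [m] closes. *)
Lemma C_open_invsqrt m U f : open U -> (forall x, U x -> 0 < f x) ->
  C_open m U f -> C_open m U (fun x => (Num.sqrt (f x))^-1).
Proof.
move=> oU f0; elim: m => [|m IHm] Cf.
  apply/C_open0 => x Ux; apply: continuousV; first by rewrite sqrtr_eq0 -ltNge f0.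
  by apply: continuous_comp (C_open_continuous Cf Ux) _; exact: sqrt_continuous.
have Cf' := IHm (C_open_le (leqnSn m) Cf).
have /C_open_rec[cf df pf] := Cf.
pose psi (a : R) := (Num.sqrt a)^-1.
have dpsi (a : R) : 0 < a -> is_derive a 1 psi (- 2^-1 * psi a ^+ 3).
  move=> a0; have s0 : Num.sqrt a != 0 by rewrite sqrtr_eq0 -ltNge.
  have ds := is_derive1_sqrt a0.
  have := is_deriveV s0 ds; rewrite /psi => H; apply: (is_derive_eq H).
  by rewrite /GRing.scale/=; field.
have chain i x : U x -> is_derive x (delta_mx 0 i) (psi \o f)
    (- 2^-1 * psi (f x) ^+ 3 * partial i f x).
  by move=> Ux; apply: is_derive_chain; [exact: df|exact/dpsi/f0].
apply/C_open_rec; split.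
- move=> x Ux; apply: continuousV; first by rewrite sqrtr_eq0 -ltNge f0.
  by apply: continuous_comp (cf x Ux) _; exact: sqrt_continuous.
- by move=> i x Ux; have [] := chain i x Ux.
- move=> i; apply: C_open_ext (C_openM oU (C_openZ (- 2^-1) oU (C_openX 3 oU Cf')) (pf i)) => // y Uy.
  by have [_] := chain i y Uy.
Qed.
End COpen.

(** Powers of the positive part serve as cutoffs: the power [m.+1] of a C^m function's positive part
    is again C^m, so a cube is enough for the C^2 gluing. *)
Definition pospart (R : realType) (a : R) : R := Num.max a 0.

Lemma pospart_continuous (R : realType) : continuous (@pospart R).
Proof.
move=> a; apply: (@continuous_max _ _ (fun x : R => x) (fun=> 0)).
  exact: id.
exact: cst_continuous.
Qed.

Lemma pospart_ge0 (R : realType) (a : R) : 0 <= pospart a.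
Proof. by rewrite /pospart le_max lexx orbT. Qed.

Lemma is_derive_pospartX (R : realType) (m : nat) (a : R) :
  is_derive a 1 (fun x => pospart x ^+ m.+2) (m.+2%:R * pospart a ^+ m.+1).
Proof.
rewrite /pospart; have [a0|a0|->] := ltgtP a 0.
- apply: (@near_eq_is_derive _ _ _ (cst 0)); last first.
    by rewrite expr0n mulr0; exact: is_derive_cst.
  near=> x; rewrite /= max_r ?expr0n//; apply: ltW; near: x; exact: lt_nbhsl.
- apply: (@near_eq_is_derive _ _ _ (fun x : R => x ^+ m.+2)).
    near=> x; rewrite /= max_l//; apply: ltW; near: x; exact: lt_nbhsr.

  apply: DeriveDef; first exact: exprn_derivable.
  by rewrite exp_derive [_ *: 1]mulr1.
- rewrite ?maxxx expr0n mulr0.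
  have H : (fun h : R => h^-1 *: (((fun x : R => Num.max x 0 ^+ m.+2) \o shift 0) (h *: 1)
      - Num.max 0 0 ^+ m.+2)) @ 0^' --> (0 : R).
    apply/cvgrPdist_le => e e0.
    have m0 : 0 < Num.min e 1 by rewrite lt_min e0 ltr01.
    near=> h; rewrite sub0r normrN ?maxxx expr0n subr0 /= addr0 [h *: 1]mulr1.
    have h0 : h != 0 by near: h; exact: nbhs_dnbhs_neq.
    have hp : 0 < `|h| by rewrite normr_gt0.
    have he : `|h| <= Num.min e 1.
      by near: h; apply: filterS (dnbhs0_lt m0) => x /ltW.
    move: he; rewrite le_min => /andP[he h1].
    rewrite normrM normfV mulrC ler_pdivrMr// normrX.
    have hm : `|Num.max h 0| <= `|h|.
      by case: (leP h 0) => h0'; rewrite ?normr0.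
    apply: (@le_trans _ _ (`|h| ^+ m.+2)); first by rewrite lerXn2r ?nnegrE.
    rewrite exprSr ler_pM2r// (le_trans _ he)// -[leRHS]expr1.
    by rewrite ler_wiXn2l.
  by apply: DeriveDef; [apply/cvg_ex; exists 0|exact: cvg_lim].
Unshelve. all: by end_near. Qed.

Section CalculusOpen.
Context {R : realType} {n : nat}.
Implicit Types (U V : set 'rV[R]_n) (f g : 'rV[R]_n -> R).

Lemma C_open_pospartX m U f : open U -> C_open m U f ->
  C_open m U (fun x => pospart (f x) ^+ m.+1).
Proof.
move=> oU; elim: m => [|m IHm] Cf.
  apply/C_open0 => x Ux; apply: continuous_comp (C_open_continuous Cf Ux) _.
  exact: pospart_continuous.
have Cf' := IHm (C_open_le (leqnSn m) Cf).
have /C_open_rec[cf df pf] := Cf.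
have chain i x : U x -> is_derive x (delta_mx 0 i) ((fun a => pospart a ^+ m.+2) \o f)
    (m.+2%:R * pospart (f x) ^+ m.+1 * partial i f x).
  by move=> Ux; apply: is_derive_chain; [exact: df|exact: is_derive_pospartX].
apply/C_open_rec; split.
- move=> x Ux; apply: (@continuous_comp _ _ _ f (fun a : R => pospart a ^+ m.+2) x (cf x Ux)).
  exact: (continuous_comp (@pospart_continuous R _) (@exprn_continuous R m.+2 _)).
- by move=> i x Ux; have [] := chain i x Ux.
- move=> i; apply: C_open_ext (C_openM oU (C_openZ m.+2%:R oU Cf') (pf i)) => // y Uy.
  by have [_] := chain i y Uy.
Qed.

Lemma continuous_dist_near f x (e : R) : {for x, continuous f} -> 0 < e ->
  exists2 d : R, 0 < d & forall y, `|y - x| < d -> `|f y - f x| <= e.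
Proof.
move=> cf e0; have : \forall y \near x, `|f y - f x| <= e.
  by move/cvgrPdist_le : cf => /(_ _ e0); apply: filterS => y; rewrite distrC.
move=> /nbhs_normP[d /= d0 dP]; exists d => // y yd; apply: dP.
by rewrite /ball_/= distrC.
Qed.

Lemma open_ball_sub U x : open U -> U x ->
  exists2 d : R, 0 < d & forall y, `|y - x| < d -> U y.
Proof.
move=> oU Ux; have /nbhs_normP[d /= d0 dP] := open_nbhs_nbhs (conj oU Ux).
by exists d => // y yd; apply: dP; rewrite /ball_/= distrC.
Qed.

(** Continuity of the partial derivatives gives differentiability: one goes from [x] to [y] changing
    one coordinate at a time ([P k] keeps the first [k] coordinates of the increment) and applies
    the mean value theorem to each move. Dividing [e] by [n.+1] rather than [n] covers [n = 0]. *)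
Lemma C1_expansion U f x : open U -> C_open 1 U f -> U x ->
  expansion U f x (grad f x).
Proof.
move=> oU /C_open_rec[cf df pf] Ux e e0.
have e'0 : 0 < e / n.+1%:R by rewrite divr_gt0.
have : \forall y \near x, U y /\ forall i, `|partial i f y - partial i f x| <= e / n.+1%:R.
  near=> y; split; first by near: y; exact: open_nbhs_nbhs.
  near: y; apply: filter_forall => i.
  have : {for x, continuous (partial i f)} by have := pf i; move/C_open0; apply.
  move=> /cvgrPdist_le/(_ _ e'0); apply: filterS => y; by rewrite distrC.
move=> /nbhs_normP[d /= d0 dP]; exists d => // y Uy.
set h := y - x => hd.
have hy : h + x = y by rewrite subrK.
clearbody h.
pose P k : 'rV[R]_n := \row_j (if (j < k)%N then h 0 j else 0).
have Pn k : `|P k| <= `|h|.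
  apply: norm_row_le => // i; rewrite mxE; case: ifP => _; rewrite ?normr0//.
  exact: norm_coord_le.
have near_ok z : `|z| <= `|h| -> U (z + x) /\
    forall i, `|partial i f (z + x) - partial i f x| <= e / n.+1%:R.
  move=> zh; apply: dP; rewrite /ball_/= opprD addrCA subrr addr0 normrN.
  exact: le_lt_trans hd.
have step k : (k <= n)%N ->
    `|f (P k + x) - f x - \sum_(j < n | (j < k)%N) partial j f x * h 0 j|
      <= k%:R * (e / n.+1%:R) * `|h|.
  elim: k => [_|k IHk kn].
    have -> : P 0%N = 0 by apply/rowP => j; rewrite !mxE.
    by rewrite add0r subrr sub0r big_pred0// oppr0 normr0 mul0r mul0r.
  pose i := Ordinal kn.
  have PS t : (\row_j (if (j < k)%N then h 0 j else if j == i then t else 0)) =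
      t *: delta_mx 0 i + P k.
    apply/rowP => j; rewrite !mxE eqxx/=; case: (eqVneq j i) => [->|ji].
      by rewrite ltnn mulr1 addr0.
    by rewrite mulr0 add0r.
  have Pk1 : P k.+1 = h 0 i *: delta_mx 0 i + P k.
    rewrite -PS; apply/rowP => j; rewrite !mxE ltnS leq_eqVlt -val_eqE/=.
    case: eqVneq => [jk|_]//=; rewrite jk ltnn; congr (h 0 _); exact: val_inj.
  have [t th tE] : exists2 t, `|t| <= `|h 0 i| &
      f (h 0 i *: delta_mx 0 i + (P k + x)) - f (0 *: delta_mx 0 i + (P k + x)) =
      partial i f (t *: delta_mx 0 i + (P k + x)) * h 0 i.
    apply: (@MVT_signed _ (fun t => f (t *: delta_mx 0 i + (P k + x)))
      (fun t => partial i f (t *: delta_mx 0 i + (P k + x)))) => t th.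
    apply: is_derive_line; apply/derivableP/df; rewrite addrA -PS.
    apply: (proj1 (near_ok _ _)); apply: norm_row_le => // j; rewrite mxE.
    case: ifP => _; first exact: norm_coord_le.
    by case: ifP => _; rewrite ?normr0// (le_trans th)// norm_coord_le.
  have := near_ok (t *: delta_mx 0 i + P k) _; rewrite -addrA => -[].
    rewrite -PS; apply: norm_row_le => // j; rewrite mxE.
    case: ifP => _; first exact: norm_coord_le.
    by case: ifP => _; rewrite ?normr0// (le_trans th)// norm_coord_le.
  move=> _ /(_ i) ti.
  rewrite (bigD1 i)//= (eq_bigl (fun j : 'I_n => (j < k)%N)); last first.
    by move=> j; rewrite -val_eqE/= ltnS ltn_neqAle andbC.
  have -> : f (P k.+1 + x) - f x - (partial i f x * h 0 i +
      \sum_(j < n | (j < k)%N) partial j f x * h 0 j) =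
    (partial i f (t *: delta_mx 0 i + (P k + x)) - partial i f x) * h 0 i +
    (f (P k + x) - f x - \sum_(j < n | (j < k)%N) partial j f x * h 0 j).
    by move: tE; rewrite scale0r add0r addrA -Pk1; lra.
  apply: le_trans (ler_normD _ _) _.
  have -> : k.+1%:R * (e / n.+1%:R) * `|h| =
    e / n.+1%:R * `|h| + k%:R * (e / n.+1%:R) * `|h| by rewrite -natr1; ring.
  apply: lerD; last exact/IHk/ltnW.
  by rewrite normrM ler_pM// norm_coord_le.
have := step n (leqnn n).
have -> : P n = h by apply/rowP => j; rewrite mxE ltn_ord.
rewrite hy (eq_bigl xpredT); last by move=> j; rewrite ltn_ord.
have -> : \sum_(j < n) partial j f x * h 0 j = dot (grad f x) h.
  by apply: eq_bigr => j _; rewrite mxE.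
move=> H; apply: le_trans H _; rewrite ler_wpM2r// mulrCA ger_pMr//.
by rewrite ler_pdivrMr// mul1r ler_nat.
Unshelve. all: by end_near. Qed.

Lemma C1_is_derive U f x v : open U -> C_open 1 U f -> U x ->
  is_derive x v f (dot (grad f x) v).
Proof.
move=> oU Cf Ux; apply: expansion_is_derive (C1_expansion oU Cf Ux).
exact: open_nbhs_nbhs.
Qed.

Lemma C1_MVT U f a b : open U -> C_open 1 U f ->
  (forall t : R, 0 <= t <= 1 -> U (t *: (b - a) + a)) ->
  exists2 t : R, 0 <= t <= 1 &
    f b - f a = dot (grad f (t *: (b - a) + a)) (b - a).
Proof.
move=> oU Cf Uab.
have [||t] := @MVT_segment _ (fun t => f (t *: (b - a) + a))
  (fun t => dot (grad f (t *: (b - a) + a)) (b - a)) 0 1 ler01.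
- move=> t; rewrite in_itv/= => /andP[t0 t1]; apply: is_derive_line.
  by apply: C1_is_derive oU Cf _; apply: Uab; rewrite !ltW.
- apply: derivable_within_continuous => t; rewrite in_itv/= => t01.
  have H : is_derive t 1 (fun t => f (t *: (b - a) + a))
      (dot (grad f (t *: (b - a) + a)) (b - a)).
    by apply: is_derive_line; apply: C1_is_derive oU Cf _; exact: Uab.
  by case: H.
- rewrite in_itv/= => t01; rewrite scale1r subrK scale0r add0r subr0 mulr1 => E.
  by exists t.
Qed.

Lemma derivable_line_is_derive f x i (t : R) :
  derivable f (t *: delta_mx 0 i + x) (delta_mx 0 i) ->
  is_derive t 1 (fun t => f (t *: delta_mx 0 i + x))
     (partial i f (t *: delta_mx 0 i + x)).
Proof. by move=> df; apply: is_derive_line; exact/derivableP. Qed.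

(** This prepares the symmetry of mixed derivatives: the second difference does not change when [i]
    and [j] are exchanged, and two mean values express it through a mixed derivative at a nearby
    point. *)
Lemma second_difference U f i j x (h : R) : C_open 2 U f ->
  (forall s t : R, `|s| <= `|h| -> `|t| <= `|h| ->
     U (s *: delta_mx 0 i + (t *: delta_mx 0 j + x))) ->
  exists s t : R, [/\ `|s| <= `|h|, `|t| <= `|h| &
    f (h *: delta_mx 0 i + (h *: delta_mx 0 j + x)) - f (h *: delta_mx 0 i + x) -
    f (h *: delta_mx 0 j + x) + f x =
    partial j (partial i f) (s *: delta_mx 0 i + (t *: delta_mx 0 j + x)) * h ^+ 2].
Proof.
move=> /C_open_rec[_ df pf] Uh.
have h00 : `|0 : R| <= `|h| by rewrite normr0.
have U0 s : `|s| <= `|h| -> U (s *: delta_mx 0 i + x).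
  by move=> sh; have := Uh s 0 sh h00; rewrite scale0r add0r.
have [|s sh sE] := @MVT_signed _ (fun s => f (s *: delta_mx 0 i + (h *: delta_mx 0 j + x)) -
   f (s *: delta_mx 0 i + x)) (fun s =>
   partial i f (s *: delta_mx 0 i + (h *: delta_mx 0 j + x)) -
   partial i f (s *: delta_mx 0 i + x)) h.
  move=> s sh.
  have H1 : is_derive s 1 (fun s => f (s *: delta_mx 0 i + (h *: delta_mx 0 j + x)))
      (partial i f (s *: delta_mx 0 i + (h *: delta_mx 0 j + x))).
    by apply: derivable_line_is_derive; apply: df; exact: Uh.
  have H2 : is_derive s 1 (fun s => f (s *: delta_mx 0 i + x))
      (partial i f (s *: delta_mx 0 i + x)).
    by apply: derivable_line_is_derive; apply: df; exact: U0.
  exact: is_deriveB.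
have [|t th tE] := @MVT_signed _ (fun t => partial i f (t *: delta_mx 0 j + (s *: delta_mx 0 i + x)))
   (fun t => partial j (partial i f) (t *: delta_mx 0 j + (s *: delta_mx 0 i + x))) h.
- move=> t th; apply: derivable_line_is_derive.
  have /C_open_rec[_ dpf _] := pf i; apply: dpf.
  by rewrite addrCA; exact: Uh.
- exists s, t; split=> //; move: sE tE.
  rewrite !scale0r !add0r ![_ *: delta_mx 0 j + (s *: _ + _)]addrCA => sE tE.
  rewrite expr2 mulrA -tE -sE; lra.
Qed.

Lemma partial_commute U f i j x : open U -> C_open 2 U f -> U x ->
  partial i (partial j f) x = partial j (partial i f) x.
Proof.
move=> oU Cf Ux; apply/eqP; rewrite -subr_eq0 -normr_le0; apply/ler_addgt0Pl => e e0.
rewrite addr0; have /C_open_rec[_ _ pf] := Cf.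
have c k l : {for x, continuous (partial k (partial l f))}.
  by have /C_open_rec[_ _ /(_ k)/C_open0] := pf l; apply.
have e2 : 0 < e / 2 by rewrite divr_gt0.
have [d1 d10 dU] := open_ball_sub oU Ux.
have [d2 d20 dij] := continuous_dist_near (c i j) e2.
have [d3 d30 dji] := continuous_dist_near (c j i) e2.
pose d := Num.min d1 (Num.min d2 d3); pose h := d / 4.
have d0 : 0 < d by rewrite /d !lt_min d10 d20 d30.
have dP y : `|y - x| < d -> [/\ U y,
   `|partial i (partial j f) y - partial i (partial j f) x| <= e / 2 &
   `|partial j (partial i f) y - partial j (partial i f) x| <= e / 2].
  by rewrite /d !lt_min => /and3P[? ? ?]; split; [exact: dU|exact: dij|exact: dji].
have h0 : 0 < h by rewrite divr_gt0.
have nd k : `|delta_mx 0 k : 'rV[R]_n| <= 1.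
  apply: norm_row_le => // l; rewrite mxE; case: (_ && _); rewrite ?normr1 ?normr0//.
have ok k l (s t : R) : `|s| <= `|h| -> `|t| <= `|h| ->
    `|s *: delta_mx 0 k + (t *: delta_mx 0 l + x) - x| < d.
  move=> sh th; rewrite addrA addrK.
  apply: le_lt_trans (ler_normD _ _) _; rewrite !normrZ.
  apply: (@le_lt_trans _ _ (h + h)); last by rewrite /h; lra.
  rewrite (gtr0_norm h0) in sh th.
  by apply: lerD; rewrite -[leRHS]mulr1 ler_pM.
have [s [t [sh th E1]]] := @second_difference U f i j x h Cf
   (fun s t sh th => let: And3 a _ _ := dP _ (ok i j s t sh th) in a).
have [s' [t' [sh' th' E2]]] := @second_difference U f j i x h Cf
   (fun s t sh th => let: And3 a _ _ := dP _ (ok j i s t sh th) in a).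
have E : partial j (partial i f) (s *: delta_mx 0 i + (t *: delta_mx 0 j + x)) =
   partial i (partial j f) (s' *: delta_mx 0 j + (t' *: delta_mx 0 i + x)).
  have hh : h ^+ 2 != 0 by rewrite expf_neq0// gt_eqF.
  apply: (mulIf hh).
  have A : h *: delta_mx 0 i + (h *: delta_mx 0 j + x) =
     h *: delta_mx 0 j + (h *: delta_mx 0 i + x) by rewrite addrCA.
  refine (etrans (esym E1) (etrans _ E2)); rewrite A.
  by move: (f _) (f _) (f _) (f _) => a1 a2 a3 a4; ring.
have [_ _ b1] := dP _ (ok i j s t sh th).
have [_ b2 _] := dP _ (ok j i s' t' sh' th').
move: b1 b2; rewrite E.
move: (partial i (partial j f) x) (partial j (partial i f) x).
move: (partial i (partial j f) _) => Z X Y b1 b2.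
have -> : X - Y = (Z - Y) - (Z - X) by ring.
apply: le_trans (ler_normB _ _) _; rewrite [leRHS](splitr e); exact: lerD b1 b2.
Qed.
End CalculusOpen.

(** * Extension of boundary data to the whole space *)

Definition bump (R : realType) (n : nat) (x0 : 'rV[R]_n) (r : R) (x : 'rV[R]_n) : R :=
  pospart (r ^+ 2 - dot (x - x0) (x - x0)) ^+ 3.

Section Bump.
Context {R : realType} {n : nat}.
Implicit Types (x : 'rV[R]_n) (r : R).

Lemma C_open_dotB m U x0 : open U ->
  C_open m U (fun x : 'rV[R]_n => dot (x - x0) (x - x0)).
Proof.
move=> oU; apply: C_open_sum => // i.
have H : C_open m U (fun x : 'rV[R]_n => x 0 i - x0 0 i).
  by apply: C_openB => //; [exact: C_open_coord|exact: C_open_cst].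
by apply: C_open_ext (C_openM oU H H) => // y _; rewrite !mxE.
Qed.

Lemma C_open_bump U x0 r : open U -> C_open 2 U (bump x0 r).
Proof.
move=> oU; apply: C_open_pospartX => //.
by apply: C_openB => //; [exact: C_open_cst|exact: C_open_dotB].
Qed.

Lemma bump_ge0 x0 r x : 0 <= bump x0 r x.
Proof. by rewrite exprn_ge0// pospart_ge0. Qed.

Lemma bump_gt0 x0 r x : 0 <= r -> (0 < bump x0 r x) = (enorm (x - x0) < r).
Proof.
move=> r0; have -> : (enorm (x - x0) < r) = (0 < r ^+ 2 - dot (x - x0) (x - x0)).
  by rewrite subr_gt0 -enormE ltr_sqr ?nnegrE ?enorm_ge0.
rewrite /bump /pospart; case: (ltP 0 (r ^+ 2 - _)) => [H|H].
  by rewrite exprn_gt0.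
by rewrite expr0n ltxx.
Qed.

Lemma bump_eq0 x0 r x : 0 <= r -> r <= `|x - x0| -> bump x0 r x = 0.
Proof.
move=> r0 rx; apply/eqP; rewrite eq_le bump_ge0 andbT leNgt bump_gt0// -leNgt.
by rewrite (le_trans rx)// norm_le_enorm.
Qed.

(** [Phi] is uncontrolled off [U], but the product vanishes where the max norm of [x - x0] is at
    least [r]. The gap [r < d] lets [U] and the open set where that norm exceeds [r] cover the
    space. *)
Lemma C_open_bumpM U (Phi : 'rV[R]_n -> R) x0 (r d : R) : open U -> 0 <= r -> r < d ->
  (forall y, `|y - x0| < d -> U y) -> C_open 2 U Phi ->
  C_open 2 setT (fun x => bump x0 r x * Phi x).
Proof.
move=> oU r0 rd Ud CPhi; apply: C_open_local => x _.
have [xd|dx] := ltP `|x - x0| d.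
  by exists U; [exact: Ud|apply: C_openM => //; exact: C_open_bump].
pose V := [set y : 'rV[R]_n | r < `|y - x0|].
have oV : open V.
  apply: (open_comp (f := fun y : 'rV[R]_n => `|y - x0|) (D := [set t | r < t])).
    move=> y _; apply: continuous_comp; last exact: norm_continuous.
    by apply: continuousB; [exact: id|exact: cst_continuous].
  exact: open_gt.
exists V; first exact: lt_le_trans dx.
apply: C_open_ext (C_open_cst 2 V 0) => // y Vy.
by rewrite bump_eq0 ?mul0r// ltW.
Qed.
End Bump.

Lemma closure_compact (R : realType) (n : nat) (Omega : set 'rV[R]_n) :
  bounded_set Omega -> compact (closure Omega).
Proof.
move=> bO; apply: bounded_closed_compact; last exact: closed_closure.
have [M [M0 OM]] := bO; exists (M + 1); split; first by rewrite realD// real1.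
move=> t Mt x cx /=.
have cl : closed [set y : 'rV[R]_n | `|y| <= t].
  apply: (closed_comp (f := fun y : 'rV[R]_n => `|y|) (D := [set s | s <= t])).
    by move=> y _; exact: norm_continuous.
  exact: closed_le.
have sub : Omega `<=` [set y : 'rV[R]_n | `|y| <= t].
  by move=> y Oy /=; apply: OM => //; apply: lt_trans Mt; rewrite ltrDl.
by have := closureS sub; rewrite -((closure_id _).1 cl) => H; exact: (H x cx).
Qed.

Lemma boundary_closed (T : topologicalType) (A : set T) : closed (boundary A).
Proof.
rewrite /boundary setDE; apply: closedI; first exact: closed_closure.
by apply: open_closedC; exact: open_interior.
Qed.

Lemma boundary_compact (R : realType) (n : nat) (Omega : set 'rV[R]_n) :
  bounded_set Omega -> compact (boundary Omega).
Proof.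
move=> bO; apply: subclosed_compact (closure_compact bO) _.
  exact: boundary_closed.
by move=> x [].
Qed.

(* The local extensions are glued by bump functions; adding
   pospart (c - S) ^+ 3 to the sum S of the bumps keeps the denominator
   positive away from the boundary without changing it where S >= c. *)
Lemma C2_boundary_extension (R : realType) (n : nat) (Omega : set 'rV[R]_n)
  (phi : 'rV[R]_n -> R) : bounded_set Omega -> C_boundary 2 Omega phi ->
  exists Phi : 'rV[R]_n -> R, C_open 2 setT Phi /\
    forall x, boundary Omega x -> Phi x = phi x.
Proof.
move=> bO Cphi.
have [B0|nB0] := pselect (boundary Omega !=set0); last first.
  exists (fun=> 0); split; first exact: C_open_cst.
  by move=> x Bx; case: nB0; exists x.
have /choice[W WP] : forall x, exists w : R * ('rV[R]_n -> R), boundary Omega x ->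
   [/\ 0 < w.1, C_open 2 setT (fun y => bump x w.1 y * w.2 y) &
    forall y, boundary Omega y -> bump x w.1 y * w.2 y = bump x w.1 y * phi y].
  move=> x; have [Bx|nBx] := pselect (boundary Omega x); last by exists (0, fun=> 0).
  have [U [Phi [oU Ux CPhi PhiE]]] := Cphi x Bx.
  have /nbhs_normP[d /= d0 dU] := open_nbhs_nbhs (conj oU Ux).
  have dU' y : `|y - x| < d -> U y by move=> yd; apply: dU; rewrite /ball_/= distrC.
  have d2 : 0 < d / 2 by rewrite divr_gt0.
  exists (d / 2, Phi) => _; split=> //=.
    apply: (C_open_bumpM oU (ltW d2) _ dU' CPhi).
    by rewrite ltr_pdivrMr// ltr_pMr// ltr1n.
  move=> y By; have [yd|dy] := ltP `|y - x| d.
    by rewrite PhiE//; exact: dU'.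
  rewrite bump_eq0 ?mul0r ?(ltW d2)//; apply: le_trans dy.
  by rewrite ler_pdivrMr// ler_pMr// ler1n.
pose b x y := bump x (W x).1 y.
have Cb x : C_open 2 setT (b x) by apply: C_open_bump; exact: openT.
have := boundary_compact bO; rewrite compact_cover.
move=> /(_ _ (boundary Omega) (fun x => [set y | 0 < b x y])).
case=> [x Bx||F FB Fcov].
- apply: (open_comp (f := b x) (D := [set t | 0 < t])); last exact: open_gt.
  by move=> y _; exact: C_open_continuous (Cb x) I.
- move=> x Bx; exists x => //=; rewrite bump_gt0 ?subrr.
    rewrite /enorm dot0l sqrtr0; by have [] := WP x Bx.
  by apply: ltW; have [] := WP x Bx.
pose D := finmap.enum_fset F.
have DBx x : x \in D -> boundary Omega x by move=> xD; have := FB x xD; rewrite inE.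
have cov y : boundary Omega y -> exists2 x, x \in D & 0 < b x y.
  by move=> By; have [x xF bx] := Fcov y By; exists x.
pose S y := \sum_(x <- D) b x y.
pose T y := \sum_(x <- D) b x y * (W x).2 y.
have CS : C_open 2 setT S by apply: C_open_sum => //; exact: openT.
have CT : C_open 2 setT T.
  rewrite /T; have : {subset D <= boundary Omega}.
    by move=> x /DBx; rewrite inE.
  elim: (D) => [_|x r IHr rB].
    by apply: C_open_ext (C_open_cst 2 setT 0); [exact: openT|move=> y _; rewrite big_nil].
  have Bx : boundary Omega x by have := rB x (mem_head _ _); rewrite inE.
  have [_ Cx _] := WP x Bx.
  have Cr := IHr (fun z zr => rB z (@mem_behead _ (x :: r) z zr)).
  by apply: C_open_ext (C_openD openT Cx Cr); [exact: openT|move=> y _; rewrite big_cons].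
have S_ge0 y : 0 <= S y by apply: sumr_ge0 => x _; exact: bump_ge0.
have S_gt0 y : boundary Omega y -> 0 < S y.
  move=> By; have [x xD bx] := cov y By.
  rewrite /S (big_rem x)//= ltr_wpDr//.
  by apply: sumr_ge0 => z _; exact: bump_ge0.
have [y0 By0 Smin] : exists2 y0, y0 \in boundary Omega &
    forall y, y \in boundary Omega -> S y0 <= S y.
  apply: EVT_min_rV => //; first exact: boundary_compact.
  by apply: continuous_subspaceT => y; exact: C_open_continuous CS I.
pose c := S y0; have c0 : 0 < c by apply: S_gt0; rewrite inE in By0.
pose Q y := S y + pospart (c - S y) ^+ 3.
have Q_gt0 y : 0 < Q y.
  rewrite /Q; have [Sc|cS] := ltP (S y) c.
    rewrite ltr_wpDl// exprn_gt0// /pospart lt_max subr_gt0 Sc//.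
  by rewrite ltr_wpDr ?exprn_ge0 ?pospart_ge0// (lt_le_trans c0).
have CQ : C_open 2 setT Q.
  apply: C_openD => //; first exact: openT.
  apply: C_open_pospartX; first exact: openT.
  by apply: C_openB => //; [exact: openT|exact: C_open_cst].
exists (fun y => T y * (Q y)^-1); split.
  apply: C_openM => //; first exact: openT.
  by apply: C_openV => //; [exact: openT|move=> x _; rewrite gt_eqF].
move=> y By; have cS : c <= S y by apply: Smin; rewrite inE.
have -> : Q y = S y.
  by rewrite /Q /pospart max_r ?subr_le0// expr0n addr0.
have -> : T y = S y * phi y.
  rewrite /T /S mulr_suml big_seq [RHS]big_seq; apply: eq_bigr => x xD.
  by have [_ _ ->] := WP x (DBx x xD).
by rewrite mulrAC mulfV ?mul1r// gt_eqF// S_gt0.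
Qed.

(** * Derivatives extended continuously to the closure *)

Section ClosureCalculus.
Context {R : realType} {n : nat}.
Implicit Types (Omega : set 'rV[R]_n) (f g h : 'rV[R]_n -> R).

Lemma closure_open_cases Omega x : open Omega -> closure Omega x ->
  Omega x \/ boundary Omega x.
Proof.
move=> oO cx; have [Ox|nOx] := pselect (Omega x); [by left|right].
by split=> // /interior_subset.
Qed.

Lemma within_closure_near Omega h x (e : R) :
  {within closure Omega, continuous h} -> closure Omega x -> 0 < e ->
  exists2 d : R, 0 < d & forall y, closure Omega y -> `|y - x| < d ->
    `|h y - h x| <= e.
Proof.
move=> /subspace_continuousP ch cx e0; have := ch x cx.
move/cvgrPdist_le => /(_ _ e0) /nbhs_normP[d /= d0 dP]; exists d => // y cy yd.
by rewrite distrC; apply: dP => //; rewrite /ball_/= distrC.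
Qed.

Lemma closure_near Omega x (d : R) : closure Omega x -> 0 < d ->
  exists2 y, Omega y & `|y - x| < d.
Proof.
move=> cx d0; have /cx[y [Oy]] : nbhs x (ball x d) by exact: nbhsx_ballx.
rewrite -ball_normE/= => yd.
by exists y => //; rewrite distrC.
Qed.

Lemma closure_norm_le Omega h (c : R) :
  {within closure Omega, continuous h} -> (forall x, Omega x -> `|h x| <= c) ->
  forall x, closure Omega x -> `|h x| <= c.
Proof.
move=> ch hc x cx; apply/ler_addgt0Pr => e e0.
have [d d0 dP] := within_closure_near ch cx e0.
have [y Oy yd] := closure_near cx d0.
rewrite -[h x](subrK (h y)) addrC (le_trans (ler_normD _ _))// lerD ?hc//.
by rewrite distrC; apply: dP => //; exact: subset_closure.
Qed.

Lemma extension_eq Omega g h x : {within closure Omega, continuous h} ->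
  (forall y, Omega y -> h y = g y) -> closure Omega x -> extension Omega g x = h x.
Proof.
move=> ch hg cx.
have PF : ProperFilter (within Omega (nbhs x)).
  exact: within_nbhs_proper.
apply: cvg_lim => //; apply/cvgrPdist_le => e e0.
have [d d0 dP] := within_closure_near ch cx e0.
rewrite near_withinE; apply/nbhs_ballP; exists d => //= y; rewrite -ball_normE/= => yd Oy.
rewrite -hg// distrC.
by apply: dP; [exact: subset_closure|rewrite distrC].
Qed.

Lemma extension_C_closure Omega m f s : C_closure m Omega f -> (size s <= m)%N ->
  {within closure Omega, continuous (extension Omega (partials s f))} /\
  forall x, Omega x -> extension Omega (partials s f) x = partials s f x.
Proof.
move=> [_ _ H] sm; have [h [ch hE]] := H s sm.
have E x : closure Omega x -> extension Omega (partials s f) x = h x.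
  exact: extension_eq.
split; last by move=> x Ox; rewrite E ?hE//; exact: subset_closure.
apply/subspace_continuousP => x cx; rewrite /from_subspace E//.
move/subspace_continuousP : ch => /(_ x cx); rewrite /from_subspace; apply: cvg_trans.
apply: near_eq_cvg; near=> y; rewrite E//.
by near: y; rewrite near_withinE; apply: nearW.
Unshelve. all: by end_near. Qed.

Lemma within_compact_bounded (A : set 'rV[R]_n) h : compact A ->
  {within A, continuous h} -> exists2 c, 0 <= c & forall x, A x -> `|h x| <= c.
Proof.
move=> cA ch; have [A0|nA0] := pselect (A !=set0); last first.
  by exists 0 => // x Ax; case: nA0; exists x.
have [c1 _ c1P] := EVT_max_rV A0 cA ch; have [c2 _ c2P] := EVT_min_rV A0 cA ch.
exists (`|h c1| + `|h c2|) => [|x Ax]; first by rewrite addr_ge0.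
have := c1P x; have := c2P x; rewrite !inE => /(_ Ax) l /(_ Ax) r.
rewrite ler_norml; apply/andP; split.
  apply: le_trans l; have := ler_norm (- h c2); rewrite normrN.
  by have := normr_ge0 (h c1); lra.
by apply: (le_trans r); have := ler_norm (h c1); have := normr_ge0 (h c2); lra.
Qed.

(** Without this the [sup] in [normC] would say nothing about the derivatives. There are finitely
    many index lists of length [j], hence the tuples, and each derivative is bounded because its
    extension is continuous on a compact closure. *)
Lemma partials_has_ubound Omega m f j : bounded_set Omega -> C_closure m Omega f ->
  (j <= m)%N ->
  has_ubound [set `|partials s f x| | s in [set s : seq 'I_n | size s = j]
                               & x in Omega].
Proof.
move=> bO Cf jm.
have /choice[c cP] : forall t : j.-tuple 'I_n, exists c : R, 0 <= c /\
    forall x, Omega x -> `|partials t f x| <= c.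
  move=> t; have [|cE E] := @extension_C_closure Omega m f t Cf.
    by rewrite size_tuple.
  have [c c0 H] := within_compact_bounded (closure_compact bO) cE.
  by exists c; split=> // x Ox; rewrite -E//; apply: H; exact: subset_closure.
exists (\sum_(t : j.-tuple 'I_n) c t) => _ [s /= sj [x Ox <-]].
have sj' : size s == j by rewrite sj.
have := (cP (Tuple sj')).2 x Ox => /le_trans; apply.
by rewrite (bigD1 (Tuple sj'))//= lerDl; apply: sumr_ge0 => t _; have [] := cP t.
Qed.

Lemma partials_le_normC Omega m f s x : bounded_set Omega -> C_closure m Omega f ->
  (size s <= m)%N -> Omega x -> `|partials s f x| <= normC m Omega f.
Proof.
move=> bO Cf sm Ox.
have ge0 (j : 'I_m.+1) : 0 <= sup [set `|partials s f x| | s in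
    [set s : seq 'I_n | size s = j] & x in Omega].
  set A := (X in sup X); have [[y Ay]|nA] := pselect (A !=set0).
    apply: (@le_trans _ _ y); first by case: Ay => t _ [z _ <-].
    apply: (ub_le_sup _ Ay); apply: (partials_has_ubound bO Cf).
    by rewrite -ltnS ltn_ord.
  by rewrite sup_out// => -[].
have sm' : (size s < m.+1)%N by rewrite ltnS.
rewrite /normC (bigD1 (Ordinal sm'))//= ler_wpDr//; first exact: sumr_ge0.
apply: ub_le_sup; first exact: (partials_has_ubound bO Cf).
by exists s => //; exists x.
Qed.

Lemma normC_ge0 Omega m f : bounded_set Omega -> C_closure m Omega f ->
  0 <= normC m Omega f.
Proof.
move=> bO Cf; apply: sumr_ge0 => j _.
set A := (X in sup X); have [[y Ay]|nA] := pselect (A !=set0).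
  apply: (@le_trans _ _ y); first by case: Ay => t _ [z _ <-].
  apply: (ub_le_sup _ Ay); apply: (partials_has_ubound bO Cf).
    by rewrite -ltnS ltn_ord.
by rewrite sup_out// => -[].
Qed.

Lemma C_open_C_closure Omega m f : C_open m setT f -> C_closure m Omega f.
Proof.
move=> Cf; have [_ cf] := Cf; split.
- exact: C_open_sub Cf.
- by apply: continuous_subspaceT => x; exact: C_open_continuous Cf I.
- move=> s sm; exists (partials s f); split=> //.
  by apply: continuous_subspaceT => x; exact: cf.
Qed.

(** The infimum in [normC_boundary] need not be attained, hence the [+ 1]. [C2_boundary_extension]
    supplies a competitor, so that the infimum is taken over a nonempty set. *)
Lemma normC_boundary_extension Omega phi : bounded_set Omega ->
  C_boundary 2 Omega phi ->
  exists Phi, [/\ C_closure 2 Omega Phi,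
    forall x, boundary Omega x -> Phi x = phi x &
    normC 2 Omega Phi <= normC_boundary 2 Omega phi + 1].
Proof.
move=> bO Cphi; have [Phi [CPhi PhiE]] := C2_boundary_extension bO Cphi.
have [||_ [Psi [CPsi PsiE] <-] lt] := @inf_adherent R
  [set normC 2 Omega Phi | Phi in
    [set Phi : 'rV[R]_n -> R | C_closure 2 Omega Phi /\
      forall x, boundary Omega x -> Phi x = phi x]] 1.
- exact: ltr01.
- split; first by exists (normC 2 Omega Phi); exists Phi => //; split=> //;
    exact: C_open_C_closure.
  by exists 0 => _ [Psi [CPsi _] <-]; exact: normC_ge0.
- by exists Psi; split=> //; exact: ltW.
Qed.
End ClosureCalculus.

(** * Geometry of the boundary *)

Lemma segment_norm_lt (R : realType) (n : nat) (x a b : 'rV[R]_n) (t r : R) :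
  0 <= t <= 1 -> `|a - x| < r -> `|b - x| < r -> `|t *: (b - a) + a - x| < r.
Proof.
move=> /andP[t0 t1] ar br.
have -> : t *: (b - a) + a - x = t *: (b - x) + (1 - t) *: (a - x).
  by apply/rowP => i; rewrite !mxE; ring.
apply: le_lt_trans (ler_normD _ _) _; rewrite !normrZ ger0_norm//.
rewrite (ger0_norm (_ : 0 <= 1 - t)) ?subr_ge0//.
have [->|t0'] := eqVneq t 0; first by rewrite mul0r add0r subr0 mul1r.
have tp : 0 < t by rewrite lt_neqAle eq_sym t0'.
have : t * `|b - x| < t * r by rewrite ltr_pM2l.
have : (1 - t) * `|a - x| <= (1 - t) * r by rewrite ler_wpM2l ?subr_ge0// ltW.
lra.
Qed.

(** The error is relative to [b - a] with both end points free, unlike in [expansion]: near a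
    boundary point, increments of [rho] between two points other than [x] have to be controlled. *)
Lemma C1_strict_expansion (R : realType) (n : nat) (U : set 'rV[R]_n)
  (f : 'rV[R]_n -> R) (x : 'rV[R]_n) (e : R) :
  open U -> C_open 1 U f -> U x -> 0 < e ->
  exists2 r : R, 0 < r & (forall y, `|y - x| < r -> U y) /\
    forall a b, `|a - x| < r -> `|b - x| < r ->
      `|f b - f a - dot (grad f x) (b - a)| <= e * `|b - a|.
Proof.
move=> oU Cf Ux e0; have [d1 d10 dU] := open_ball_sub oU Ux.
have e'0 : 0 < e / n.+1%:R by rewrite divr_gt0.
have [d2 d20 d2P] : exists2 d : R, 0 < d & forall y, `|y - x| < d ->
    forall i, `|partial i f y - partial i f x| <= e / n.+1%:R.
  have /C_open_rec[_ _ pf] := Cf.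
  have /choice[d dP] : forall i, exists d : R, 0 < d /\ forall y, `|y - x| < d ->
      `|partial i f y - partial i f x| <= e / n.+1%:R.
    move=> i; have /C_open0/(_ x Ux) cf := pf i.
    by have [d d0 H] := continuous_dist_near cf e'0; exists d.
  exists (\big[Num.min/1]_(i < n) d i) => [|y yd i].
    by apply: lt_bigmin => // i _; have [] := dP i.
  have [_] := dP i; apply; apply: lt_le_trans yd _; exact: bigmin_le_cond.
exists (Num.min d1 d2); first by rewrite lt_min d10.
split=> [y|a b]; first by rewrite lt_min => /andP[/dU].
move=> ad bd; have seg t (t01 : 0 <= t <= 1) := segment_norm_lt t01 ad bd.
have [|t t01 ->] := C1_MVT (a := a) (b := b) oU Cf.
  by move=> t /seg; rewrite lt_min => /andP[/dU].
rewrite -dotBl; have := seg t t01; rewrite lt_min => /andP[_ td].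
apply: le_trans (dot_norm_le (c := e / n.+1%:R) _ _) _.
  by move=> i; rewrite !mxE; exact: d2P.
rewrite ler_wpM2r// mulrCA ger_pMr// ler_pdivrMr// mul1r ler_nat.
exact: leqnSn.
Qed.

Lemma norm_diff_perturb (R : realFieldType) (a a' c c' q m z : R) :
  `|a' - a| <= z / 2 -> `|c' - c| <= z / 2 -> `|a' - c' - q| <= m ->
  `|a - c - q| <= m + z.
Proof.
by rewrite !ler_norml => /andP[? ?] /andP[? ?] /andP[? ?]; apply/andP; split; lra.
Qed.

Section BoundaryPoint.
Context {R : realType} {n : nat} (Omega : set 'rV[R]_n) (x0 : 'rV[R]_n).
Context (U : set 'rV[R]_n) (rho : 'rV[R]_n -> R).
Hypothesis oO : open Omega.
Hypothesis Bx0 : boundary Omega x0.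
Hypothesis Ldef : local_defining 1 Omega x0 U rho.

Let g := grad rho x0.

Let Ux0 : U x0. Proof. by have [[]] := Ldef. Qed.

Let rho0 : rho x0 = 0. Proof. by have [_ _ _ _ H] := Ldef; apply/H. Qed.

Lemma grad_defining_neq0 : g != 0.
Proof. by have [_ _ H _ _] := Ldef; exact: H. Qed.

Let gg : 0 < dot g g. Proof. exact/dot_gt0/grad_defining_neq0. Qed.

Let gn : 0 < `|g|. Proof. by rewrite normr_gt0 grad_defining_neq0. Qed.

Lemma defining_closure_le0 y : U y -> closure Omega y -> rho y <= 0.
Proof.
move=> Uy cy; have [_ _ _ OP BP] := Ldef.
have [/OP H|/BP H] := closure_open_cases oO cy; first exact/ltW/H.
by rewrite H.
Qed.

(** Near [x0] the function [rho] decreases along [- g] at rate at least [dot g g / 2]. The first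
    form starts at any point of the closure, where [rho <= 0]; in the second the starting point [z]
    may be outside, at a distance from [x0] small compared with the step [s]. *)
Lemma inward_cone : exists r delta : R, [/\ 0 < r, 0 < delta,
  forall y s, closure Omega y -> `|y - x0| < r -> 0 < s -> s < r -> Omega (y - s *: g) &
  forall z s, 0 < s -> s < r -> `|z - x0| <= delta * s -> Omega (z - s *: g)].
Proof.
have [oU CU _ OP _] := Ldef.
(* With this [e], the error of the expansion over a step [s *: g] is half of the gain
   [s * dot g g]. *)
pose e := dot g g / (2 * `|g|).
have e0 : 0 < e by rewrite divr_gt0// mulr_gt0.
have [r0 r00 [rU rE]] := C1_strict_expansion oU.1 CU Ux0 e0.
pose M := n%:R * `|g| + e + 1.
have M0 : 0 < M by rewrite /M ltr_wpDl// addr_ge0 ?(ltW e0)// mulr_ge0.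
have ege : e * `|g| = dot g g / 2.
  by rewrite /e; field; rewrite gt_eqF.
(* Here [M * delta] is a quarter of [dot g g], so starting at distance [delta * s] from [x0] costs
   at most half of the decrease that is left. *)
pose delta := dot g g / (2 * M) / 2.
have de0 : 0 < delta by rewrite /delta divr_gt0// divr_gt0// mulr_gt0.
pose r := r0 / (2 * (1 + `|g| + delta)).
have den : 0 < 2 * (1 + `|g| + delta) by rewrite mulr_gt0// !addr_gt0.
have r_gt0 : 0 < r by rewrite /r divr_gt0.
have rr : r * (1 + `|g| + delta) < r0.
  have -> : r * (1 + `|g| + delta) = r0 / 2 by rewrite /r; field; rewrite gt_eqF//; lra.
  by lra.
have r1 : r + r * `|g| < r0.
  by have : 0 < r * delta by [rewrite mulr_gt0|]; move: rr; rewrite !mulrDr mulr1; lra.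
exists r, delta; split=> //.
- move=> y s cy yr s0 sr.
  have yr0 : `|y - x0| < r0.
    by apply: lt_trans yr _; have : 0 < r * `|g| by [rewrite mulr_gt0|]; lra.
  have ysr : `|y - s *: g - x0| < r0.
    rewrite addrAC; apply: le_lt_trans (ler_normB _ _) _.
    rewrite normrZ gtr0_norm//.
    have : s * `|g| <= r * `|g| by rewrite ler_wpM2r// ltW.
    by lra.
  apply/OP; first exact: rU.
  have := rE _ _ yr0 ysr.
  have := defining_closure_le0 (rU _ yr0) cy.
  have -> : y - s *: g - y = - (s *: g) by rewrite addrAC subrr sub0r.
  rewrite dotNr dotZr normrN normrZ gtr0_norm// mulrCA ege -/g => ry.
  move=> /(le_trans (ler_norm _)) H.
  have : 0 < s * dot g g by rewrite mulr_gt0.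
  by lra.
- move=> z s s0 sr zs.
  have zr0 : `|z - s *: g - x0| < r0.
    rewrite addrAC; apply: le_lt_trans (ler_normB _ _) _.
    rewrite normrZ gtr0_norm//.
    have : s * `|g| <= r * `|g| by rewrite ler_wpM2r// ltW.
    have : delta * s <= r * delta by rewrite mulrC ler_wpM2r// ltW.
    by move: rr; rewrite !mulrDr mulr1; lra.
  apply/OP; first exact: rU.
  have x00 : `|x0 - x0| < r0 by rewrite subrr normr0.
  have := rE _ _ x00 zr0; rewrite rho0 subr0 -/g.
  have -> : z - s *: g - x0 = (z - x0) - s *: g by rewrite addrAC.
  rewrite dotBr dotZr => /(le_trans (ler_norm _)) H.
  have H1 : dot g (z - x0) <= n%:R * `|g| * (delta * s).
    apply: le_trans (ler_norm _) _; apply: le_trans (dot_norm_le2 _ _) _.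
    by rewrite ler_wpM2l// mulr_ge0.
  have H2 : e * `|z - x0 - s *: g| <= e * (delta * s) + s * (dot g g / 2).
    have -> : e * (delta * s) + s * (dot g g / 2) = e * (delta * s + s * `|g|).
      by rewrite -ege; ring.
    rewrite ler_pM2l//; apply: le_trans (ler_normB _ _) _.
    by rewrite normrZ gtr0_norm// lerD2r.
  have H3 : M * (delta * s) = s * dot g g / 4.
    by rewrite /delta; field; rewrite gt_eqF.
  have H4 : 0 < s * dot g g by rewrite mulr_gt0.
  have H5 : (n%:R * `|g| + e) * (delta * s) <= M * (delta * s).
    apply: ler_wpM2r; first by rewrite mulr_ge0// ltW.
    by rewrite /M lerDl.
  by move: H5; rewrite mulrDl; lra.
Qed.

(* From x0 to y along x0, x0 - s g, y - s g, y with s proportional to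
   |y - x0|: the interior of this path lies in Omega. *)
Lemma boundary_expansion (F : 'rV[R]_n -> R) (h : 'I_n -> 'rV[R]_n -> R) :
  {within closure Omega, continuous F} -> C_open 1 Omega F ->
  (forall i, {within closure Omega, continuous (h i)}) ->
  (forall i y, Omega y -> h i y = partial i F y) ->
  expansion (closure Omega) F x0 (\row_i h i x0).
Proof.
move=> cF CF ch hE e e0; have [r [delta [r0 de0 cone1 cone2]]] := inward_cone.
pose G := \row_i h i x0; have cx0 : closure Omega x0 by case: Bx0.
(* [C] is the ratio of the total length of the path, two pieces of length [s |g|] and one of length
   [|y - x0|], to [|y - x0|], when [s = |y - x0| / delta]. *)
pose C := 2 * `|g| / delta + 1.
have C0 : 0 < C by rewrite ltr_wpDl// divr_ge0 ?(ltW de0)// mulr_ge0.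
pose e' := e / (n.+1%:R * C).
have e'0 : 0 < e' by rewrite divr_gt0// mulr_gt0.
have [d d0 dP] : exists2 d : R, 0 < d & forall y, closure Omega y -> `|y - x0| < d ->
    forall i, `|h i y - h i x0| <= e'.
  have /choice[d dP] : forall i, exists d : R, 0 < d /\ forall y, closure Omega y ->
      `|y - x0| < d -> `|h i y - h i x0| <= e'.
    by move=> i; have [d d0 H] := within_closure_near (ch i) cx0 e'0; exists d.
  exists (\big[Num.min/1]_(i < n) d i) => [|y cy yd i].
    by apply: lt_bigmin => // i _; have [] := dP i.
  have [_] := dP i; apply=> //; apply: lt_le_trans yd _; exact: bigmin_le_cond.
have seg a b : (forall t, 0 <= t <= 1 -> Omega (t *: (b - a) + a)) ->
    `|a - x0| < d -> `|b - x0| < d ->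
    `|F b - F a - dot G (b - a)| <= e / C * `|b - a|.
  move=> Oab ad bd; have [t t01 ->] := C1_MVT oO CF Oab.
  rewrite -dotBl; apply: le_trans (dot_norm_le (c := e') _ _) _.
    move=> i; rewrite !mxE -hE; last exact: Oab.
    by apply: dP; [apply: subset_closure; exact: Oab|exact: segment_norm_lt].
  rewrite ler_wpM2r//.
  have -> : n%:R * e' = e / C * (n%:R / n.+1%:R).
    by rewrite /e' invfM; ring.
  by rewrite ger_pMr ?divr_gt0// ler_pdivrMr// mul1r ler_nat.
pose K := 1 + (1 + `|g|) / delta.
have K1 : 1 <= K by rewrite lerDl divr_ge0 ?addr_ge0 ?(ltW de0).
have K0 : 0 < K by rewrite (lt_le_trans _ K1).
exists (Num.min r d / K); first by rewrite divr_gt0// lt_min r0.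
move=> y cy; rewrite ltr_pdivlMr// lt_min => /andP[yr yd].
have [->|yx0] := eqVneq y x0; first by rewrite !subrr dot0r subr0 !normr0 mulr0.
set L := `|y - x0| in yr yd *; have L0 : 0 < L by rewrite normr_gt0 subr_eq0.
pose s := L / delta; have s0 : 0 < s by rewrite divr_gt0.
have ds : delta * s = L by rewrite /s mulrC divfK// gt_eqF.
have LK : L * K = L + s + s * `|g|.
  by rewrite /K /s; field; rewrite gt_eqF.
have sg : 0 <= s * `|g| by rewrite mulr_ge0// ltW.
have sr : s < r by move: yr; rewrite LK; lra.
have Lr : L < r by move: yr; rewrite LK; lra.
have Lsd : L + s * `|g| < d by move: yd; rewrite LK; lra.
have x0r : `|x0 - x0| < r by rewrite subrr normr0.
have inb z t : `|z - x0| <= L -> 0 <= t -> t <= s -> `|z - t *: g - x0| < d.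
  move=> zL t0 ts; rewrite addrAC; apply: le_lt_trans (ler_normB _ _) _.
  apply: le_lt_trans Lsd; apply: lerD => //.
  by rewrite normrZ ger0_norm// ler_wpM2r.
have vert z t : closure Omega z -> `|z - x0| <= L -> 0 < t -> t <= s ->
    `|F (z - t *: g) - F (z - s *: g) - dot G ((s - t) *: g)| <= e / C * (s * `|g|).
  move=> cz zL t0 ts.
  have E : z - t *: g - (z - s *: g) = (s - t) *: g.
    by apply/rowP => i; rewrite !mxE; ring.
  have := seg (z - s *: g) (z - t *: g); rewrite E => H.
  apply: le_trans (H _ _ _) _.
  - move=> q /andP[q0 q1].
    have -> : q *: ((s - t) *: g) + (z - s *: g) = z - (s - q * (s - t)) *: g.
      by apply/rowP => i; rewrite !mxE; ring.
    have qs : 0 <= q * (s - t) by rewrite mulr_ge0// subr_ge0.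
    have qs' : q * (s - t) <= s - t by rewrite ler_piMl// subr_ge0.
    apply: cone1 => //; first exact: le_lt_trans Lr.
      by lra.
    by lra.
  - by apply: inb => //; exact: ltW.
  - by apply: inb => //; exact: ltW.
  - rewrite ler_wpM2l ?divr_ge0 ?(ltW e0) ?(ltW C0)// normrZ ger0_norm ?subr_ge0//.
    by rewrite ler_wpM2r//; lra.
have hor : `|F (y - s *: g) - F (x0 - s *: g) - dot G (y - x0)| <= e / C * L.
  have E : y - s *: g - (x0 - s *: g) = y - x0.
    by apply/rowP => i; rewrite !mxE; ring.
  have := seg (x0 - s *: g) (y - s *: g); rewrite E; apply.
  - move=> q /andP[q0 q1].
    have -> : q *: (y - x0) + (x0 - s *: g) = (x0 + q *: (y - x0)) - s *: g.
      by apply/rowP => i; rewrite !mxE; ring.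
    apply: cone2 => //; rewrite ds addrAC subrr add0r normrZ ger0_norm//.
    by rewrite ler_piMl.
  - by apply: inb; rewrite ?subrr ?normr0 ?(ltW L0) ?(ltW s0).
  - by apply: inb; rewrite ?(ltW s0).
have CE : e / C * (s * `|g|) + e / C * L + e / C * (s * `|g|) = e * L.
  have C0' : C != 0 by rewrite gt_eqF.
  rewrite /s; transitivity (e / C * ((2 * `|g| / delta + 1) * L)); first by ring.
  by rewrite -/C mulrA divfK.
(* The mean value theorem needs segments inside [Omega], so both ends of the path are displaced by
   [- t *: g]; continuity of [F] on the closure then lets [t] tend to [0]. *)
have main t : 0 < t -> t <= s ->
    `|F (y - t *: g) - F (x0 - t *: g) - dot G (y - x0)| <= e * L.
  move=> t0 ts.
  have v1 := vert y t cy (lexx _) t0 ts.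
  have v2 : `|F (x0 - t *: g) - F (x0 - s *: g) - dot G ((s - t) *: g)| <= e / C * (s * `|g|).
    by apply: vert => //; rewrite subrr normr0 ltW.
  rewrite -CE.
  have -> : F (y - t *: g) - F (x0 - t *: g) - dot G (y - x0) =
    (F (y - t *: g) - F (y - s *: g) - dot G ((s - t) *: g)) +
    (F (y - s *: g) - F (x0 - s *: g) - dot G (y - x0)) -
    (F (x0 - t *: g) - F (x0 - s *: g) - dot G ((s - t) *: g)) by ring.
  apply: le_trans (ler_normB _ _) _; apply: lerD => //.
  by apply: le_trans (ler_normD _ _) _; apply: lerD.
apply/ler_addgt0Pr => eta eta0.
have eta2 : 0 < eta / 2 by rewrite divr_gt0.
have [d1 d10 d1P] := within_closure_near cF cy eta2.
have [d2 d20 d2P] := within_closure_near cF cx0 eta2.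
pose t := Num.min s (Num.min d1 d2 / (2 * `|g|)).
have m0 : 0 < Num.min d1 d2 by rewrite lt_min d10.
have t0 : 0 < t by rewrite lt_min s0 divr_gt0// mulr_gt0.
have ts : t <= s by rewrite ge_min lexx.
have tg : t * `|g| < Num.min d1 d2.
  apply: (@le_lt_trans _ _ (Num.min d1 d2 / 2)); last by lra.
  have : t <= Num.min d1 d2 / (2 * `|g|) by rewrite ge_min lexx orbT.
  by rewrite ler_pdivlMr ?mulr_gt0//; lra.
have tn z : `|z - t *: g - z| < Num.min d1 d2.
  by rewrite addrAC subrr sub0r normrN normrZ gtr0_norm.
have b1 : `|F (y - t *: g) - F y| <= eta / 2.
  apply: d1P; last by have := tn y; rewrite lt_min => /andP[].
  by apply: subset_closure; apply: cone1 => //; exact: le_lt_trans sr.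
have b2 : `|F (x0 - t *: g) - F x0| <= eta / 2.
  apply: d2P; last by have := tn x0; rewrite lt_min => /andP[].
  by apply: subset_closure; apply: cone1 => //; exact: le_lt_trans sr.
exact: norm_diff_perturb b1 b2 (main t t0 ts).
Qed.
End BoundaryPoint.

(** The implicit function theorem is replaced by a search in one variable: for each [t] the
    intermediate value theorem along [g] moves [x0 + t *: xi] to a boundary point. The correction
    [s t] is chosen separately for each [t], with no continuity claimed; the bound [S t], which is
    [o(t)] because [xi] is tangent, already fixes the velocity. *)
Lemma boundary_curve (R : realType) (n : nat) (Omega U : set 'rV[R]_n)
  (rho : 'rV[R]_n -> R) (x0 xi : 'rV[R]_n) :
  boundary Omega x0 -> local_defining 1 Omega x0 U rho ->
  dot (grad rho x0) xi = 0 ->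
  exists gam : R -> 'rV[R]_n, (\forall t \near 0^'+, boundary Omega (gam t)) /\
    t^-1 *: (gam t - x0) @[t --> 0^'+] --> xi.
Proof.
move=> Bx0 Ldef gxi; have g_neq0 := grad_defining_neq0 Ldef.
have [[oU Ux0] CU _ _ BP] := Ldef; set g := grad rho x0 in gxi g_neq0.
have rho0 : rho x0 = 0 by exact/BP.
have gg : 0 < dot g g by exact: dot_gt0.
have gn : 0 < `|g| by rewrite normr_gt0.
pose e := dot g g / (2 * `|g|).
have e0 : 0 < e by rewrite divr_gt0// mulr_gt0.
have ege : e * `|g| = dot g g / 2 by rewrite /e; field; rewrite gt_eqF.
have [r r0 [rU rE]] := C1_strict_expansion oU CU Ux0 e0.
have x0r : `|x0 - x0| < r by rewrite subrr normr0.
(* The error [e] takes at most half of the slope [dot g g], so the factor [2] is enough for [rho] to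
   change sign between [- S t] and [S t]. *)
pose S t := 2 * `|rho (x0 + t *: xi)| / dot g g.
have S_ge0 t : 0 <= S t by rewrite divr_ge0 ?mulr_ge0// ltW.
have tn t : `|x0 + t *: xi - x0| = `|t| * `|xi| by rewrite addrAC subrr add0r normrZ.
have Ssmall e1 t : `|rho (x0 + t *: xi)| <= e1 * (`|t| * `|xi|) ->
    S t * `|g| <= e1 / e * (`|t| * `|xi|).
  move=> H; have -> : S t * `|g| = `|rho (x0 + t *: xi)| / e.
    by rewrite /S /e; field; rewrite !gt_eqF.
  by rewrite ler_pdivrMr// mulrAC mulfVK ?gt_eqF.
have [s sP] : exists s : R -> R, forall t, `|t| * `|xi| < r / 2 ->
    `|s t| <= S t /\ boundary Omega (x0 + t *: xi + s t *: g).
  suff /choice[s sP] : forall t, exists s : R, `|t| * `|xi| < r / 2 ->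
    `|s| <= S t /\ boundary Omega (x0 + t *: xi + s *: g) by exists s.
  move=> t; have [tr|] := boolP (`|t| * `|xi| < r / 2); last by exists 0.
  pose p := x0 + t *: xi.
  have pr : `|p - x0| < r by rewrite tn; lra.
  have rp : `|rho p| <= e * (`|t| * `|xi|).
    have := rE _ _ x0r pr; rewrite rho0 subr0 tn.
    by rewrite addrAC subrr add0r dotZr gxi mulr0 subr0.
  have Sg : S t * `|g| <= `|t| * `|xi|.
    by have := Ssmall e t rp; rewrite divff ?mul1r// gt_eqF.
  have psr s : `|s| <= S t -> `|p + s *: g - x0| < r.
    move=> sS; rewrite addrAC; apply: le_lt_trans (ler_normD _ _) _.
    rewrite tn normrZ.
    have : `|s| * `|g| <= S t * `|g| by rewrite ler_wpM2r.
    by lra.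
  have inc s : `|s| <= S t ->
      `|rho (p + s *: g) - rho p - s * dot g g| <= `|s| * (dot g g / 2).
    move=> sS; have := rE _ _ pr (psr s sS).
    have -> : p + s *: g - p = s *: g by rewrite addrAC subrr add0r.
    by rewrite dotZr normrZ mulrCA ege.
  have SS : `|S t| <= S t by rewrite ger0_norm.
  have NSS : `|- S t| <= S t by rewrite normrN.
  have Sgg : S t * dot g g = 2 * `|rho p| by rewrite /S divfK// gt_eqF.
  have [|||s sI sE] := @IVT _ (fun s => rho (p + s *: g)) (- S t) (S t) 0.
  - by have := S_ge0 t; lra.
  - apply: derivable_within_continuous => s; rewrite in_itv/= => /andP[s1 s2].
    have sS : `|s| <= S t by rewrite ler_norml s1.
    have H : is_derive s 1 (fun s => rho (s *: g + p)) (dot (grad rho (s *: g + p)) g).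
      apply: is_derive_line; apply: (C1_is_derive _ oU CU); apply: rU.
      by rewrite [_ *: _ + p]addrC; exact: psr.
    rewrite (_ : (fun s => _) = (fun s => rho (s *: g + p))); first by case: H.
    by apply/funext => q; rewrite addrC.
  - have := inc _ SS; have := inc _ NSS; rewrite normrN (ger0_norm (S_ge0 t)).
    rewrite !ler_norml mulrA mulNr Sgg => /andP[_ h1] /andP[h2 _].
    have n1 := ler_norm (rho p); have n2 := ler_norm (- rho p); rewrite normrN in n2.
    rewrite ge_min le_max; apply/andP; split; apply/orP; [left|right]; lra.
  - exists s => _; have sS : `|s| <= S t by move: sI; rewrite in_itv/= ler_norml.
    by split=> //; apply/BP => //; apply: rU; exact: psr.
exists (fun t => x0 + t *: xi + s t *: g).
have tsmall d : 0 < d -> \forall t \near (0 : R)^'+, `|t| * `|xi| < d.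
  move=> d0; have d1 : 0 < d / (`|xi| + 1) by rewrite divr_gt0// ltr_wpDl.
  have : \forall t \near (0 : R)^'+, `|t| < d / (`|xi| + 1).
    near=> t; rewrite ger0_norm; first by near: t; exact: nbhs_right_lt.
    by apply: ltW; near: t; exact: nbhs_right_gt.
  apply: filterS => t; rewrite ltr_pdivlMr ?ltr_wpDl// mulrDr mulr1.
  by have := normr_ge0 t; lra.
split.
  apply: filterS (tsmall (r / 2) _) => [t tr|]; last by rewrite divr_gt0.
  by have [] := sP t tr.
apply/cvgrPdist_le => eta eta0.
pose e1 := e * (eta / (`|xi| + 1)).
have xi1 : 0 < `|xi| + 1 by rewrite ltr_wpDl.
have e10 : 0 < e1 by rewrite mulr_gt0// divr_gt0.
have [r1 r10 [_ r1E]] := C1_strict_expansion oU CU Ux0 e10.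
near=> t.
have t0 : 0 < t by near: t; exact: nbhs_right_gt.
have tr : `|t| * `|xi| < r / 2 by near: t; apply: tsmall; rewrite divr_gt0.
have tr1 : `|t| * `|xi| < r1 by near: t; exact: tsmall.
have [sS _] := sP t tr.
have x0r1 : `|x0 - x0| < r1 by rewrite subrr normr0.
have := r1E x0 (x0 + t *: xi) x0r1; rewrite tn => /(_ tr1).
rewrite rho0 subr0 [_ + _ - x0]addrAC subrr add0r dotZr gxi mulr0 subr0.
have e1e : e1 / e = eta / (`|xi| + 1) by rewrite /e1 mulrAC divff ?mul1r// gt_eqF.
move=> /Ssmall; rewrite e1e => H.
have -> : xi - t^-1 *: (x0 + t *: xi + s t *: g - x0) = - (t^-1 * s t) *: g.
  have -> : x0 + t *: xi + s t *: g - x0 = t *: xi + s t *: g.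
    by rewrite addrAC [x0 + _ - x0]addrAC subrr add0r.
  rewrite scalerDr !scalerA mulVf ?gt_eqF// scale1r opprD addrA subrr sub0r.
  by rewrite scaleNr.
rewrite normrZ normrN normrM normfV -mulrA mulrC ler_pdivrMr ?normr_gt0 ?gt_eqF//.
apply: (@le_trans _ _ (S t * `|g|)); first by rewrite ler_wpM2r.
apply: le_trans H _.
have -> : eta / (`|xi| + 1) * (`|t| * `|xi|) = eta * `|t| * (`|xi| / (`|xi| + 1)) by ring.
rewrite ler_piMr ?mulr_ge0 ?(ltW eta0)// ler_pdivrMr// mul1r lerDl//.
Unshelve. all: by end_near. Qed.

(** The open half-space of [a] lies in the closed one of [b]. Testing with [w - d *: a], where [w]
    is the part of [b] orthogonal to [a] and [d] is small, forces [w = 0]. *)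
Lemma tangent_sub (R : realType) (n : nat) (a b : 'rV[R]_n) : a != 0 ->
  (forall v, dot a v < 0 -> dot b v <= 0) -> exists2 c : R, 0 <= c & b = c *: a.
Proof.
move=> a0 H; have aa := dot_gt0 a0.
pose c := dot a b / dot a a; pose w := b - c *: a.
have aw : dot a w = 0 by rewrite /w dotBr dotZr /c mulfVK ?subrr// gt_eqF.
have bE : b = c *: a + w by rewrite /w addrC subrK.
have bw : dot b w = dot w w by rewrite {1}bE dotDl dotZl aw mulr0 add0r.
clearbody w.
have w0 : w = 0.
  apply/eqP; rewrite -dot_eq0 eq_le dot_ge0 andbT; apply/ler_addgt0Pr => e e0.
  pose d := e / (`|dot b a| + 1).
  have d0 : 0 < d by rewrite divr_gt0// ltr_wpDl.
  have := H (w - d *: a); rewrite !dotBr !dotZr aw sub0r oppr_lt0 mulr_gt0// bw.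
  move=> /(_ isT); rewrite subr_le0 add0r => /le_trans; apply.
  apply: le_trans (ler_norm _) _; rewrite normrM gtr0_norm// /d mulrAC.
  by rewrite ler_pdivrMr ?ltr_wpDl// ler_wpM2l ?(ltW e0)// lerDl.
exists c; last by rewrite bE w0 addr0.
rewrite /c divr_ge0 ?(ltW aa)// dotC.
by have := H (- a); rewrite !dotNr oppr_lt0 oppr_le0; apply.
Qed.

(** A direction along which one defining function decreases and the other increases would lead to
    points both inside and outside [Omega]. So [tangent_sub] applies and the gradients are positive
    multiples of each other: the outer normal does not depend on [rho]. *)
Lemma unit_grad_unique (R : realType) (n : nat) (Omega U V : set 'rV[R]_n)
  (rho sig : 'rV[R]_n -> R) (x0 : 'rV[R]_n) : boundary Omega x0 ->
  local_defining 1 Omega x0 U rho -> local_defining 1 Omega x0 V sig ->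
  unit_grad rho x0 = unit_grad sig x0.
Proof.
move=> Bx0 L1 L2; have a0 := grad_defining_neq0 L1; have b0 := grad_defining_neq0 L2.
have [[oU Ux0] CU _ O1 B1] := L1; have [[oV Vx0] CV _ O2 B2] := L2.
have rho0 : rho x0 = 0 by exact/B1.
have sig0 : sig x0 = 0 by exact/B2.
have [c c0 bE] : exists2 c : R, 0 <= c & grad sig x0 = c *: grad rho x0.
  apply: tangent_sub => // v av; rewrite leNgt; apply/negP => bv.
  have vn : 0 < `|v|.
    rewrite normr_gt0; apply/eqP => v0; move: av; rewrite v0 dot0r ltxx//.
  pose m := Num.min (- dot (grad rho x0) v) (dot (grad sig x0) v).
  have m0 : 0 < m by rewrite lt_min oppr_gt0 av.
  pose e := m / (2 * `|v|).
  have e0 : 0 < e by rewrite divr_gt0// mulr_gt0.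
  have [d1 d10 [d1U d1E]] := C1_strict_expansion oU CU Ux0 e0.
  have [d2 d20 [d2V d2E]] := C1_strict_expansion oV CV Vx0 e0.
  pose t := Num.min d1 d2 / (2 * `|v|).
  have d0 : 0 < Num.min d1 d2 by rewrite lt_min d10.
  have t0 : 0 < t by rewrite divr_gt0// mulr_gt0.
  have tv : t * `|v| = Num.min d1 d2 / 2 by rewrite /t; field; rewrite gt_eqF.
  have yx : x0 + t *: v - x0 = t *: v by rewrite addrAC subrr add0r.
  have yn : `|x0 + t *: v - x0| < Num.min d1 d2.
    by rewrite yx normrZ gtr0_norm// tv; lra.
  have etv : e * (t * `|v|) = t * (m / 2) by rewrite /e; field; rewrite gt_eqF.
  move: yn; rewrite lt_min => /andP[y1 y2].
  have xx d : 0 < d -> `|x0 - x0| < d by rewrite subrr normr0.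
  have := d1E _ _ (xx _ d10) y1; have := d2E _ _ (xx _ d20) y2.
  rewrite yx rho0 sig0 !subr0 !dotZr normrZ (gtr0_norm t0) etv.
  rewrite !ler_norml => /andP[h1 _] /andP[_ h2].
  have m1 : t * m <= t * - dot (grad rho x0) v by rewrite ler_pM2l// ge_min lexx.
  have m2 : t * m <= t * dot (grad sig x0) v by rewrite ler_pM2l// ge_min lexx orbT.
  have tm : 0 < t * m by rewrite mulr_gt0.
  have : Omega (x0 + t *: v) by apply/O1; [exact: d1U|lra].
  by move/O2 => /(_ (d2V _ y2)); lra.
have cp : 0 < c.
  rewrite lt_neqAle c0 andbT eq_sym; apply/eqP => c00.
  by move: b0; rewrite bE c00 scale0r eqxx.
have gn := enorm_gt0 a0.
rewrite /unit_grad bE scalerA; congr (_ *: _).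
rewrite /enorm dotZl dotZr mulrA -expr2 sqrtrM ?sqr_ge0// sqrtr_sqr gtr0_norm//.
by rewrite -/(enorm _); field; rewrite !gt_eqF.
Qed.

Lemma local_defining_le (R : realType) (n m m' : nat) (Omega U : set 'rV[R]_n)
  (x : 'rV[R]_n) (rho : 'rV[R]_n -> R) : (m <= m')%N ->
  local_defining m' Omega x U rho -> local_defining m Omega x U rho.
Proof. by move=> mm' [H1 H2 H3 H4 H5]; split=> //; exact: C_open_le H2. Qed.

Lemma cvg_curve_point (R : realType) (n : nat) (F : set_system R) {FF : Filter F}
  (gam : R -> 'rV[R]_n) (x v : 'rV[R]_n) :
  (\forall t \near F, t != 0) -> t @[t --> F] --> (0 : R) ->
  t^-1 *: (gam t - x) @[t --> F] --> v -> gam t @[t --> F] --> x.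
Proof.
move=> F0 Fc gv; rewrite -[X in _ --> X]add0r -[X in X + _](scale0r v).
have : t *: (t^-1 *: (gam t - x)) + x @[t --> F] --> 0 *: v + x.
  by apply: cvgD; [exact: cvgZ|exact: cvg_cst].
apply: cvg_trans; apply: near_eq_cvg; near=> t.
have t0 : t != 0 by near: t.
by rewrite scalerA divff// scale1r subrK.
Unshelve. all: by end_near. Qed.

Section RightFilter.
Context {R : realType}.

Lemma right_neq0 : \forall t \near (0 : R)^'+, t != 0.
Proof. by near=> t; rewrite gt_eqF//; near: t; exact: nbhs_right_gt. Unshelve. all: by end_near. Qed.

Lemma right_cvg0 : t @[t --> (0 : R)^'+] --> (0 : R).
Proof. exact: cvg_within. Qed.
End RightFilter.

(** Relations known only on the boundary, such as the Neumann condition or the equality of [N] with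
    the normal, can be differentiated only along it; [boundary_curve] realises every tangent vector
    as a velocity. *)
Lemma tangential_derivative_eq (R : realType) (n : nat) (Omega U D1 D2 : set 'rV[R]_n)
  (rho f1 f2 : 'rV[R]_n -> R) (x0 g1 g2 xi : 'rV[R]_n) :
  boundary Omega x0 -> local_defining 1 Omega x0 U rho ->
  dot (grad rho x0) xi = 0 ->
  (\forall y \near x0, boundary Omega y -> D1 y /\ D2 y) ->
  expansion D1 f1 x0 g1 -> expansion D2 f2 x0 g2 ->
  (\forall y \near x0, boundary Omega y -> f1 y = f2 y) ->
  dot g1 xi = dot g2 xi.
Proof.
move=> Bx0 L gxi nD E1 E2 f12; have [gam [gB gxi']] := boundary_curve Bx0 L gxi.
have gx0 : gam t @[t --> 0^'+] --> x0.
  exact: cvg_curve_point right_neq0 right_cvg0 gxi'.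
have gD : \forall t \near 0^'+, D1 (gam t) /\ D2 (gam t).
  have := gx0 _ nD; rewrite /= => nD'.
  by near=> t; near: t; apply: filterS2 gB nD' => t /[swap]; exact.
have c1 : t^-1 * (f1 (gam t) - f1 x0) @[t --> 0^'+] --> dot g1 xi.
  apply: (expansion_curve right_neq0 right_cvg0 E1 _ gxi').
  by apply: filterS gD => t [].
have c2 : t^-1 * (f2 (gam t) - f2 x0) @[t --> 0^'+] --> dot g2 xi.
  apply: (expansion_curve right_neq0 right_cvg0 E2 _ gxi').
  by apply: filterS gD => t [].
have f12' := gx0 _ f12; have f0 := nbhs_singleton f12 Bx0.
have c3 : t^-1 * (f1 (gam t) - f1 x0) @[t --> 0^'+] --> dot g2 xi.
  apply: cvg_trans c2; apply: near_eq_cvg.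
  by apply: filterS2 gB f12' => t gt /(_ gt) ->; rewrite f0.
exact: (cvg_unique _ c1 c3).
Unshelve. all: by end_near. Qed.

Section UnitNormal.
Context {R : realType} {n : nat} (U : set 'rV[R]_n) (rho : 'rV[R]_n -> R).
Hypothesis oU : open U.
Hypothesis g0 : forall y, U y -> grad rho y != 0.

Let Q y := dot (grad rho y) (grad rho y).

Lemma C_open_gradsq m : C_open m.+1 U rho -> C_open m U Q.
Proof.
move=> /C_open_rec[_ _ pr]; apply: C_open_sum => // i.
by apply: C_open_ext (C_openM oU (pr i) (pr i)) => // y _; rewrite !mxE.
Qed.

Lemma C_open_inv_enorm m : C_open m.+1 U rho ->
  C_open m U (fun y => (enorm (grad rho y))^-1).
Proof.
move=> Cr; apply: C_open_invsqrt => //; last exact: C_open_gradsq.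
by move=> y Uy; apply: dot_gt0; exact: g0.
Qed.

Lemma C_open_unit_grad m i : C_open m.+1 U rho ->
  C_open m U (fun y => unit_grad rho y 0 i).
Proof.
move=> Cr; have Ci := C_open_inv_enorm Cr; have /C_open_rec[_ _ pr] := Cr.
by apply: C_open_ext (C_openM oU Ci (pr i)) => // y _; rewrite !mxE.
Qed.
End UnitNormal.

(** The unit gradient loses one derivative, so a C^3 boundary gives a C^2 normal; [unit_grad_unique]
    makes the local fields agree with [nu], which is what the gluing requires. *)
Lemma normal_field_extension (R : realType) (n : nat) (Omega : set 'rV[R]_n)
  (nu : 'rV[R]_n -> 'rV[R]_n) : C_domain 3 Omega ->
  (forall x, boundary Omega x -> outer_unit_normal Omega x (nu x)) ->
  exists N : 'I_n -> 'rV[R]_n -> R, (forall i, C_open 2 setT (N i)) /\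
    forall i x, boundary Omega x -> N i x = nu x 0 i.
Proof.
move=> [[_ oO _ bO] LD] hnu.
suff /choice[N NP] : forall i, exists Ni : 'rV[R]_n -> R, C_open 2 setT Ni /\
    forall x, boundary Omega x -> Ni x = nu x 0 i.
  by exists N; split=> [i|i x Bx]; have [H1 H2] := NP i; [exact: H1|exact: H2].
move=> i; apply: (C2_boundary_extension (phi := fun x => nu x 0 i) bO) => x Bx.
have [U [rho L]] := LD x Bx; have [[oU Ux] CU g0 OP BP] := L.
exists U, (fun y => unit_grad rho y 0 i); split=> //.
  exact: C_open_unit_grad.
move=> y By Uy; have [V [sig [L' ->]]] := hnu y By.
have Ly : local_defining 1 Omega y U rho.
  by split=> //; exact: C_open_le CU.
by rewrite (unit_grad_unique By Ly L').
Qed.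

Lemma quadratic_ge0_linear (R : realFieldType) (b c : R) :
  (forall t, 0 <= 2 * t * b + t ^+ 2 * c) -> b = 0.
Proof.
move=> H; apply/eqP; rewrite -normr_le0 leNgt; apply/negP => b0.
have d0 : 0 < `|c| + 1 by rewrite ltr_wpDl.
have bb : 0 < b ^+ 2 by rewrite exprn_even_gt0//= -normr_gt0.
have := H (- b / (`|c| + 1)).
have -> : 2 * (- b / (`|c| + 1)) * b + (- b / (`|c| + 1)) ^+ 2 * c =
    (b ^+ 2 / (`|c| + 1)) * (c / (`|c| + 1) - 2).
  by field; rewrite gt_eqF.
rewrite pmulr_rge0 ?divr_gt0// subr_ge0 ler_pdivlMr//.
by have := ler_norm c; have := normr_ge0 c; lra.
Qed.

Lemma gradE (R : realType) (n : nat) (f : 'rV[R]_n -> R) (x : 'rV[R]_n) (i : 'I_n) :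
  grad f x 0 i = partial i f x.
Proof. by rewrite mxE. Qed.

(** * Principal curvatures and the second fundamental form *)

Section Curvature.
Context {R : realType} {n : nat} (Omega U : set 'rV[R]_n) (rho : 'rV[R]_n -> R).
Context (x0 : 'rV[R]_n) (kappa0 : R).
Hypothesis L2 : local_defining 2 Omega x0 U rho.
Hypothesis kappa0P : forall kappa, principal_curvature Omega x0 kappa -> kappa0 <= kappa.

Let g := grad rho x0.
Let ug i (y : 'rV[R]_n) := unit_grad rho y 0 i.
Let m i tau := dot (grad (ug i) x0) tau.
Let q := (enorm g)^-1.
Let B (eta tau : 'rV[R]_n) := \sum_i eta 0 i * dot (grad (partial i rho) x0) tau.

Let oU : open U. Proof. by have [[]] := L2. Qed.
Let Ux0 : U x0. Proof. by have [[]] := L2. Qed.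
Let CU : C_open 2 U rho. Proof. by have [_ ] := L2. Qed.
Let g0U : forall y, U y -> grad rho y != 0. Proof. by have [_ _] := L2. Qed.
Let g0 : g != 0. Proof. exact: g0U. Qed.
Let q0 : 0 < q. Proof. by rewrite invr_gt0 enorm_gt0. Qed.

Let is_derive_ug i tau : is_derive x0 tau (ug i) (m i tau).
Proof.
by apply: (C1_is_derive _ oU) => //; exact: C_open_unit_grad.
Qed.

Let unit_normal_derivative tau : \sum_i ug i x0 * m i tau = 0.
Proof.
have H : is_derive x0 tau (\sum_i (ug i * ug i)) (\sum_i (ug i x0 *: m i tau + ug i x0 *: m i tau)).
  apply: is_derive_sum => i.
  have := is_derive_ug i tau => ?; exact: is_deriveM.
have E : {near x0, (\sum_i (ug i * ug i)) =1 cst 1}.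
  apply: filterS (open_nbhs_nbhs (conj oU Ux0)) => y Uy.
  rewrite fct_sumE /= -(enorm_unit (g0U Uy)).
  by apply: eq_bigr => i _.
have := derive_val (is_derive := H); rewrite (near_eq_derive _ E) derive_cst.
move/esym; rewrite big_split/= => /eqP; rewrite -mulr2n mulrn_eq0/= => /eqP.
exact: id.
Qed.

(** In the derivative of [q * grad rho], the term from the scalar factor is a multiple of [g] and
    vanishes against a tangent [eta]. What remains is the Hessian of [rho], which is symmetric. *)
Let tangential_form eta tau : dot g eta = 0 -> \sum_i eta 0 i * m i tau = q * B eta tau.
Proof.
move=> ge; pose qf y := (enorm (grad rho y))^-1.
have Cq : C_open 1 U qf by exact: C_open_inv_enorm.
have dq : is_derive x0 tau qf (dot (grad qf x0) tau) by exact: C1_is_derive oU Cq Ux0.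
have mE i : m i tau = q * dot (grad (partial i rho) x0) tau +
    partial i rho x0 * dot (grad qf x0) tau.
  have /C_open_rec[_ _ pr] := CU.
  have dp : is_derive x0 tau (partial i rho) (dot (grad (partial i rho) x0) tau).
    exact: C1_is_derive oU (pr i) Ux0.
  have H : is_derive x0 tau (qf * partial i rho)
      (qf x0 *: dot (grad (partial i rho) x0) tau + partial i rho x0 *: dot (grad qf x0) tau).
    exact: is_deriveM.
  have H' := is_derive_ug i tau.
  rewrite -[LHS](derive_val (is_derive := H')) -[RHS](derive_val (is_derive := H)).
  congr ('D_tau _ x0); apply/funext => y.
  by rewrite /ug /unit_grad !mxE.
under eq_bigr do rewrite mE mulrDr.
rewrite big_split/= [X in _ + X](_ : _ = 0) ?addr0.
  by rewrite /B mulr_sumr; apply: eq_bigr => i _; rewrite mulrCA.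
under eq_bigr do rewrite mulrA.
have -> : \sum_i eta 0 i * partial i rho x0 * dot (grad qf x0) tau =
    dot g eta * dot (grad qf x0) tau.
  by rewrite mulr_suml; apply: eq_bigr => i _; rewrite mxE [eta 0 i * _]mulrC.
by rewrite ge mul0r.
Qed.

Let B_sym eta tau : B eta tau = B tau eta.
Proof.
rewrite /B /dot; under eq_bigr do rewrite mulr_sumr.
under [RHS]eq_bigr do rewrite mulr_sumr.
rewrite exchange_big/=; apply: eq_bigr => i _; apply: eq_bigr => j _.
have E : grad (partial j rho) x0 0 i = grad (partial i rho) x0 0 j.
  refine (etrans (gradE _ _ _) (etrans _ (esym (gradE _ _ _)))).
  exact: (@partial_commute R n U rho i j x0 oU CU Ux0).
have AC (a z b : R) : a * (z * b) = b * (z * a) by ring.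
exact: (etrans (congr1 (fun z => eta 0 j * (z * tau 0 i)) E) (AC _ _ _)).
Qed.

Let B_Dr eta a b : B eta (a + b) = B eta a + B eta b.
Proof. by rewrite /B -big_split/=; apply: eq_bigr => i _; rewrite dotDr mulrDr. Qed.

Let B_Zr (t : R) eta a : B eta (t *: a) = t * B eta a.
Proof. by rewrite /B mulr_sumr; apply: eq_bigr => i _; rewrite dotZr mulrCA. Qed.

Let B_Dl eta a b : B (a + b) eta = B a eta + B b eta.
Proof. by rewrite !(B_sym _ eta) B_Dr. Qed.

Let B_Zl (t : R) eta a : B (t *: a) eta = t * B a eta.
Proof. by rewrite !(B_sym _ eta) B_Zr. Qed.

(** The lowest principal direction is obtained variationally, by minimising the form on the compact
    unit sphere of the tangent space; the assumed tangent vector makes that sphere nonempty. *)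
Let min_tangent : (exists2 xi : 'rV[R]_n, xi != 0 & dot g xi = 0) ->
  exists tau, [/\ dot g tau = 0, dot tau tau = 1 &
    forall eta, dot g eta = 0 -> B tau tau * dot eta eta <= B eta eta].
Proof.
move=> [xi xi0 gxi].
pose K := [set tau : 'rV[R]_n | dot g tau = 0 /\ dot tau tau = 1].
have cdd : continuous (fun tau : 'rV[R]_n => dot tau tau).
  move=> x; apply: (@cvg_sumr _ _ (nbhs x) (nbhs_filter x)) => i.
  by apply: cvgM; exact: coord_continuous.
have cK : compact K.
  apply: bounded_closed_compact.
    exists 1; split; first exact: real1.
    move=> t t1 tau [_ tt] /=; apply: le_trans (norm_le_enorm _) _.
    by rewrite /enorm tt sqrtr1 ltW.
  apply: (@closedI _ [set tau | dot g tau = 0] [set tau | dot tau tau = 1]).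
    apply: (closed_comp (f := dot g) (D := [set 0 : R])); last exact: closed_eq.
    by move=> y _; exact: dot_continuous.
  apply: (closed_comp (f := fun tau : 'rV[R]_n => dot tau tau) (D := [set 1 : R])).
    by move=> y _; exact: cdd.
  exact: closed_eq.
have unit_eta eta : eta != 0 -> dot g eta = 0 -> K ((enorm eta)^-1 *: eta).
  by move=> e0 ge; split; [rewrite dotZr ge mulr0|exact: enorm_unit].
have K0 : K !=set0 by exists ((enorm xi)^-1 *: xi); exact: unit_eta.
have cB : continuous (fun tau => B tau tau).
  move=> x; apply: (@cvg_sumr _ _ (nbhs x) (nbhs_filter x)) => i.
  by apply: cvgM; [exact: coord_continuous|exact: dot_continuous].
have [tau + tauP] := EVT_min_rV K0 cK (continuous_subspaceT cB).
rewrite inE => -[gt tt]; exists tau; split=> // eta ge.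
have [->|e0] := eqVneq eta 0.
  by rewrite dot0r mulr0 /B big1// => i _; rewrite mxE mul0r.
have := tauP ((enorm eta)^-1 *: eta); rewrite inE => /(_ (unit_eta _ e0 ge)).
rewrite B_Zl B_Zr mulrA -invfM -expr2 enormE ler_pdivlMl ?dot_gt0//.
by rewrite mulrC.
Qed.

(** [principal_curvature] speaks only of eigenvectors of the shape operator. The minimiser [tau] is
    a critical point, hence such an eigenvector, and its eigenvalue [q * c] is the minimum of the
    form on unit tangent vectors, so the bound [kappa0] passes to all of them. *)
Lemma curvature_form xi : dot g xi = 0 ->
  kappa0 * dot xi xi <= \sum_i xi 0 i * dot (grad (ug i) x0) xi.
Proof.
move=> gxi; have [->|xi0] := eqVneq xi 0.
  by rewrite dot0r mulr0 big1// => i _; rewrite mxE mul0r.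
have [tau [gt tt tauP]] : exists tau, [/\ dot g tau = 0, dot tau tau = 1 &
    forall eta, dot g eta = 0 -> B tau tau * dot eta eta <= B eta eta].
  by apply: min_tangent; exists xi.
set c := B tau tau in tauP.
have crit eta : dot g eta = 0 -> B eta tau = c * dot eta tau.
  move=> ge; apply/eqP; rewrite -subr_eq0; apply/eqP.
  apply: (@quadratic_ge0_linear _ _ (B eta eta - c * dot eta eta)) => t.
  have := tauP (tau + t *: eta); rewrite dotDr dotZr gt ge mulr0 addr0 => /(_ erefl).
  rewrite !B_Dr !B_Dl !B_Zr !B_Zl !dotDr !dotDl !dotZr !dotZl tt -/c.
  rewrite (B_sym tau eta) (dotC tau eta).
  rewrite -subr_ge0; congr (0 <= _); ring.
have kE : 'D_tau (unit_grad rho) x0 = (q * c) *: tau.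
  have dU : derivable (unit_grad rho) x0 tau.
    apply/derivable_mxP => i j; rewrite ord1.
    by have [] := is_derive_ug j tau.
  rewrite derive_mx//; set w0 := \matrix_(_, _) _.
  have w0E i : w0 0 i = m i tau.
    by rewrite mxE; have [_] := is_derive_ug i tau.
  clearbody w0; pose w := w0 - (q * c) *: tau.
  (* The derivative of the unit normal is tangent, so the defect [w] of the eigenvector equation is
     tangent too and [crit] can be applied to [w] itself. *)
  have gw : dot g w = 0.
    rewrite /w dotBr dotZr gt mulr0 subr0.
    apply: (mulfI (lt0r_neq0 q0)); rewrite mulr0 -[RHS](unit_normal_derivative tau).
    rewrite /dot mulr_sumr; apply: eq_bigr => i _.
    by rewrite w0E mulrA /ug /unit_grad !mxE.
  have ww : dot w w = 0.
    rewrite {2}/w dotBr dotZr.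
    have -> : dot w w0 = \sum_i w 0 i * m i tau by apply: eq_bigr => i _; rewrite w0E.
    by rewrite tangential_form// crit// mulrA subrr.
  by apply/eqP; rewrite -subr_eq0 -/w -dot_eq0 ww.
have pc : principal_curvature Omega x0 (q * c).
  exists U, rho, tau; split=> //; last by rewrite dotC.
  by apply/eqP => t0; move: tt => /eqP; rewrite t0 dot0r eq_sym oner_eq0.
rewrite -/(m _ _) (eq_bigr (fun i => xi 0 i * m i xi))// tangential_form//.
apply: (@le_trans _ _ (q * c * dot xi xi)).
  by rewrite ler_wpM2r ?dot_ge0// kappa0P.
by rewrite -mulrA ler_pM2l// tauP.
Qed.
End Curvature.

(** * The maximum principle *)

Definition hessq (R : realType) (n : nat) (f : 'rV[R]_n -> R) (x v : 'rV[R]_n) : R :=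
  \sum_i v 0 i * dot (grad (partial i f) x) v.

(** It records two derivatives of [f] in the fixed direction [v]: the first as a function on
    [Omega], so that it can be differentiated again, and the second at [x] only. The rules below
    assemble those of the test function term by term. *)
Definition jet (R : realType) (n : nat) (Omega : set 'rV[R]_n) (x v : 'rV[R]_n)
  (f f1 : 'rV[R]_n -> R) (f2 : R) : Prop :=
  (forall y, Omega y -> is_derive y v f (f1 y)) /\ is_derive x v f1 f2.

Section Jet.
Context {R : realType} {n : nat} (Omega : set 'rV[R]_n) (x v : 'rV[R]_n).
Hypothesis oO : open Omega.
Hypothesis Ox : Omega x.

Lemma C2_jet (f : 'rV[R]_n -> R) : C_open 2 Omega f ->
  jet Omega x v f (fun y => dot (grad f y) v) (hessq f x v).
Proof.
move=> Cf; have /C_open_rec[_ _ pf] := Cf; split=> [y Oy|].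
  by apply: C1_is_derive oO _ Oy; exact: C_open_le Cf.
have H : is_derive x v (\sum_i (fun y => v 0 i * partial i f y)) (hessq f x v).
  apply: is_derive_sum => i.
  by have := is_deriveZ (v 0 i) (C1_is_derive v oO (pf i) Ox).
rewrite [X in is_derive _ _ X _](_ : _ = \sum_i (fun y => v 0 i * partial i f y))//.
apply/funext => y; rewrite fct_sumE; apply: eq_bigr => i _.
by rewrite gradE mulrC.
Qed.

Lemma jetD (f f1 g g1 : 'rV[R]_n -> R) (f2 g2 : R) : jet Omega x v f f1 f2 -> jet Omega x v g g1 g2 ->
  jet Omega x v (fun y => f y + g y) (fun y => f1 y + g1 y) (f2 + g2).
Proof.
move=> [Df Df1] [Dg Dg1]; split=> [y Oy|]; last exact: is_deriveD.
have := Df y Oy; have := Dg y Oy => ? ?; exact: is_deriveD.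
Qed.

Lemma jetM (f f1 g g1 : 'rV[R]_n -> R) (f2 g2 : R) : jet Omega x v f f1 f2 -> jet Omega x v g g1 g2 ->
  jet Omega x v (fun y => f y * g y) (fun y => f y * g1 y + g y * f1 y)
    (f x * g2 + 2 * (f1 x * g1 x) + g x * f2).
Proof.
move=> [Df Df1] [Dg Dg1]; split=> [y Oy|].
  by have := Df y Oy; have := Dg y Oy => ? ?; exact: is_deriveM.
have := Df x Ox; have := Dg x Ox => ? ?.
have H1 : is_derive x v (f * g1) (f x *: g2 + g1 x *: f1 x) by exact: is_deriveM.
have H2 : is_derive x v (g * f1) (g x *: f2 + f1 x *: g1 x) by exact: is_deriveM.
have H : is_derive x v (f * g1 + g * f1)
   ((f x *: g2 + g1 x *: f1 x) + (g x *: f2 + f1 x *: g1 x)) by exact: is_deriveD.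
apply: (is_derive_eq H); rewrite /GRing.scale/=.
by move: (f x) (g x) (f1 x) (g1 x) => a b c d; ring.
Qed.

Lemma jetZ (a : R) (f f1 : 'rV[R]_n -> R) (f2 : R) : jet Omega x v f f1 f2 ->
  jet Omega x v (fun y => a * f y) (fun y => a * f1 y) (a * f2).
Proof.
move=> [Df Df1]; split=> [y Oy|]; last exact: is_deriveZ.
have := Df y Oy => ?; exact: is_deriveZ.
Qed.

Lemma jet_sum (I : Type) (r : seq I) (f f1 : I -> 'rV[R]_n -> R) (f2 : I -> R) :
  (forall i, jet Omega x v (f i) (f1 i) (f2 i)) ->
  jet Omega x v (fun y => \sum_(i <- r) f i y) (fun y => \sum_(i <- r) f1 i y)
    (\sum_(i <- r) f2 i).
Proof.
move=> H; elim: r => [|i r IHr].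
  under eq_fun do rewrite big_nil; under [X in jet _ _ _ _ X _]eq_fun do rewrite big_nil.
  by rewrite big_nil; split=> [y _|]; exact: is_derive_cst.
under eq_fun do rewrite big_cons; under [X in jet _ _ _ _ X _]eq_fun do rewrite big_cons.
by rewrite big_cons; exact: jetD.
Qed.

Lemma jet_sqnorm : jet Omega x v (fun y : 'rV[R]_n => dot y y)
  (fun y => \sum_i (2 * (y 0 i * v 0 i))) (2 * dot v v).
Proof.
have H i : jet Omega x v (fun y : 'rV[R]_n => y 0 i * y 0 i)
    (fun y => 2 * (y 0 i * v 0 i)) (2 * (v 0 i * v 0 i)).
  have C : jet Omega x v (fun y : 'rV[R]_n => y 0 i) (fun=> v 0 i) 0.
    by split=> [y _|]; [exact: is_derive_coord|exact: is_derive_cst].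
  have [J1 J2] := jetM C C; split=> [y Oy|].
    by apply: (is_derive_eq (J1 y Oy)); ring.
  have -> : (fun y : 'rV[R]_n => 2 * (y 0 i * v 0 i)) =
      (fun y => y 0 i * v 0 i + y 0 i * v 0 i).
    by apply/funext => y; ring.
  by apply: (is_derive_eq J2); ring.
by rewrite /dot mulr_sumr; exact: jet_sum.
Qed.

(** The derivative along the line vanishes at the maximum. If [f2 > 0], it is positive just after
    it, and the mean value theorem produces a larger value of [f]. *)
Lemma jet_max (f f1 : 'rV[R]_n -> R) (f2 : R) : jet Omega x v f f1 f2 ->
  (forall y, Omega y -> f y <= f x) -> f2 <= 0.
Proof.
move=> [Df Df1] fmax.
have [d d0 dO] : exists2 d : R, 0 < d & forall t, `|t| < d -> Omega (t *: v + x).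
  have [r r0 rO] := open_ball_sub oO Ox.
  exists (r / (`|v| + 1)) => [|t]; first by rewrite divr_gt0// ltr_wpDl.
  rewrite ltr_pdivlMr ?ltr_wpDl// mulrDr mulr1 => tr; apply: rO.
  by rewrite addrK normrZ; have := normr_ge0 t; lra.
pose w t := f (t *: v + x); pose w1 t := f1 (t *: v + x).
have dw (t : R) : `|t| < d -> is_derive t 1 w (w1 t).
  by move=> td; apply: is_derive_line; exact/Df/dO.
have dw1 : is_derive (0 : R) 1 w1 f2.
  by apply: is_derive_line; rewrite scale0r add0r.
have w10 : w1 0 = 0.
  have dd : - d <= d by lra.
  have in0 : 0 \in `](- d), d[ by rewrite in_itv/= oppr_lt0 d0.
  have D0 : is_derive (0 : R) 1 w 0.
    apply: (@derive1_at_max _ w (- d) d) => //.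
      by move=> t; rewrite in_itv/= -ltr_norml => /dw[].
    move=> t; rewrite in_itv/= -ltr_norml => td; rewrite {2}/w scale0r add0r.
    exact/fmax/dO.
  have n0 : `|0 : R| < d by rewrite normr0.
  by have [_ <-] := dw 0 n0; have [_ ->] := D0.
rewrite leNgt; apply/negP => f20.
have /cvg_ex[l wl] : derivable w1 0 1 by have [] := dw1.
have lE : l = f2 by have [_ <-] := dw1; apply/esym/cvg_lim.
move: wl; rewrite lE => /cvgrPdist_lt/(_ _ f20)/nbhs_ballP[r /= r0 rP].
pose T := Num.min d r / 2.
have m0 : 0 < Num.min d r by rewrite lt_min d0.
have T0 : 0 < T by rewrite divr_gt0.
have Td : T < d.
  by apply: (@lt_le_trans _ _ (Num.min d r)); [rewrite /T; lra|rewrite ge_min lexx].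
have Tr : T < r.
  by apply: (@lt_le_trans _ _ (Num.min d r)); [rewrite /T; lra|rewrite ge_min lexx orbT].
have nT c : 0 <= c -> c <= T -> `|c| < d by move=> c0 cT; rewrite ger0_norm//; lra.
have [||c cT wE] := @MVT _ w w1 0 T T0.
- by move=> c; rewrite in_itv/= => /andP[c0 cT]; apply: dw; apply: nT; exact: ltW.
- apply: derivable_within_continuous => c; rewrite in_itv/= => /andP[c0 cT].
  by have [] := dw c (nT c c0 cT).
move: cT; rewrite in_itv/= => /andP[c0 cT].
have wle : w T <= w 0.
  by rewrite /w scale0r add0r; apply/fmax/dO; rewrite gtr0_norm.
have : 0 < w1 c.
  have bc : ball 0 r c by rewrite -ball_normE/= sub0r normrN gtr0_norm//; lra.
  have := rP c bc (lt0r_neq0 c0); rewrite w10 subr0 /= addr0 [c *: 1]mulr1.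
  move=> H; have : 0 < c^-1 * w1 c.
    by move: H; rewrite ltr_norml => /andP[_]; rewrite /GRing.scale/=; lra.
  by rewrite pmulr_rgt0// invr_gt0.
have : w1 c * (T - 0) <= 0 by rewrite -wE; lra.
by rewrite subr0 pmulr_lle0//; lra.
Qed.
End Jet.

Section Hessian.
Context {R : realType} {n : nat} (Omega : set 'rV[R]_n) (u : 'rV[R]_n -> R).
Hypothesis oO : open Omega.

Lemma hessianE y i j : hessian u y i j = partial i (partial j u) y.
Proof. by rewrite mxE. Qed.

Lemma hessian_form (y v : 'rV[R]_n) : (v *m hessian u y *m v^T) 0 0 = hessq u y v.
Proof.
rewrite mxE; apply: eq_bigr => j _; rewrite [v^T _ _]mxE mulrC; congr (_ * _).
by rewrite mxE; apply: eq_bigr => i _; rewrite mxE gradE mulrC.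
Qed.

Lemma hessian_sym (y : 'rV[R]_n) : C_open 2 Omega u -> Omega y -> (hessian u y)^T = hessian u y.
Proof.
move=> Cu Oy; apply/matrixP => i j.
have tE : (hessian u y)^T i j = hessian u y j i by rewrite mxE.
refine (etrans tE (etrans (hessianE _ _ _) (etrans _ (esym (hessianE _ _ _))))).
exact: (@partial_commute R n Omega u j i y oO Cu Oy).
Qed.

(** The left side is how the Hessian changes along [xi]; the right side is the Hessian of the
    derivative of [u] along [xi], which the maximality of the test function controls. They agree
    because third derivatives commute. *)
Lemma third_form (x v xi : 'rV[R]_n) : C_open 3 Omega u -> Omega x ->
  \sum_i \sum_j v 0 i * v 0 j * dot (grad (partial j (partial i u)) x) xi =
  \sum_m xi 0 m * hessq (partial m u) x v.
Proof.
move=> Cu Ox; have Cu2 : C_open 2 Omega u by exact: C_open_le Cu.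
have /C_open_rec[_ _ pu] := Cu.
have comm3 i j m : partial m (partial j (partial i u)) x =
    partial j (partial i (partial m u)) x.
  refine (etrans (@partial_commute R n Omega (partial i u) m j x oO (pu i) Ox) _).
  exact: (@partial_ext R n Omega (partial m (partial i u)) (partial i (partial m u)) j x
    oO (fun y Oy => @partial_commute R n Omega u m i y oO Cu2 Oy) Ox).
pose t3 i j m := partial j (partial i (partial m u)) x.
have L i j : dot (grad (partial j (partial i u)) x) xi = \sum_m t3 i j m * xi 0 m.
  apply: eq_bigr => m _.
  by refine (congr1 (fun z => z * xi 0 m) (etrans (gradE _ _ _) (comm3 i j m))).
have Rr m : hessq (partial m u) x v = \sum_i \sum_j v 0 i * (t3 i j m * v 0 j).
  apply: eq_bigr => i _; rewrite /dot mulr_sumr; apply: eq_bigr => j _.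
  by refine (congr1 (fun z => v 0 i * (z * v 0 j)) (gradE _ _ _)).
under eq_bigr do under eq_bigr do rewrite L mulr_sumr.
under [RHS]eq_bigr do rewrite Rr mulr_sumr.
under [RHS]eq_bigr do under eq_bigr do rewrite mulr_sumr.
rewrite [RHS]exchange_big/=; apply: eq_bigr => i _.
rewrite [RHS]exchange_big/=; apply: eq_bigr => j _.
apply: eq_bigr => m _; move: (t3 i j m) => z; ring.
Qed.

Lemma coord_le_enorm (v : 'rV[R]_n) i : `|v 0 i| <= enorm v.
Proof. exact: le_trans (norm_coord_le v i) (norm_le_enorm v). Qed.

(** One [d] serves all [v]. Each of the [n^2] entries is expanded with error [1 / (n + 1)^2], so the
    total error is at most [t * dot v v]; it is the [1] subtracted in [2 * K - C1 - 1] further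
    on. *)
Lemma hessq_expansion (x xi : 'rV[R]_n) : C_open 3 Omega u -> Omega x -> `|xi| <= 1 ->
  exists2 d : R, 0 < d & forall t, 0 < t -> t < d -> Omega (x + t *: xi) /\
    forall v, hessq u (x + t *: xi) v <=
      hessq u x v + t * (\sum_m xi 0 m * hessq (partial m u) x v) + t * dot v v.
Proof.
move=> Cu Ox xi1; have /C_open_rec[_ _ pu] := Cu.
have Cij i j : C_open 1 Omega (partial j (partial i u)).
  by have /C_open_rec[_ _ ] := pu i; apply.
pose e : R := (n.+1%:R ^+ 2)^-1.
have e0 : 0 < e by rewrite invr_gt0 exprn_gt0.
have [d0 d00 dO] := open_ball_sub oO Ox.
have /choice[d dP] : forall ij : 'I_n * 'I_n, exists d : R, 0 < d /\
    forall y, Omega y -> `|y - x| < d ->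
      `|partial ij.2 (partial ij.1 u) y - partial ij.2 (partial ij.1 u) x -
        dot (grad (partial ij.2 (partial ij.1 u)) x) (y - x)| <= e * `|y - x|.
  move=> [i j]; have [d dp dE] := C1_expansion oO (Cij i j) Ox e0.
  by exists d.
pose dm := \big[Num.min/d0]_(ij : 'I_n * 'I_n) d ij.
have dm0 : 0 < dm by apply: lt_bigmin => // ij _; have [] := dP ij.
exists dm => // t t0 td.
have tx : x + t *: xi - x = t *: xi by rewrite addrAC subrr add0r.
have tn : `|t *: xi| <= t by rewrite normrZ gtr0_norm// ler_piMr// ltW.
have tnd : `|x + t *: xi - x| < dm by rewrite tx (le_lt_trans tn).
have Oy : Omega (x + t *: xi).
  by apply: dO; apply: (lt_le_trans tnd); exact: bigmin_le_id.
split=> // v.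
have E i j : v 0 i * v 0 j * partial j (partial i u) (x + t *: xi) <=
    v 0 i * v 0 j * partial j (partial i u) x +
    t * (v 0 i * v 0 j * dot (grad (partial j (partial i u)) x) xi) +
    t * (e * dot v v).
  have [_ H] := dP (i, j); have := H _ Oy _; rewrite /= tx dotZr.
  have -> : `|t *: xi| < d (i, j).
    rewrite -tx; apply: (lt_le_trans tnd); exact: bigmin_le_cond.
  move: (partial j (partial i u) (x + t *: xi)) (partial j (partial i u) x)
    (dot (grad (partial j (partial i u)) x) xi) => F F0 D /(_ isT) FE.
  have vv : `|v 0 i * v 0 j| <= dot v v.
    by rewrite -enormE expr2 normrM ler_pM// coord_le_enorm.
  have : v 0 i * v 0 j * (F - F0 - t * D) <= dot v v * (e * t).
    apply: le_trans (ler_norm _) _; rewrite normrM; apply: ler_pM => //.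
    by apply: le_trans FE _; rewrite ler_pM2l.
  nra.
have hE y : hessq u y v = \sum_i \sum_j v 0 i * v 0 j * partial j (partial i u) y.
  apply: eq_bigr => i _; rewrite /dot mulr_sumr; apply: eq_bigr => j _.
  refine (etrans (congr1 (fun z => v 0 i * (z * v 0 j)) (gradE _ _ _)) _).
  by move: (partial _ _ _) => z; ring.
rewrite hE hE -third_form//.
apply: (@le_trans _ _ (\sum_i \sum_j (v 0 i * v 0 j * partial j (partial i u) x +
    t * (v 0 i * v 0 j * dot (grad (partial j (partial i u)) x) xi) +
    t * (e * dot v v)))).
  by apply: ler_sum => i _; apply: ler_sum => j _; exact: E.
under eq_bigr do rewrite !big_split/= -mulr_sumr sumr_const card_ord.
rewrite !big_split/= -mulr_sumr sumr_const card_ord lerD2l.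
rewrite -mulrnA -mulr_natl natrM.
have -> : n%:R * n%:R * (t * (e * dot v v)) = (n%:R * n%:R * e) * (t * dot v v) by ring.
rewrite ler_piMl ?mulr_ge0 ?dot_ge0 ?(ltW t0)//.
rewrite /e ler_pdivrMr ?exprn_gt0// mul1r expr2 ler_pM// ler_nat//.
Qed.
End Hessian.

Lemma dot_enorm_le (R : realType) (n : nat) (w v : 'rV[R]_n) (c : R) : 0 <= c ->
  (forall i, `|w 0 i| <= c) -> `|dot w v| <= n%:R * c * enorm v.
Proof.
move=> c0 wc; apply: le_trans (dot_norm_le _ wc) _.
by rewrite ler_wpM2l ?norm_le_enorm// mulr_ge0.
Qed.

Lemma hessq_le (R : realType) (n : nat) (f : 'rV[R]_n -> R) (x v : 'rV[R]_n) (c : R) :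
  0 <= c -> (forall i j, `|partial i (partial j f) x| <= c) ->
  `|hessq f x v| <= n%:R ^+ 2 * c * dot v v.
Proof.
move=> c0 fc; apply: le_trans (ler_norm_sum _ _ _) _.
apply: (@le_trans _ _ (\sum_(i < n) enorm v * (n%:R * c * enorm v))).
  apply: ler_sum => i _; rewrite normrM ler_pM// ?coord_le_enorm//.
  by apply: dot_enorm_le => // j; rewrite gradE.
rewrite sumr_const card_ord -mulr_natl -enormE.
by rewrite le_eqVlt; apply/orP; left; apply/eqP; ring.
Qed.

(** The suffixes [0], [1], [2] stand for the value and the first two derivatives along [v]: [u] for
    the solution, [n] for the normal part, [P] for [Phi]. [T] is the second derivative of [u_xi],
    [b] the value of [Phi - eps u], [E] the length of [v], [q] its square, and [m] the dimension. *)
Lemma second_order_test_bound (R : realFieldType)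
  (T u0 u1 u2 n0 n1 n2 b P1 P2 eps K q E m cN cPhi M0 : R) :
  0 <= m -> 0 <= cN -> 0 <= cPhi -> 0 <= E -> E ^+ 2 = q ->
  `|b| <= M0 + cPhi -> `|P1| <= m * cPhi * E -> `|P2| <= m ^+ 2 * cPhi * q ->
  `|n0| <= m * cN -> `|n1| <= m * (m * cN * E) -> `|n2| <= m * (m ^+ 2 * cN * q) ->
  T + -1 * (n0 * (- eps * u2 + P2) + 2 * (n1 * (- eps * u1 + P1)) + b * n2) +
    eps ^+ 2 * (u0 * u2 + 2 * (u1 * u1) + u0 * u2) + K * (2 * q) <= 0 ->
  T <= - (eps * n0 + 2 * eps ^+ 2 * u0) * u2 +
    (3 * m ^+ 3 * cN * cPhi + (M0 + cPhi) * m ^+ 3 * cN + m ^+ 4 * cN ^+ 2 / 2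
      - 2 * K) * q.
Proof.
move=> m0 cN0 cP0 E0 Eq b0 bP1 bP2 bn0 bn1 bn2 H.
have mulle (a c A C : R) : `|a| <= A -> `|c| <= C -> a * c <= A * C.
  by move=> aA cC; apply: le_trans (ler_norm _) _; rewrite normrM ler_pM.
have h1 := mulle _ _ _ _ bn0 bP2; have h2 := mulle _ _ _ _ bn1 bP1.
have h3 := mulle _ _ _ _ b0 bn2; have h4 := mulle _ _ _ _ bn1 bn1.
(* Half of this square is [2 (eps u1)^2 + 2 eps u1 n1 + n1^2 / 2]; the first two terms are those of
   the hypothesis [H], and the last is the source of [cN ^+ 2 / 2] in the bound. *)
have h5 := sqr_ge0 (2 * eps * u1 + n1).
have e2 : m * (m * cN * E) * (m * cPhi * E) = m ^+ 3 * cN * cPhi * q by rewrite -Eq; ring.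
have e4 : m * (m * cN * E) * (m * (m * cN * E)) = m ^+ 4 * cN ^+ 2 * q by rewrite -Eq; ring.
rewrite {}e2 in h2; rewrite {}e4 in h4.
lra.
Qed.

(** * The test function at an interior maximum *)

Section TestFunction.
Context {R : realType} {n : nat} (Omega : set 'rV[R]_n) (u Phi : 'rV[R]_n -> R)
  (N : 'I_n -> 'rV[R]_n -> R) (xi : 'rV[R]_n) (eps K : R).

Definition normal_part (y : 'rV[R]_n) : R := \sum_i xi 0 i * N i y.

Definition test_function (y : 'rV[R]_n) : R :=
  \sum_i xi 0 i * partial i u y
  + -1 * (normal_part y * (- eps * u y + Phi y))
  + eps ^+ 2 * (u y * u y) + K * dot y y.

Context (cN cPhi M0 : R) (x : 'rV[R]_n).
Hypothesis oO : open Omega.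
Hypothesis Ox : Omega x.
Hypothesis xi1 : forall i, `|xi 0 i| <= 1.
Hypothesis eps01 : 0 < eps < 1.
Hypothesis cN0 : 0 <= cN.
Hypothesis cPhi0 : 0 <= cPhi.
Hypothesis M00 : 0 <= M0.
Hypothesis Cu : C_open 3 Omega u.
Hypothesis CPhi : C_open 2 Omega Phi.
Hypothesis CN : forall i, C_open 2 Omega (N i).
Hypothesis bu : `|eps * u x| <= M0.
Hypothesis bPhi : forall s, (size s <= 2)%N -> `|partials s Phi x| <= cPhi.
Hypothesis bN : forall i s, (size s <= 2)%N -> `|partials s (N i) x| <= cN.

Let xi_sum_le (a : 'I_n -> R) (c : R) : (forall i, `|a i| <= c) ->
  `|\sum_i xi 0 i * a i| <= n%:R * c.
Proof.
move=> ac; apply: le_trans (ler_norm_sum _ _ _) _.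
apply: (@le_trans _ _ (\sum_(i < n) c)); last by rewrite sumr_const card_ord mulr_natl.
by apply: ler_sum => i _; rewrite normrM -[leRHS]mul1r ler_pM.
Qed.

Definition test_constant : R :=
  3 * n%:R ^+ 3 * cN * cPhi + (M0 + cPhi) * n%:R ^+ 3 * cN + n%:R ^+ 4 * cN ^+ 2 / 2.

Lemma test_constant_ge0 : 0 <= test_constant.
Proof. by rewrite /test_constant !addr_ge0 ?mulr_ge0 ?exprn_ge0 ?addr_ge0. Qed.

(** This is the bounded [c] of the overview: the factor of the second derivative of [u] that comes
    from [<N, xi> eps u] and from [eps^2 u^2]. Its bound involves [u] only through [eps * u]. *)
Definition test_slope : R := eps * normal_part x + 2 * eps ^+ 2 * u x.

Lemma test_slope_le : `|test_slope| <= n%:R * cN + 2 * M0.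
Proof.
move: eps01 => /andP[e0 e1].
have nn : `|normal_part x| <= n%:R * cN by apply: xi_sum_le => i; exact: (bN i (s := [::])).
rewrite /test_slope; apply: le_trans (ler_normD _ _) _; apply: lerD.
  rewrite normrM gtr0_norm//; apply: le_trans nn.
  by rewrite ler_piMl// ltW.
have -> : 2 * eps ^+ 2 * u x = 2 * (eps * (eps * u x)) by ring.
rewrite !normrM gtr0_norm// ler_pM2l// -normrM gtr0_norm//.
by apply: le_trans bu; rewrite ler_piMl// ltW.
Qed.

(* Completing the square absorbs the only term of first order in u. *)
Lemma test_function_max_hessian v :
  (forall y, Omega y -> test_function y <= test_function x) ->
  \sum_m xi 0 m * hessq (partial m u) x v <=
    - test_slope * hessq u x v + (test_constant - 2 * K) * dot v v.
Proof.
move=> Vmax; move: eps01 => /andP[e0 e1].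
have /C_open_rec[_ _ pu] := Cu.
have Cu2 : C_open 2 Omega u by exact: C_open_le Cu.
have Ju := C2_jet v oO Ox Cu2; have JPhi := C2_jet v oO Ox CPhi.
have JU := jet_sum (index_enum _) (fun i => jetZ (xi 0 i) (C2_jet v oO Ox (pu i))).
have JN := jet_sum (index_enum _) (fun i => jetZ (xi 0 i) (C2_jet v oO Ox (CN i))).
have Jb := jetD (jetZ (- eps) Ju) JPhi.
have Jnb := jetZ (-1) (jetM Ox JN Jb).
have Juu := jetZ (eps ^+ 2) (jetM Ox Ju Ju).
have JV := jetD (jetD (jetD JU Jnb) Juu) (jetZ K (jet_sqnorm v Ox)).
have H := jet_max oO Ox JV Vmax.
have b0 : `|- eps * u x + Phi x| <= M0 + cPhi.
  apply: le_trans (ler_normD _ _) _; rewrite mulNr normrN.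
  by apply: lerD => //; exact: (bPhi (s := [::])).
have b1 : `|dot (grad Phi x) v| <= n%:R * cPhi * enorm v.
  by apply: dot_enorm_le => // i; rewrite gradE; exact: (bPhi (s := [:: i])).
have b2 : `|hessq Phi x v| <= n%:R ^+ 2 * cPhi * dot v v.
  by apply: hessq_le => // i j; exact: (bPhi (s := [:: i; j])).
have nn0 : `|normal_part x| <= n%:R * cN by apply: xi_sum_le => i; exact: (bN i (s := [::])).
have nn1 : `|\sum_i xi 0 i * dot (grad (N i) x) v| <= n%:R * (n%:R * cN * enorm v).
  apply: xi_sum_le => i; apply: dot_enorm_le => // j; rewrite gradE.
  exact: (bN i (s := [:: j])).
have nn2 : `|\sum_i xi 0 i * hessq (N i) x v| <= n%:R * (n%:R ^+ 2 * cN * dot v v).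
  by apply: xi_sum_le => i; apply: hessq_le => // j k; exact: (bN i (s := [:: j; k])).
rewrite /test_slope /test_constant.
exact: (second_order_test_bound (ler0n _ _) cN0 cPhi0 (enorm_ge0 v) (enormE v) b0 b1 b2 nn0 nn1 nn2 H).
Qed.
End TestFunction.

(* Maximality forces D^2 u (x + t xi) <= (1 - c t) D^2 u (x) - t s I, up to a
   small error, for small t > 0, with s large when K is; by hquot_Lambda_le, fr
   then decreases along xi faster than its derivative bound permits. *)
Lemma interior_not_max (R : realType) (n p k l : nat) (Omega : set 'rV[R]_n)
  (u Phi fr : 'rV[R]_n -> R) (N : 'I_n -> 'rV[R]_n -> R) (xi x : 'rV[R]_n)
  (eps K cN cPhi cf M0 : R) :
  (l < k)%N -> (0 < 'C(n, p))%N -> open Omega -> Omega x ->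
  (forall i, `|xi 0 i| <= 1) -> 0 < eps < 1 -> 0 <= cN -> 0 <= cPhi -> 0 <= cf -> 0 <= M0 ->
  C_open 3 Omega u -> C_open 2 Omega Phi -> (forall i, C_open 2 Omega (N i)) ->
  C_open 1 Omega fr ->
  (forall y, Omega y -> Gamma_cone k (Lambda p (hessian u y))) ->
  (forall y, Omega y -> fr y = (sigma k (Lambda p (hessian u y)) /
     sigma l (Lambda p (hessian u y))) `^ (k - l)%:R^-1) ->
  `|eps * u x| <= M0 ->
  (forall s, (size s <= 2)%N -> `|partials s Phi x| <= cPhi) ->
  (forall i s, (size s <= 2)%N -> `|partials s (N i) x| <= cN) ->
  (forall y, Omega y -> `|fr y| <= cf) ->
  (forall i y, Omega y -> `|partial i fr y| <= cf) ->
  0 <= 2 * K - test_constant (n := n) cN cPhi M0 - 1 ->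
  n%:R * cf + (n%:R * cN + 2 * M0) * cf <
    (2 * K - test_constant (n := n) cN cPhi M0 - 1) * p%:R / ('C(n, p))%:R ->
  ~ (forall y, Omega y ->
      test_function u Phi N xi eps K y <= test_function u Phi N xi eps K x).
Proof.
move=> lk C0 oO Ox xi1 eps01 cN0 cP0 cf0 M00 Cu CPhi CN Cfr adm eqn bu bPhi bN bfr bdfr K0 Kbig Vmax.
have xin : `|xi| <= 1 by exact: norm_row_le.
have [d d0 dP] := hessq_expansion oO Cu Ox xin.
set C1 := test_constant (n := n) cN cPhi M0 in K0 Kbig.
set c := test_slope u N xi eps x.
have cle : `|c| <= n%:R * cN + 2 * M0 by exact: test_slope_le.
have T v := test_function_max_hessian oO Ox xi1 eps01 cN0 cP0 Cu CPhi CN bu bPhi bN v Vmax.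
(* Being below [d], [t] is in the range of the Hessian expansion; the other bound keeps the factor
   [1 - c * t] positive, as homogeneity requires. *)
pose t := Num.min d (2 * (`|c| + 1))^-1 / 2.
have c1 : 0 < 2 * (`|c| + 1) by rewrite mulr_gt0// ltr_wpDl.
have m0 : 0 < Num.min d (2 * (`|c| + 1))^-1 by rewrite lt_min d0 invr_gt0.
have t0 : 0 < t by rewrite divr_gt0.
have tm : t < Num.min d (2 * (`|c| + 1))^-1 by rewrite /t; lra.
have td : t < d by apply: (lt_le_trans tm); rewrite ge_min lexx.
have tc : t * (2 * (`|c| + 1)) < 1.
  by rewrite -ltr_pdivlMr// div1r; apply: (lt_le_trans tm); rewrite ge_min lexx orbT.
have [Oy hE] := dP t t0 td.
set y := x + t *: xi in Oy hE.
have a0 : 0 < 1 - c * t.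
  have : c * t <= `|c| * t by rewrite ler_wpM2r ?(ltW t0)// ler_norm.
  by nra.
have s0 : 0 <= t * (2 * K - C1 - 1) by rewrite mulr_ge0// ltW.
have Cu2 : C_open 2 Omega u by exact: C_open_le Cu.
have subst3 (a b q a' b' q' e1 e2 : R) : a = a' -> b = b' -> q = q' ->
  a' <= e1 * b' - e2 * q' -> a <= e1 * b - e2 * q by move=> -> -> ->.
have le (z : 'rV[R]_n) : (z *m hessian u y *m z^T) 0 0 <=
    (1 - c * t) * (z *m hessian u x *m z^T) 0 0 - t * (2 * K - C1 - 1) * (z *m z^T) 0 0.
  have dE : (z *m z^T) 0 0 = dot z z by rewrite mxE; apply: eq_bigr => i _; rewrite mxE.
  refine (subst3 _ _ _ _ _ _ (1 - c * t) (t * (2 * K - C1 - 1)) (hessian_form u y z) (hessian_form u x z) dE _).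
  apply: (le_trans (hE z)); have := T z.
  rewrite -/C1 -/c; move: (\sum_m _) (hessq u x z) (dot z z) => S h q ST.
  have : t * S <= t * (- c * h + (C1 - 2 * K) * q) by rewrite ler_pM2l.
  by lra.
have subst2 (a b a' b' e1 e2 : R) : a = a' -> b = b' ->
  a' + e1 <= e2 * b' -> a + e1 <= e2 * b by move=> -> ->.
have H := subst2 _ _ _ _ _ _ (eqn y Oy) (eqn x Ox)
  (hquot_Lambda_le lk (hessian_sym oO Cu2 Ox) (hessian_sym oO Cu2 Oy)
    (adm x Ox) (adm y Oy) a0 s0 le).
(* The derivative bound gives [fr y] from below, while [H] bounds it from above by
   [(1 - c * t) * fr x] minus a multiple of [t] that grows with [K]; [Kbig] makes the two
   incompatible. *)
have fxy : `|fr y - fr x| <= n%:R * cf * t.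
  have yx : y - x = t *: xi by rewrite /y addrAC subrr add0r.
  have seg s : 0 <= s <= 1 -> Omega (s *: (y - x) + x).
    move=> /andP[s0' s1]; rewrite yx scalerA addrC.
    have [->|sn0] := eqVneq s 0; first by rewrite mul0r scale0r addr0.
    have sp : 0 < s by rewrite lt_neqAle eq_sym sn0.
    apply: (proj1 (dP (s * t) _ _)); first by rewrite mulr_gt0.
    by apply: le_lt_trans td; rewrite ler_piMl// ltW.
  have [s s01 ->] := C1_MVT oO Cfr seg.
  have := dot_norm_le (c := cf) (u := grad fr (s *: (y - x) + x)) (y - x).
  move=> /(_ _)/le_trans; apply.
    by move=> i; rewrite gradE; apply: bdfr; exact: seg.
  by rewrite yx normrZ gtr0_norm// ler_wpM2l ?mulr_ge0// ler_piMr// ltW.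
have cfx : - (c * fr x) <= (n%:R * cN + 2 * M0) * cf.
  apply: le_trans (ler_norm _) _; rewrite normrN normrM.
  by apply: ler_pM => //; exact: bfr.
have Kt : t * (n%:R * cf + (n%:R * cN + 2 * M0) * cf) <
    t * ((2 * K - C1 - 1) * p%:R / ('C(n, p))%:R) by rewrite ltr_pM2l.
have cft : t * - (c * fr x) <= t * ((n%:R * cN + 2 * M0) * cf) by rewrite ler_pM2l.
move: fxy; rewrite ler_norml => /andP[fxy _].
move: H Kt cft fxy; set Z := (2 * K - C1 - 1) * p%:R / ('C(n, p))%:R.
have -> : t * (2 * K - C1 - 1) * p%:R / ('C(n, p))%:R = t * Z by rewrite /Z; ring.
move: (fr x) (fr y) Z => a b Z; clearbody c; lra.
Qed.

(** * First-order calculus at a boundary point *)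

Section ExpansionAlgebra.
Context {R : realType} {n : nat} (D : set 'rV[R]_n) (x : 'rV[R]_n).

Lemma expansion_cst (c : R) : expansion D (fun=> c) x 0.
Proof.
move=> e e0; exists 1 => // y _ _; rewrite subrr dot0l subr0 normr0.
by rewrite mulr_ge0// ltW.
Qed.

Lemma expansionD (f h : 'rV[R]_n -> R) (a b : 'rV[R]_n) :
  expansion D f x a -> expansion D h x b ->
  expansion D (fun y => f y + h y) x (a + b).
Proof.
move=> Ef Eh e e0; have e2 : 0 < e / 2 by rewrite divr_gt0.
have [d1 d10 H1] := Ef _ e2; have [d2 d20 H2] := Eh _ e2.
exists (Num.min d1 d2) => [|y Dy]; first by rewrite lt_min d10.
rewrite lt_min => /andP[y1 y2]; have l1 := H1 y Dy y1; have l2 := H2 y Dy y2.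
rewrite dotDl.
have -> : f y + h y - (f x + h x) - (dot a (y - x) + dot b (y - x)) =
  (f y - f x - dot a (y - x)) + (h y - h x - dot b (y - x)) by ring.
apply: le_trans (ler_normD _ _) _; rewrite [X in _ <= X * _](splitr e) mulrDl; exact: lerD.
Qed.

Lemma expansion_lip (f : 'rV[R]_n -> R) (a : 'rV[R]_n) : expansion D f x a ->
  exists2 d : R, 0 < d & forall y, D y -> `|y - x| < d ->
    `|f y - f x| <= (n%:R * `|a| + 1) * `|y - x|.
Proof.
move=> Ef; have [d d0 H] := Ef 1 ltr01; exists d => // y Dy yd.
have := H y Dy yd; rewrite mul1r => l1.
rewrite -[f y - f x](subrK (dot a (y - x))).
apply: le_trans (ler_normD _ _) _; rewrite mulrDl mul1r addrC; apply: lerD => //.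
exact: dot_norm_le2.
Qed.

Lemma expansionM (f h : 'rV[R]_n -> R) (a b : 'rV[R]_n) :
  expansion D f x a -> expansion D h x b ->
  expansion D (fun y => f y * h y) x (f x *: b + h x *: a).
Proof.
move=> Ef Eh e e0.
have [d3 d30 L1] := expansion_lip Ef; have [d4 d40 L2] := expansion_lip Eh.
set A := n%:R * `|a| + 1 in L1; set B := n%:R * `|b| + 1 in L2.
have A0 : 0 < A by rewrite ltr_wpDl// mulr_ge0.
have B0 : 0 < B by rewrite ltr_wpDl// mulr_ge0.
pose M := `|f x| + `|h x| + A * B + 1.
have M0 : 0 < M by rewrite ltr_wpDl// !addr_ge0// mulr_ge0 ?(ltW A0) ?(ltW B0).
have e' : 0 < e / M by rewrite divr_gt0.
have [d1 d10 H1] := Ef _ e'; have [d2 d20 H2] := Eh _ e'.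
exists (Num.min (Num.min d1 d2) (Num.min (Num.min d3 d4) (e / M))).
  by rewrite !lt_min d10 d20 d30 d40.
move=> y Dy; rewrite !lt_min => /andP[/andP[y1 y2] /andP[/andP[y3 y4] y5]].
have l1 := H1 y Dy y1; have l2 := H2 y Dy y2.
have l3 := L1 y Dy y3; have l4 := L2 y Dy y4.
rewrite dotDl !dotZl.
move: l1 l2 l3 l4 y5; set r := `|y - x|; move: (dot a (y - x)) (dot b (y - x)) => p q.
have r0 : 0 <= r by exact: normr_ge0.
move: (f y) (h y) => fy hy l1 l2 l3 l4 y5.
have -> : fy * hy - f x * h x - (f x * q + h x * p) =
  f x * (hy - h x - q) + h x * (fy - f x - p) + (fy - f x) * (hy - h x) by ring.
have -> : e * r = `|f x| * (e / M * r) + `|h x| * (e / M * r) + (A * B + 1) * (e / M * r).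
  have -> : e * r = M * (e / M * r) by rewrite mulrA mulrCA divff ?mulr1// gt_eqF.
  by rewrite /M; ring.
apply: le_trans (ler_normD _ _) _; apply: lerD.
  apply: le_trans (ler_normD _ _) _; rewrite !normrM; apply: lerD; exact: ler_wpM2l.
rewrite normrM; apply: (@le_trans _ _ (A * r * (B * r))); first exact: ler_pM.
have -> : A * r * (B * r) = A * B * (r * r) by ring.
have AB : 0 < A * B by rewrite mulr_gt0.
apply: (@le_trans _ _ (A * B * (e / M * r))).
  by rewrite ler_pM2l// ler_wpM2r// ltW.
by apply: ler_wpM2r; rewrite ?lerDl// mulr_ge0// ltW.
Qed.

Lemma expansionZ (c : R) (f : 'rV[R]_n -> R) (a : 'rV[R]_n) :
  expansion D f x a -> expansion D (fun y => c * f y) x (c *: a).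
Proof.
move=> Ef; have := expansionM (expansion_cst c) Ef.
by rewrite scaler0 addr0.
Qed.

Lemma expansion_sum (I : Type) (r : seq I) (f : I -> 'rV[R]_n -> R) (a : I -> 'rV[R]_n) :
  (forall i, expansion D (f i) x (a i)) ->
  expansion D (fun y => \sum_(i <- r) f i y) x (\sum_(i <- r) a i).
Proof.
move=> H; elim: r => [|i r IHr].
  by rewrite big_nil; under eq_fun do rewrite big_nil; exact: expansion_cst.
by rewrite big_cons; under eq_fun do rewrite big_cons; exact: expansionD.
Qed.

Lemma expansion_sub (D' : set 'rV[R]_n) (f : 'rV[R]_n -> R) (a : 'rV[R]_n) :
  D `<=` D' -> expansion D' f x a -> expansion D f x a.
Proof.
move=> DD Ef e e0; have [d d0 H] := Ef e e0; exists d => // y Dy.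
by apply: H; exact: DD.
Qed.

Lemma expansion_sqnorm : expansion D (fun y => dot y y) x (2 *: x).
Proof.
have -> : 2 *: x = \sum_i (x 0 i *: delta_mx 0 i + x 0 i *: delta_mx 0 i).
  by rewrite big_split/= -row_sum_delta scaler_nat.
apply: expansion_sum => i.
have C : expansion D (fun y : 'rV[R]_n => y 0 i) x (delta_mx 0 i).
  move=> e e0; exists 1 => // y _ _; rewrite dotC dot_delta !mxE subrr normr0.
  by rewrite mulr_ge0// ltW.
exact: expansionM.
Qed.
End ExpansionAlgebra.

Lemma dot_suml (R : realType) (n : nat) (I : Type) (r : seq I) (a : I -> 'rV[R]_n)
  (v : 'rV[R]_n) : dot (\sum_(i <- r) a i) v = \sum_(i <- r) dot (a i) v.
Proof.
elim: r => [|i r IHr]; first by rewrite !big_nil dot0l.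
by rewrite !big_cons dotDl IHr.
Qed.

(** Only inward difference quotients are available: along [x0 - t *: g], which [inward_cone] keeps
    in the closure, they are nonpositive and converge to [- dot w g]. *)
Lemma expansion_boundary_max (R : realType) (n : nat) (Omega U : set 'rV[R]_n)
  (rho f : 'rV[R]_n -> R) (x0 w : 'rV[R]_n) :
  open Omega -> boundary Omega x0 -> local_defining 1 Omega x0 U rho ->
  expansion (closure Omega) f x0 w ->
  (forall y, closure Omega y -> f y <= f x0) -> 0 <= dot w (grad rho x0).
Proof.
move=> oO Bx0 L Ef fmax; set g := grad rho x0.
have [r [_ [r0 _ cone _]]] := inward_cone oO Bx0 L.
have cx0 : closure Omega x0 by case: Bx0.
have inO : \forall t \near 0^'+, closure Omega (x0 - t *: g).
  near=> t; have t0 : 0 < t by near: t; exact: nbhs_right_gt.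
  have tr : t < r by near: t; exact: nbhs_right_lt.
  by apply: subset_closure; apply: cone; rewrite // subrr normr0.
have dir : t^-1 *: (x0 - t *: g - x0) @[t --> 0^'+] --> - g.
  apply: (@cvg_trans _ (cst (- g) @ 0^'+)); last exact: cvg_cst.
  apply: near_eq_cvg; near=> t.
  have t0 : t != 0 by near: t; exact: right_neq0.
  by rewrite addrAC subrr sub0r scalerN scalerA mulVf// scale1r.
have lim : t^-1 * (f (x0 - t *: g) - f x0) @[t --> 0^'+] --> dot w (- g).
  exact: expansion_curve right_neq0 right_cvg0 Ef inO dir.
rewrite -oppr_le0 -dotNr -(cvg_lim (@Rhausdorff R) lim); apply: limr_le.
  by apply/cvg_ex; eexists; exact: lim.
near=> t.
have t0 : 0 < t by near: t; exact: nbhs_right_gt.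
by rewrite pmulr_rle0 ?invr_gt0// subr_le0; apply: fmax; near: t.
Unshelve. all: by end_near. Qed.

Lemma sum_unit_le (R : realType) (n : nat) (v : 'rV[R]_n) (a : 'I_n -> R) (c : R) :
  dot v v = 1 -> (forall i, `|a i| <= c) -> `|\sum_i v 0 i * a i| <= n%:R * c.
Proof.
move=> v1 ac; apply: le_trans (ler_norm_sum _ _ _) _.
apply: (@le_trans _ _ (\sum_(i < n) c)); last by rewrite sumr_const card_ord mulr_natl.
apply: ler_sum => i _; rewrite normrM -[leRHS]mul1r ler_pM//.
by apply: le_trans (coord_le_enorm v i) _; rewrite /enorm v1 sqrtr1.
Qed.

(** [E] is the Neumann condition differentiated along [xi], and the inequality after it is the outer
    normal derivative of W. [SX] is the second fundamental form at [xi], [QN] the mixed second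
    derivative of [u], [X] the product of position and normal; [SN] and [T] are further derivatives
    of [N], and [DP] that of [Phi]. Eliminating [QN] isolates [e0 * SX], and [eps * e0] has the good
    sign. *)
Lemma boundary_arith (R : realFieldType)
  (m e0 b eps U QN SX SN DP T X K kappa0 cN cPhi M0 dR : R) :
  0 <= m -> 0 <= cN -> 0 <= cPhi -> 0 <= e0 -> 0 < eps < 1 -> 0 <= K -> 0 <= M0 ->
  `|b| <= M0 + cPhi -> `|eps * U| <= M0 -> kappa0 <= SX ->
  `|SN| <= m * (m * cN) -> `|T| <= m * (m * cN) -> `|DP| <= m * cPhi ->
  `|X| <= m * dR -> e0 * SX + b * SN + QN + eps * e0 - DP = 0 ->
  0 <= QN - b * T + eps ^+ 2 * (2 * (U * b)) + K * (2 * X) ->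
  kappa0 * e0 <= 2 * (M0 + cPhi) * (m ^+ 2 * cN) + m * cPhi +
    2 * M0 * (M0 + cPhi) + 2 * K * (m * dR).
Proof.
move=> m0 cN0 cP0 e00 /andP[ep0 ep1] K0 M00 bb bU kS bSN bT bDP bX E H.
have mulle (a c A C : R) : `|a| <= A -> `|c| <= C -> `|a * c| <= A * C.
  by move=> aA cC; rewrite normrM ler_pM.
have h1 := mulle _ _ _ _ bb bSN; have h2 := mulle _ _ _ _ bb bT.
have h3 := mulle _ _ _ _ bU bb.
have h4 : kappa0 * e0 <= e0 * SX by rewrite mulrC ler_wpM2l.
have h5 : 0 <= eps * e0 by rewrite mulr_ge0// ltW.
have h6 : eps * (eps * U * b) <= M0 * (M0 + cPhi).
  apply: le_trans (ler_norm _) _; rewrite normrM gtr0_norm//.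
  by apply: le_trans h3; rewrite ler_piMl// ltW.
have h7 : K * X <= K * (m * dR) by rewrite ler_wpM2l// (le_trans (ler_norm _)).
have e2 : eps ^+ 2 * (2 * (U * b)) = 2 * (eps * (eps * U * b)) by ring.
rewrite {}e2 in H.
move: h1 h2 bDP; rewrite !ler_norml => /andP[h1 _] /andP[h2 _] /andP[_ h8].
have -> : m ^+ 2 * cN = m * (m * cN) by ring.
lra.
Qed.

(** * The maximum on the boundary *)

Section BoundaryMax.
Context {R : realType} {n : nat} (Omega U : set 'rV[R]_n) (rho : 'rV[R]_n -> R)
  (N G : 'I_n -> 'rV[R]_n -> R) (GG : 'I_n -> 'I_n -> R) (u Phi : 'rV[R]_n -> R)
  (P xi x0 : 'rV[R]_n) (eps K kappa0 e0 cN cPhi M0 dR : R).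
Hypothesis oO : open Omega.
Hypothesis Bx0 : boundary Omega x0.
Hypothesis L2 : local_defining 2 Omega x0 U rho.
Hypothesis kappa0P : forall kappa, principal_curvature Omega x0 kappa -> kappa0 <= kappa.
Hypothesis CN : forall i, C_open 1 setT (N i).
Hypothesis NE : forall i y, U y -> boundary Omega y -> N i y = unit_grad rho y 0 i.
Hypothesis EG : forall i, expansion (closure Omega) (G i) x0 (\row_j GG i j).
Hypothesis GGC : forall i j, GG i j = GG j i.
Hypothesis Eu : expansion (closure Omega) u x0 (\row_i G i x0).
Hypothesis EPhi : expansion (closure Omega) Phi x0 P.
Hypothesis bc : forall y, boundary Omega y ->
  \sum_i G i y * N i y = - eps * u y + Phi y.
Hypothesis xi1 : dot xi xi = 1.
Hypothesis gxi : dot (grad rho x0) xi = 0.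
Hypothesis e00 : 0 <= e0.
Hypothesis GE : forall i,
  G i x0 = e0 * xi 0 i + (- eps * u x0 + Phi x0) * N i x0.
Hypothesis eps01 : 0 < eps < 1.
Hypothesis K0 : 0 <= K.
Hypothesis cN0 : 0 <= cN.
Hypothesis cPhi0 : 0 <= cPhi.
Hypothesis M00 : 0 <= M0.
Hypothesis bN : forall i j, `|partial j (N i) x0| <= cN.
Hypothesis bPhi : `|Phi x0| <= cPhi.
Hypothesis bP : forall j, `|P 0 j| <= cPhi.
Hypothesis bu : `|eps * u x0| <= M0.
Hypothesis bx : forall j, `|x0 0 j| <= dR.

Let nu := unit_grad rho x0.
Let b := - eps * u x0 + Phi x0.
Let m i v := dot (grad (N i) x0) v.

Let Ux0 : U x0. Proof. by have [[]] := L2. Qed.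
Let oU : open U. Proof. by have [[]] := L2. Qed.
Let L1 : local_defining 1 Omega x0 U rho. Proof. exact: local_defining_le L2. Qed.
Let g0 : grad rho x0 != 0. Proof. by have [_ _ /(_ _ Ux0)] := L2. Qed.
Let NE0 i : N i x0 = nu 0 i. Proof. exact: NE. Qed.
Let nu1 : dot nu nu = 1. Proof. exact: enorm_unit. Qed.
Let nuxi : dot nu xi = 0. Proof. by rewrite dotZl gxi mulr0. Qed.

Let expansion_N i : expansion setT (N i) x0 (grad (N i) x0).
Proof. by apply: C1_expansion (CN i) _; first exact: openT. Qed.

Let m_le i v : dot v v = 1 -> `|m i v| <= n%:R * cN.
Proof.
move=> v1; have := @dot_enorm_le R n (grad (N i) x0) v cN cN0.
by rewrite /enorm v1 sqrtr1 mulr1; apply => j; rewrite gradE.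
Qed.

(** Curvature is defined through [unit_grad rho], which agrees with the extension [N] on the
    boundary; hence their tangential derivatives agree. Nothing similar holds along the normal,
    where the derivative of [N] is merely bounded. *)
Let mxiE i : m i xi = dot (grad (fun y => unit_grad rho y 0 i) x0) xi.
Proof.
apply: (tangential_derivative_eq (D1 := setT) (D2 := U)
  (f2 := fun y => unit_grad rho y 0 i) Bx0 L1 gxi) => //.
- by apply: filterS (open_nbhs_nbhs (conj oU Ux0)) => y.
- apply: C1_expansion => //; apply: (C_open_unit_grad _) => //; by have [] := L2.
- by apply: filterS (open_nbhs_nbhs (conj oU Ux0)) => y Uy; exact: NE.
Qed.

Let Gv := \row_i G i x0.
Let dotG v : dot Gv v = e0 * dot xi v + b * dot nu v.
Proof.
rewrite /dot !mulr_sumr -big_split/=; apply: eq_bigr => i _.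
by rewrite mxE GE NE0 mulrDl !mulrA.
Qed.

Let Q (v w : 'rV[R]_n) := \sum_i v 0 i * dot (\row_j GG i j) w.
Let Q_sym v w : Q v w = Q w v.
Proof.
rewrite /Q /dot; under eq_bigr do rewrite mulr_sumr.
under [RHS]eq_bigr do rewrite mulr_sumr.
rewrite exchange_big/=; apply: eq_bigr => i _; apply: eq_bigr => j _.
by rewrite !mxE GGC; ring.
Qed.

(** By [GE] the gradient at [x0] is [e0 *: xi + b *: nu]. Its first part, against the derivative of
    the normal, gives the curvature term, and it also makes [eps * e0] the derivative of [eps * u]
    along [xi]. *)
Let tangential_equation : e0 * (\sum_i xi 0 i * m i xi) + b * (\sum_i nu 0 i * m i xi)
  + Q nu xi + eps * e0 - dot P xi = 0.
Proof.
have E : expansion (closure Omega) (fun y => \sum_i G i y * N i y + (eps * u y + -1 * Phi y))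
    x0 (\sum_i (G i x0 *: grad (N i) x0 + N i x0 *: \row_j GG i j) + (eps *: Gv + -1 *: P)).
  apply: expansionD; last by apply: expansionD; exact: expansionZ.
  apply: expansion_sum => i; apply: expansionM => //.
  exact: expansion_sub (expansion_N i).
have H : dot (\sum_i (G i x0 *: grad (N i) x0 + N i x0 *: \row_j GG i j) +
    (eps *: Gv + -1 *: P)) xi = 0.
  rewrite -(dot0l xi).
  apply: (tangential_derivative_eq Bx0 L1 gxi (D2 := setT) _ E (expansion_cst _ _ 0)).
  - by apply: (@filterE _ (nbhs x0) _) => y [].
  - by apply: (@filterE _ (nbhs x0) _) => y /bc ->; ring.
rewrite -[RHS]H !dotDl !dotZl dot_suml dotG nuxi xi1 mulN1r.
have -> : \sum_i dot (G i x0 *: grad (N i) x0 + N i x0 *: \row_j GG i j) xi =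
    e0 * (\sum_i xi 0 i * m i xi) + b * (\sum_i nu 0 i * m i xi) + Q nu xi.
  rewrite !mulr_sumr -!big_split/=; apply: eq_bigr => i _.
  by rewrite dotDl !dotZl GE NE0 -/b -/(m i xi); ring.
by ring.
Qed.

Let normal_inequality :
  (forall y, closure Omega y ->
    \sum_i xi 0 i * G i y + -1 * (normal_part N xi y * (- eps * u y + Phi y))
      + eps ^+ 2 * (u y * u y) + K * dot y y <=
    \sum_i xi 0 i * G i x0 + -1 * (normal_part N xi x0 * (- eps * u x0 + Phi x0))
      + eps ^+ 2 * (u x0 * u x0) + K * dot x0 x0) ->
  0 <= Q xi nu - b * (\sum_i xi 0 i * m i nu) + eps ^+ 2 * (2 * (u x0 * b))
    + K * (2 * dot x0 nu).
Proof.
move=> Wmax.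
have EN : expansion (closure Omega) (normal_part N xi) x0 (\sum_i xi 0 i *: grad (N i) x0).
  by apply: expansion_sum => i; apply: expansionZ; exact: expansion_sub (expansion_N i).
have Eb := expansionD (expansionZ (- eps) Eu) EPhi.
have EW := expansionD (expansionD (expansionD
  (expansion_sum (index_enum _) (fun i => expansionZ (xi 0 i) (EG i)))
  (expansionZ (-1) (expansionM EN Eb)))
  (expansionZ (eps ^+ 2) (expansionM Eu Eu)))
  (expansionZ K (expansion_sqnorm (closure Omega) x0)).
have := expansion_boundary_max oO Bx0 L1 EW Wmax.
have -> : grad rho x0 = enorm (grad rho x0) *: nu.
  by rewrite /nu /unit_grad scalerA divff ?scale1r// gt_eqF// enorm_gt0.
rewrite dotZr pmulr_rge0 ?enorm_gt0//.
(* Since [xi] is tangent, the product rule drops the derivative of [Phi - eps u] and keeps only that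
   of [N]. *)
have nn0 : normal_part N xi x0 = 0.
  rewrite /normal_part -[RHS]nuxi; apply: eq_bigr => i _.
  by rewrite NE0 mulrC.
have dGn : dot (\row_i G i x0) nu = b by rewrite -/Gv dotG dotC nuxi nu1; ring.
rewrite !dotDl !dotZl !dotDl !dotZl !dot_suml nn0 dGn -/b.
have -> : \sum_i dot (xi 0 i *: \row_j GG i j) nu = Q xi nu.
  by apply: eq_bigr => i _; rewrite dotZl.
have -> : \sum_i dot (xi 0 i *: grad (N i) x0) nu = \sum_i xi 0 i * m i nu.
  by apply: eq_bigr => i _; rewrite dotZl.
congr (0 <= _); ring.
Qed.

Lemma boundary_max_bound :
  (forall y, closure Omega y ->
    \sum_i xi 0 i * G i y + -1 * (normal_part N xi y * (- eps * u y + Phi y))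
      + eps ^+ 2 * (u y * u y) + K * dot y y <=
    \sum_i xi 0 i * G i x0 + -1 * (normal_part N xi x0 * (- eps * u x0 + Phi x0))
      + eps ^+ 2 * (u x0 * u x0) + K * dot x0 x0) ->
  kappa0 * e0 <= 2 * (M0 + cPhi) * (n%:R ^+ 2 * cN) + n%:R * cPhi +
    2 * M0 * (M0 + cPhi) + 2 * K * (n%:R * dR).
Proof.
(* Symmetry of the second derivatives identifies the mixed term of the two relations, so that it can
   be eliminated. *)
move=> /normal_inequality; rewrite Q_sym => H.
have dR0 : 0 <= dR.
  case: (pickP (@predT 'I_n)) => [j _|n0]; first exact: le_trans (bx j).
  by move: xi1; rewrite /dot big1 => [/eqP|i _]; [rewrite eq_sym oner_eq0|have := n0 i].
have kS : kappa0 <= \sum_i xi 0 i * m i xi.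
  have := curvature_form L2 kappa0P gxi; rewrite xi1 mulr1.
  by under [X in _ <= X -> _]eq_bigr do rewrite -mxiE.
have bb : `|b| <= M0 + cPhi.
  by apply: le_trans (ler_normD _ _) _; rewrite mulNr normrN lerD.
have unit1 (w : 'rV[R]_n) (c : R) : 0 <= c -> (forall j, `|w 0 j| <= c) ->
    forall v, dot v v = 1 -> `|dot w v| <= n%:R * c.
  by move=> c0 wc v v1; have := dot_enorm_le v c0 wc; rewrite /enorm v1 sqrtr1 mulr1.
exact: (boundary_arith (ler0n _ n) cN0 cPhi0 e00 eps01 K0 M00 bb bu kS
  (sum_unit_le nu1 (fun i => m_le i xi1)) (sum_unit_le xi1 (fun i => m_le i nu1))
  (unit1 _ _ cPhi0 bP _ xi1) (unit1 _ _ dR0 bx _ nu1) tangential_equation H).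
Qed.
End BoundaryMax.

Lemma dot_unit_le (R : realType) (n : nat) (v w : 'rV[R]_n) :
  dot v v = 1 -> dot v w <= enorm w.
Proof.
move=> v1; have H : dot v w ^+ 2 <= dot w w.
  have := dot_ge0 (w - dot v w *: v).
  rewrite !dotBl !dotBr !dotZl !dotZr v1 (dotC w v).
  by move: (dot v w) (dot w w) => a c; lra.
apply: le_trans (ler_norm _) _; rewrite -sqrtr_sqr; exact: ler_wsqrtr.
Qed.

(** * The gradient estimate *)

Section GradientEstimate.
Context {R : realType} {n : nat} (Omega : set 'rV[R]_n) (nu : 'rV[R]_n -> 'rV[R]_n)
  (N : 'I_n -> 'rV[R]_n -> R) (u Phi : 'rV[R]_n -> R)
  (eps K kappa0 cN cPhi M0 dR : R).
Hypothesis oO : open Omega.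
Hypothesis bO : bounded_set Omega.
Hypothesis LD : forall x, boundary Omega x ->
  exists (U : set 'rV[R]_n) (rho : 'rV[R]_n -> R), local_defining 2 Omega x U rho.
Hypothesis hnu : forall x, boundary Omega x -> outer_unit_normal Omega x (nu x).
Hypothesis kappa00 : 0 < kappa0.
Hypothesis kappa0P : forall x kappa, boundary Omega x ->
  principal_curvature Omega x kappa -> kappa0 <= kappa.
Hypothesis CN : forall i, C_open 2 setT (N i).
Hypothesis NE : forall i x, boundary Omega x -> N i x = nu x 0 i.
Hypothesis Cu : C_closure 2 Omega u.
Hypothesis CPhi : C_closure 2 Omega Phi.
Hypothesis bc : forall y, boundary Omega y ->
  dirder_closure Omega u (nu y) y = - eps * u y + Phi y.
Hypothesis eps01 : 0 < eps < 1.
Hypothesis K0 : 0 <= K.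
Hypothesis cN0 : 0 <= cN.
Hypothesis cPhi0 : 0 <= cPhi.
Hypothesis M00 : 0 <= M0.
Hypothesis bN : forall i s x, (size s <= 2)%N -> closure Omega x ->
  `|partials s (N i) x| <= cN.
Hypothesis bPhi : forall s x, (size s <= 2)%N -> Omega x -> `|partials s Phi x| <= cPhi.
Hypothesis bu : forall x, closure Omega x -> `|eps * u x| <= M0.
Hypothesis bx : forall x i, closure Omega x -> `|x 0 i| <= dR.
Hypothesis interior : forall x xi : 'rV[R]_n, Omega x -> (forall i, `|xi 0 i| <= 1) ->
  ~ (forall y, Omega y ->
      test_function u Phi N xi eps K y <= test_function u Phi N xi eps K x).

Definition boundary_constant (m : R) : R :=
  2 * (M0 + cPhi) * (m ^+ 2 * cN) + m * cPhi + 2 * M0 * (M0 + cPhi) + 2 * K * (m * dR).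

Let G i := extension Omega (partial i u).
Let GG i j := extension Omega (partial j (partial i u)).
Let b y := - eps * u y + Phi y.
Let h i y := G i y - b y * N i y.
Let hv y := \row_i h i y.
(* The maximum over the unit vectors xi of the test function at y. *)
Let S y := enorm (hv y) + eps ^+ 2 * (u y * u y) + K * dot y y.

Let GC i : {within closure Omega, continuous (G i)} /\
  forall x, Omega x -> G i x = partial i u x.
Proof. exact: (extension_C_closure (s := [:: i]) Cu). Qed.

Let GGC i j : {within closure Omega, continuous (GG i j)} /\
  forall x, Omega x -> GG i j x = partial j (partial i u) x.
Proof. exact: (extension_C_closure (s := [:: j; i]) Cu). Qed.

Let PC i : {within closure Omega, continuous (extension Omega (partial i Phi))} /\
  forall x, Omega x -> extension Omega (partial i Phi) x = partial i Phi x.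
Proof. exact: (extension_C_closure (s := [:: i]) CPhi). Qed.

Let within_cst_dot : {within closure Omega, continuous (fun y : 'rV[R]_n => dot y y)}.
Proof.
apply: continuous_subspaceT => x; apply: (@cvg_sumr _ _ (nbhs x) (nbhs_filter x)) => i.
by apply: cvgM; exact: coord_continuous.
Qed.

Let b_cont : {within closure Omega, continuous b}.
Proof.
have [_ cu _] := Cu; have [_ cP _] := CPhi.
apply/subspace_continuousP => x cx; rewrite /from_subspace.
move/subspace_continuousP: cu => /(_ x cx) cu; move/subspace_continuousP: cP => /(_ x cx) cP.
by apply: cvgD => //; apply: cvgM => //; exact: cvg_cst.
Qed.

Let S_cont : {within closure Omega, continuous S}.
Proof.
have [_ cu _] := Cu.
have hC i : {within closure Omega, continuous (h i)}.
  have [cG _] := GC i.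
  apply/subspace_continuousP => x cx; rewrite /from_subspace.
  move/subspace_continuousP: cG => /(_ x cx) cG.
  move/subspace_continuousP: b_cont => /(_ x cx) cb.
  apply: cvgB => //; apply: cvgM => //; apply: cvg_within_filter.
  exact: (C_open_continuous (CN i)).
apply/subspace_continuousP => x cx; rewrite /from_subspace.
move/subspace_continuousP: cu => /(_ x cx) cu.
move/subspace_continuousP: within_cst_dot => /(_ x cx) cd.
apply: cvgD; last by apply: cvgM => //; exact: cvg_cst.
apply: cvgD; last by apply: cvgM; [exact: cvg_cst|exact: cvgM].
rewrite /enorm; apply: (@cvg_comp _ _ _ (fun y => dot (hv y) (hv y)) Num.sqrt);
  last exact: sqrt_continuous.
have E y : dot (hv y) (hv y) = \sum_i h i y * h i y.
  by apply: eq_bigr => i _; rewrite mxE.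
under eq_fun do rewrite E; rewrite E.
apply: (@cvg_sumr R _ (within (closure Omega) (nbhs x)) _) => i.
have := hC i => /subspace_continuousP /(_ x cx) ci.
exact: cvgM.
Qed.

Let GbE (xi y : 'rV[R]_n) : \sum_i xi 0 i * G i y + -1 * (normal_part N xi y * b y)
    + eps ^+ 2 * (u y * u y) + K * dot y y =
  dot xi (hv y) + eps ^+ 2 * (u y * u y) + K * dot y y.
Proof.
congr (_ + _ + _); rewrite /normal_part mulr_suml mulr_sumr -big_split/=.
by apply: eq_bigr => i _; rewrite mxE /h; ring.
Qed.

Let b_le y : closure Omega y -> `|b y| <= M0 + cPhi.
Proof.
move=> cy; apply: le_trans (ler_normD _ _) _; rewrite mulNr normrN.
apply: lerD; first exact: bu.
have [_ cP _] := CPhi; apply: (closure_norm_le cP) => // x Ox.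
exact: (bPhi (s := [::])).
Qed.

(** The hypotheses of [boundary_max_bound] are checked for the derivatives extended to the closure.
    The alternative [e0 = 0] is separated because the tangency of [xi] is obtained by cancelling
    [e0]. *)
Let boundary_case (x0 xi : 'rV[R]_n) (e0 : R) : boundary Omega x0 -> 0 <= e0 -> dot xi xi = 1 ->
  hv x0 = e0 *: xi ->
  (forall y, closure Omega y ->
    \sum_i xi 0 i * G i y + -1 * (normal_part N xi y * b y)
      + eps ^+ 2 * (u y * u y) + K * dot y y <=
    \sum_i xi 0 i * G i x0 + -1 * (normal_part N xi x0 * b x0)
      + eps ^+ 2 * (u x0 * u x0) + K * dot x0 x0) ->
  dot (nu x0) (hv x0) = 0 ->
  kappa0 * e0 <= boundary_constant n%:R \/ e0 = 0.
Proof.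
move=> Bx0 e00 xi1 hE Wmax nh; have [->|e0n] := eqVneq e0 0; first by right.
left; have cx0 : closure Omega x0 by case: Bx0.
have [U [rho L2]] := LD Bx0.
have L1 : local_defining 1 Omega x0 U rho by exact: local_defining_le L2.
have NU i y : U y -> boundary Omega y -> N i y = unit_grad rho y 0 i.
  move=> Uy By; rewrite NE//; have [V [sig [L' ->]]] := hnu By.
  by rewrite (unit_grad_unique By L' (V := U) (sig := rho))//; have [[oU _] ? ? ? ?] := L1; split.
have nuE : nu x0 = unit_grad rho x0.
  by apply/rowP => i; rewrite -NE// NU//; have [[_ ]] := L1.
have gxi : dot (grad rho x0) xi = 0.
  move: nh; rewrite nuE hE dotZr dotZl => /eqP; rewrite mulf_eq0 (negPf e0n)/=.
  rewrite mulf_eq0 invr_eq0 gt_eqF ?enorm_gt0//; last exact: (grad_defining_neq0 L1).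
  by move/eqP.
have Cu' : C_open 2 Omega u by case: Cu.
have cu : {within closure Omega, continuous u} by case: Cu.
have /C_open_rec[_ _ pu] := Cu'.
have GE i y : Omega y -> G i y = partial i u y by have [_] := GC i; apply.
have CG i : C_open 1 Omega (G i).
  by apply: C_open_ext (pu i) => // y Oy; rewrite GE.
pose P := \row_i extension Omega (partial i Phi) x0.
have hk kappa : principal_curvature Omega x0 kappa -> kappa0 <= kappa by exact: kappa0P.
have hCN i : C_open 1 setT (N i) by exact: C_open_le (CN i).
have hEG i : expansion (closure Omega) (G i) x0 (\row_j GG i j x0).
  apply: (boundary_expansion (h := GG i) oO Bx0 L1 (proj1 (GC i)) (CG i)) => j.
    exact: (proj1 (GGC i j)).
  move=> y Oy; have [_ /(_ y Oy) E] := GGC i j; refine (etrans E _).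
  by apply: (@partial_ext R n Omega) => // z Oz; rewrite GE.
have hGG i j : GG i j x0 = GG j i x0.
  refine (@extension_eq R n Omega (partial j (partial i u)) (GG j i) x0
    (proj1 (GGC j i)) _ cx0) => y Oy.
  refine (etrans (proj2 (GGC j i) y Oy) _).
  exact: (@partial_commute R n Omega u i j y oO Cu' Oy).
have hEu : expansion (closure Omega) u x0 (\row_i G i x0).
  apply: (boundary_expansion (h := G) oO Bx0 L1 cu (C_open_le (isT : (1 <= 2)%N) Cu')) => // i.
  exact: (proj1 (GC i)).
have hEP : expansion (closure Omega) Phi x0 P.
  have [CP cP _] := CPhi.
  apply: (boundary_expansion (h := fun i => extension Omega (partial i Phi)) oO Bx0 L1 cP (C_open_le (isT : (1 <= 2)%N) CP)) => // i.
    exact: (proj1 (PC i)).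
  exact: (proj2 (PC i)).
have hbc y : boundary Omega y -> \sum_i G i y * N i y = - eps * u y + Phi y.
  move=> By; rewrite -bc//; apply: eq_bigr => i _.
  by rewrite NE// mxE.
have hGE i : G i x0 = e0 * xi 0 i + (- eps * u x0 + Phi x0) * N i x0.
  have := congr1 (fun M : 'rV[R]_n => M 0 i) hE; rewrite !mxE /h => <-.
  by rewrite /b; ring.
have hbN i j : `|partial j (N i) x0| <= cN by exact: (bN i (s := [:: j])).
have hbP : `|Phi x0| <= cPhi.
  have [_ cP _] := CPhi; apply: (closure_norm_le cP) => // x Ox.
  exact: (bPhi (s := [::])).
have hbdP j : `|P 0 j| <= cPhi.
  rewrite mxE; have [cj Ej] := PC j.
  apply: (closure_norm_le cj) => // x Ox; rewrite Ej//.
  exact: (bPhi (s := [:: j])).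
exact: (boundary_max_bound oO Bx0 L2 hk hCN NU hEG hGG hEu hEP hbc xi1 gxi e00 hGE
  eps01 K0 cN0 cPhi0 M00 hbN hbP hbdP (bu cx0) (fun j => bx j cx0) Wmax).
Qed.

(** One maximum point [x0] of [S] controls every [x]: the length of [hv x] is at most [S x <= S x0],
    where [e0] is bounded by the curvature argument and the other two terms by [M0 ^+ 2] and
    [K * (n%:R * dR ^+ 2)]. Adding [b x * N i x] back to [h i x] recovers the derivative of [u]. *)
Lemma gradient_estimate (x : 'rV[R]_n) (i : 'I_n) : closure Omega x ->
  `|extension Omega (partial i u) x| <=
    boundary_constant n%:R / kappa0 + M0 ^+ 2 + K * (n%:R * dR ^+ 2) + (M0 + cPhi) * cN.
Proof.
move=> cx; have cO0 : closure Omega !=set0 by exists x.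
have [x0 cx0 Smax] := EVT_max_rV cO0 (closure_compact bO) S_cont.
rewrite inE in cx0; have {}Smax y : closure Omega y -> S y <= S x0.
  by move=> cy; apply: Smax; rewrite inE.
have dR0 : 0 <= dR by exact: le_trans (bx i cx).
have bc0 : 0 <= boundary_constant n%:R.
  by rewrite /boundary_constant !addr_ge0 ?mulr_ge0 ?exprn_ge0 ?addr_ge0.
set e0 := enorm (hv x0).
have e0_le : e0 <= boundary_constant n%:R / kappa0.
  have [e00|e0n] := eqVneq e0 0; first by rewrite e00 divr_ge0// ltW.
  have h0 : hv x0 != 0.
    by apply: contra_neq e0n => h0; rewrite /e0 h0 /enorm dot0l sqrtr0.
  have e0p : 0 < e0 by exact: enorm_gt0.
  pose xi := e0^-1 *: hv x0.
  have xi1 : dot xi xi = 1 by exact: enorm_unit.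
  have hE : hv x0 = e0 *: xi by rewrite /xi scalerA divff ?scale1r.
  have Wmax y : closure Omega y ->
      dot xi (hv y) + eps ^+ 2 * (u y * u y) + K * dot y y <=
      dot xi (hv x0) + eps ^+ 2 * (u x0 * u x0) + K * dot x0 x0.
    have dE : dot xi (hv x0) = e0.
      by refine (etrans (congr1 (dot xi) hE) _); rewrite dotZr xi1 mulr1.
    move=> cy; have := Smax y cy; rewrite /S -/e0 dE.
    by apply: le_trans; rewrite !lerD2r; exact: dot_unit_le.
  have [Ox0|Bx0] := closure_open_cases oO cx0.
    exfalso; apply: (interior Ox0 (xi := xi)).
      by move=> j; apply: le_trans (coord_le_enorm _ _) _; rewrite /enorm xi1 sqrtr1.
    have TE y : Omega y -> test_function u Phi N xi eps K y =
        dot xi (hv y) + eps ^+ 2 * (u y * u y) + K * dot y y.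
      move=> Oy; rewrite -GbE; congr (_ + _ + _ + _); apply: eq_bigr => j _.
      by have [_ /(_ y Oy) ->] := GC j.
    by move=> y Oy; rewrite !TE//; apply: Wmax; exact: subset_closure.
  rewrite ler_pdivlMr// mulrC.
  have nh : dot (nu x0) (hv x0) = 0.
    have E : dot (nu x0) (grad_closure Omega u x0) = b x0.
      by rewrite dotC; exact: bc.
    have hvE : hv x0 = grad_closure Omega u x0 - b x0 *: nu x0.
      by apply/rowP => j; rewrite !mxE /h NE.
    have nu1 : dot (nu x0) (nu x0) = 1.
      have [V [sig [L' ->]]] := hnu Bx0; apply: enorm_unit.
      exact: (grad_defining_neq0 L').
    by rewrite hvE dotBr E dotZr nu1 mulr1 subrr.
  have [y cy|//|e00] := @boundary_case x0 xi e0 Bx0 (enorm_ge0 _) xi1 hE _ nh.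
    by rewrite !GbE; exact: Wmax.
  by move: e0n; rewrite e00 eqxx.
have h_le : `|h i x| <= e0 + M0 ^+ 2 + K * (n%:R * dR ^+ 2).
  have -> : h i x = hv x 0 i by rewrite mxE.
  apply: le_trans (coord_le_enorm _ _) _; apply: (@le_trans _ _ (S x)).
    rewrite /S -addrA lerDl; apply: addr_ge0; apply: mulr_ge0; rewrite ?sqr_ge0 ?dot_ge0//.
  apply: le_trans (Smax x cx) _; apply: lerD; first apply: lerD => //.
    have -> : eps ^+ 2 * (u x0 * u x0) = `|eps * u x0| ^+ 2.
      by rewrite real_normK ?num_real//; ring.
    by rewrite ler_sqr ?nnegrE// bu.
  rewrite ler_wpM2l// (_ : n%:R * _ = \sum_(j < n) dR ^+ 2); last first.
    by rewrite sumr_const card_ord mulr_natl.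
  apply: ler_sum => j _; rewrite -expr2 -(real_normK (num_real _)).
  by rewrite ler_sqr ?nnegrE// bx.
have -> : extension Omega (partial i u) x = h i x + b x * N i x by rewrite /h subrK.
apply: le_trans (ler_normD _ _) _; apply: lerD.
  by apply: le_trans h_le _; rewrite !lerD2r.
rewrite normrM ler_pM//; first exact: b_le.
exact: (bN i (s := [::])).
Qed.
End GradientEstimate.

Lemma enorm_le (R : realType) (n : nat) (v : 'rV[R]_n) (c : R) : 0 <= c ->
  (forall i, `|v 0 i| <= c) -> enorm v <= n%:R * c.
Proof.
move=> c0 vc; have [->|v0] := eqVneq v 0.
  by rewrite /enorm dot0l sqrtr0 mulr_ge0.
have := dot_enorm_le v c0 vc; rewrite ger0_norm ?dot_ge0// -enormE expr2.
by rewrite ler_pM2r// enorm_gt0.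
Qed.

(** The value of [K] is solved from the strict inequality required by [interior_not_max]: with it
    the right side there exceeds the left side by exactly [1]. *)
Definition barrier_constant (R : realType) (n p : nat) (cN cPhi cf M0 : R) : R :=
  (test_constant (n := n) cN cPhi M0 + 1 +
    (n%:R * cf + (n%:R * cN + 2 * M0) * cf + 1) * 'C(n, p)%:R / p%:R) / 2.

Unset Implicit Arguments.

Theorem theorem4p1 (R : realType) (n p k l : nat)
    (hn : (2 <= n)%N) (hp : (1 <= p <= n - 1)%N)
    (hlk : (l < k)%N) (hk : (k <= 'C(n, p))%N)
    (Omega : set 'rV[R]_n) (hOmega : C_domain 3 Omega)
    (hconv : strictly_convex Omega)
    (nu : 'rV[R]_n -> 'rV[R]_n)
    (hnu : forall x, boundary Omega x -> outer_unit_normal Omega x (nu x)) :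
  exists M1 : R -> R -> R -> R,
    forall (f phi u : 'rV[R]_n -> R) (eps M0 : R),
      let fr := fun x => f x `^ ((k - l)%:R^-1) in
      (forall x, closure Omega x -> 0 < f x) ->
      C_closure 1 Omega fr ->
      C_boundary 2 Omega phi ->
      0 < eps < 1 ->
      C_open 3 Omega u ->
      C_closure 2 Omega u ->
      admissible p k Omega u ->
      neumann_solution p k l Omega nu f phi eps u ->
      (forall x, closure Omega x -> `|eps * u x| <= M0) ->
      forall x, closure Omega x ->
        enorm (grad_closure Omega u x)
          <= M1 M0 (normC_boundary 2 Omega phi) (normC 1 Omega fr).
Proof.
have [kappa0 kappa00 kappa0P] := hconv.
have [N [CN NE]] := normal_field_extension hOmega hnu.
have [[_ oO _ bO] LD] := hOmega.
have p0 : 0 < p%:R :> R by rewrite ltr0n; case/andP: hp.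
have C0 : (0 < 'C(n, p))%N by exact: leq_ltn_trans (leq0n l) (leq_trans hlk hk).
pose cN := \sum_i normC 2 Omega (N i).
have CNc i : C_closure 2 Omega (N i) by exact: C_open_C_closure.
have cNi0 i : 0 <= normC 2 Omega (N i) by exact: normC_ge0.
have cN0 : 0 <= cN by exact: sumr_ge0.
have bN i s x : (size s <= 2)%N -> closure Omega x -> `|partials s (N i) x| <= cN.
  move=> s2; have [_ cNs] := CN i.
  apply: closure_norm_le => [|y Oy].
    by apply: continuous_subspaceT => y; exact: cNs.
  apply: (@le_trans _ _ (normC 2 Omega (N i))); first exact: partials_le_normC.
  by rewrite /cN (bigD1 i)//= lerDl sumr_ge0.
have [dR bx] : exists dR : R, forall x i, closure Omega x -> `|x 0 i| <= dR.
  have cn : {within closure Omega, continuous (fun x : 'rV[R]_n => `|x|)}.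
    by apply: continuous_subspaceT => x; exact: norm_continuous.
  have [d _ dP] := within_compact_bounded (closure_compact bO) cn.
  exists d => x i cx; apply: le_trans (norm_coord_le x i) _.
  by have := dP x cx; rewrite normr_id.
(* [N], [cN], [dR] and [kappa0] have been fixed from [Omega] alone, before [f], [phi], [u] and [eps]
   appear. The argument [a] stands for the norm of [phi], replaced by [a + 1] because of
   [normC_boundary_extension]; the outer factor [n] passes from a bound on each coordinate to the
   Euclidean norm. *)
exists (fun M0 a cf => let K := barrier_constant n p cN (a + 1) cf M0 in
  n%:R * (boundary_constant K cN (a + 1) M0 dR n%:R / kappa0 + M0 ^+ 2
    + K * (n%:R * dR ^+ 2) + (M0 + (a + 1)) * cN)).
move=> f phi u eps M0 fr f0 Cfr Cphi eps01 Cu3 Cu adm [eqn bc] bu x cx /=.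
have [Phi [CPhi PhiE nPhi]] := normC_boundary_extension bO Cphi.
set cPhi := normC_boundary 2 Omega phi + 1 in nPhi *.
set cf := normC 1 Omega fr; set K := barrier_constant _ _ _ _ _ _.
have cPhi0 : 0 <= cPhi by apply: le_trans nPhi; exact: normC_ge0.
have cf0 : 0 <= cf by exact: normC_ge0.
have M00 : 0 <= M0 by exact: le_trans (bu x cx).
have n0 : 0 <= n%:R :> R by [].
have s0 : 0 <= n%:R * cf + (n%:R * cN + 2 * M0) * cf.
  by rewrite addr_ge0 ?mulr_ge0 ?addr_ge0 ?mulr_ge0.
have CR0 : 0 < 'C(n, p)%:R :> R by rewrite ltr0n.
have KE : 2 * K - test_constant (n := n) cN cPhi M0 - 1 =
    (n%:R * cf + (n%:R * cN + 2 * M0) * cf + 1) * 'C(n, p)%:R / p%:R.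
  by rewrite /K /barrier_constant; field; rewrite gt_eqF.
have tail0 : 0 <= (n%:R * cf + (n%:R * cN + 2 * M0) * cf + 1) * 'C(n, p)%:R / p%:R.
  by rewrite divr_ge0 ?mulr_ge0 ?(ltW CR0) ?(ltW p0)// addr_ge0.
have K0 : 0 <= K.
  rewrite /K /barrier_constant divr_ge0// addr_ge0// addr_ge0//.
  exact: test_constant_ge0.
have bPhi s y : (size s <= 2)%N -> Omega y -> `|partials s Phi y| <= cPhi.
  by move=> s2 Oy; apply: le_trans nPhi; exact: partials_le_normC.
have int (y xi : 'rV[R]_n) : Omega y -> (forall i, `|xi 0 i| <= 1) ->
    ~ (forall z, Omega z ->
      test_function u Phi N xi eps K z <= test_function u Phi N xi eps K y).
  move=> Oy xi1; have cy : closure Omega y by exact: subset_closure.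
  have [CPo _ _] := CPhi; have [Cfo _ _] := Cfr; have [_ admG] := adm.
  apply: (interior_not_max hlk C0 oO Oy xi1 eps01 cN0 cPhi0 cf0 M00 Cu3 CPo _ Cfo admG).
  - by move=> i; exact: C_open_sub (CN i).
  - by move=> z Oz; rewrite eqn.
  - exact: bu.
  - by move=> s s2; exact: bPhi.
  - by move=> i s s2; exact: bN.
  - by move=> z Oz; exact: (partials_le_normC (s := [::]) bO Cfr).
  - by move=> i z Oz; exact: (partials_le_normC (s := [:: i]) bO Cfr).
  - by rewrite KE.
  - by rewrite KE mulfVK ?gt_eqF// mulfK ?gt_eqF// ltrDl.
have LD2 y : boundary Omega y ->
    exists (U : set 'rV[R]_n) (rho : 'rV[R]_n -> R), local_defining 2 Omega y U rho.
  move=> /LD[U [rho L]]; exists U, rho; exact: local_defining_le L.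
have bc' y : boundary Omega y -> dirder_closure Omega u (nu y) y = - eps * u y + Phi y.
  by move=> By; rewrite PhiE//; exact: bc.
have est i := gradient_estimate oO bO LD2 hnu kappa00 kappa0P CN NE Cu CPhi bc' eps01
  K0 cN0 cPhi0 M00 bN bPhi bu bx int i cx.
have dR0 : 0 <= dR by exact: le_trans (bx x (Ordinal (ltnW hn)) cx).
apply: enorm_le => [|i]; last by rewrite mxE.
exact: le_trans (normr_ge0 _) (est (Ordinal (ltnW hn))).
Qed.
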